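(* Let $n\ge 2$, let $u_t=K(t,x,u,u_1,\dots,u_n)$ be a scalar evolution equation with $K$ smooth and $\partial K/\partial u_n$ nowhere zero. The map induced by the vertical differential, $$d_V:\ H^{1,1}(\mathcal R^\infty)\big/d_V\big(H^{1,0}(\mathcal R^\infty)\big)\ \to\ \ker\Lambda ,$$ is an isomorphism, where $\Lambda:H^{1,2}(\mathcal R^\infty)\to H^{2,0}(\mathcal R^\infty)$ is the linear map described in the context. Moreover, sending a class to the function $Q$ of its unique representative of the form $dx\wedge\theta^0\cdot Q-dt\wedge\beta$, $\beta\in\Omega^{0,1}(\mathcal R^\infty)$, identifies the classes in $H^{1,1}(\mathcal R^\infty)$ that are nonzero in $H^{1,1}(\mathcal R^\infty)/d_V(H^{1,0}(\mathcal R^\infty))$ with the functions $Q\in C^\infty(\mathcal R^\infty)$ satisfying $$(\mathbf F_Q^*-\mathbf F_Q)(u_t-K)=\mathbf E\big(Q\,(u_t-K)\big)\quad\text{and}\quad \delta^E_V\big(dx\wedge\theta^0_E\cdot Q\big)\ne0 .$$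
   Context: Write $u_0=u$, $u_i=\partial_x^i u$; smooth functions depend on finitely many coordinates. $\mathcal R^\infty$ is the infinitely prolonged equation manifold of $u_t=K$, with coordinates $(t,x,u,u_1,u_2,\dots)$. On it $X=\partial_x+\sum_i u_{i+1}\partial_{u_i}$, $T=\partial_t+\sum_i X^i(K)\partial_{u_i}$, $\theta^i=du_i-X^i(K)\,dt-u_{i+1}\,dx$. $\Omega^{r,s}(\mathcal R^\infty)$ is the space of forms that are finite sums of a function times $r$ of the forms $dt,dx$ wedged with $s$ of the $\theta^i$. $X,T$ act on forms by Lie derivative (they annihilate $dt,dx$; $X(\theta^i)=\theta^{i+1}$). $d_H\omega=dx\wedge X(\omega)+dt\wedge T(\omega)$, $d_V=d-d_H$, $H^{r,s}(\mathcal R^\infty)=\ker(d_H|_{\Omega^{r,s}})/d_H(\Omega^{r-1,s})$; since $d_Hd_V=-d_Vd_H$, $d_V[\omega]=[d_V\omega]$ defines $d_V:H^{r,s}\to H^{r,s+1}$. Every class in $H^{1,1}(\mathcal R^\infty)$ has a unique representative of the form $dx\wedge\theta^0\cdot Q-dt\wedge\beta$. The map $\Lambda$: each $[\omega]\in H^{1,2}(\mathcal R^\infty)$ has a representative $\omega=d_V\eta$ with $\eta=dx\wedge\theta^0\cdot Q-dt\wedge\gamma$, $Q\in C^\infty(\mathcal R^\infty)$, $\gamma\in\Omega^{0,1}(\mathcal R^\infty)$; there is then $\lambda\in\Omega^{2,0}(\mathcal R^\infty)$ with $d_H\eta=d_V\lambda$, and $\Lambda([\omega])=[\lambda]$ is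 well defined. Functions of $(t,x,u,u_1,\dots)$ are also regarded as functions on $J^\infty(\mathbb R^2,\mathbb R)$ (coordinates $(t,x,u_{a,i})$, $u_{a,i}$ corresponding to $\partial_t^a\partial_x^iu$), with total derivatives $D_t,D_x$ and $\mathbf E(L)=\sum_{a,i}(-1)^{a+i}D_x^iD_t^a(\partial L/\partial u_{a,i})$. $\mathbf F_Q=\sum_i(\partial Q/\partial u_i)D_x^i$, $\mathbf F_Q^*(f)=\sum_i(-D_x)^i((\partial Q/\partial u_i)f)$. On $E=\mathbb R\times J^\infty(\mathbb R,\mathbb R)$ (coordinates $(t,x,u,u_1,\dots)$, functions identified with those on $\mathcal R^\infty$), $\theta^i_E=du_i-u_{i+1}dx$; $d_V^E$ is the anti-derivation with $d^E_Vf=\sum(\partial f/\partial u_i)\theta^i_E$, $d^E_V(dx)=0$, $d^E_V\theta^i_E=0$; $\delta_V^E=I_E\circ d_V^E$ where, for a form $\Sigma$ that is a sum of terms $f\,dx\wedge\theta_E^{i_1}\wedge\cdots\wedge\theta_E^{i_s}$, $I_E(\Sigma)=\frac1s\theta^0_E\wedge\sum_i(-D_x)^i(\partial_{u_i}\lrcorner\,\Sigma)$, with $D_x$ acting as a derivation, $D_x(dx)=0$, $D_x\theta^i_E=\theta^{i+1}_E$. *)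

(* Defs.v *)
From HB Require Import structures.
From mathcomp Require Import all_boot all_order all_algebra.
From mathcomp Require Import all_classical all_reals all_analysis.

Set Implicit Arguments.
Unset Strict Implicit.
Unset Printing Implicit Defensive.

Import Order.TTheory GRing.Theory Num.Theory.
Import numFieldNormedType.Exports.

Local Open Scope classical_set_scope.
Local Open Scope ring_scope.

(* A point is ((t, x), u), where u is the family of the fibre coordinates.
   I = nat :       coordinates (t, x, u_i) of E and of the equation manifold;
   I = nat * nat : coordinates (t, x, u_(a,i)) of J^oo(R^2, R). *)
Notation jet R I := (R^o * R^o * {ptws I -> R^o})%type.

Inductive coord (I : Type) := Ct | Cx | Cu of I.
Arguments Ct {I}.
Arguments Cx {I}.

Section Smooth.
Variables (R : realType) (I : choiceType).
Implicit Types (f : jet R I -> R^o) (p q : jet R I).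

Definition coord_val (c : coord I) p : R :=
  match c with Ct => p.1.1 | Cx => p.1.2 | Cu i => p.2 i end.

Definition coord_set (c : coord I) p (s : R) : jet R I :=
  match c with
  | Ct => ((s, p.1.2), p.2)
  | Cx => ((p.1.1, s), p.2)
  | Cu i => (p.1, fun j => if j == i then s else p.2 j)
  end.

Definition pd (c : coord I) f : jet R I -> R^o :=
  fun p => derive1 (fun s : R^o => f (coord_set c p s)) (coord_val c p).

Definition depends_on (S : pred I) f :=
  forall p q, p.1 = q.1 -> (forall i, S i -> p.2 i = q.2 i) -> f p = f q.

(* For f depending on finitely many coordinates, continuity in the product
   topology is joint continuity in these coordinates. *)
Fixpoint Ck (k : nat) f : Prop :=
  continuous f /\
  if k is k'.+1 then
    forall c : coord I,
      (forall p, derivable (fun s : R^o => f (coord_set c p s))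
                           (coord_val c p) 1)
      /\ Ck k' (pd c f)
  else True.

Definition smooth f :=
  (exists S : seq I, depends_on (mem S) f) /\ forall k, Ck k f.

End Smooth.

(* All infinite sums below are \sum_(i \in setT): at each point they have
   finitely many nonzero terms, because functions depend on finitely many
   coordinates and forms have finitely many coefficients. *)

Section Functions.
Variable R : realType.
Implicit Types (f Q K : jet R nat -> R^o) (g : jet R (nat * nat)%type -> R^o).

Definition Xfun f : jet R nat -> R^o :=
  fun p => pd Cx f p + \sum_(i \in [set: nat]) p.2 i.+1 * pd (Cu i) f p.

Definition Tfun K f : jet R nat -> R^o :=
  fun p => pd Ct f p + \sum_(i \in [set: nat]) iter i Xfun K p * pd (Cu i) f p.

Definition Dx g : jet R (nat * nat)%type -> R^o :=
  fun p => pd Cx g p +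
    \sum_(k \in [set: nat * nat]) p.2 (k.1, k.2.+1) * pd (Cu k) g p.

Definition Dt g : jet R (nat * nat)%type -> R^o :=
  fun p => pd Ct g p +
    \sum_(k \in [set: nat * nat]) p.2 (k.1.+1, k.2) * pd (Cu k) g p.

Definition Euler g : jet R (nat * nat)%type -> R^o :=
  fun p => \sum_(k \in [set: nat * nat])
    (-1) ^+ (k.1 + k.2) * iter k.2 Dx (iter k.1 Dt (pd (Cu k) g)) p.

(* a function of (t, x, u, u_1, ...) regarded as a function on J^oo(R^2, R) *)
Definition to_J f : jet R (nat * nat)%type -> R^o :=
  fun p => f (p.1, fun i => p.2 (0%N, i)).

(* the function u_t - K *)
Definition Delta K : jet R (nat * nat)%type -> R^o :=
  fun p => p.2 (1%N, 0%N) - to_J K p.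

Definition Fre Q g : jet R (nat * nat)%type -> R^o :=
  fun p => \sum_(i \in [set: nat]) to_J (pd (Cu i) Q) p * iter i Dx g p.

Definition Fre_adj Q g : jet R (nat * nat)%type -> R^o :=
  fun p => \sum_(i \in [set: nat])
    (-1) ^+ i * iter i Dx (fun q => to_J (pd (Cu i) Q) q * g q) p.

End Functions.

(* A form w of any bidegree is given by its coefficients in the coframe
   (dt, dx, theta^i):
     w = \sum_(a, b) dt^a /\ dx^b /\
           \sum_(i_1 < ... < i_s) w a b [:: i_1; ...; i_s]
                                  theta^(i_1) /\ ... /\ theta^(i_s)
   with w a b alternating in the list of indices. With theta^i read as
   theta^i_E, the forms without dt are the forms on E. *)
Notation bform R := (bool -> bool -> seq nat -> jet R nat -> R^o).

Section Forms.
Variable R : realType.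
Implicit Types (f Q K : jet R nat -> R^o) (w eta : bform R).
Implicit Types (c d : set (bform R)) (a b : bool) (l : seq nat).

(* Omega^{r,s}; alternation is stated for adjacent indices *)
Definition Omega (r s : nat) : set (bform R) := [set w : bform R |
  [/\ forall a b l, smooth (w a b l),
      forall a b l, (a + b != r)%N || (size l != s) -> w a b l = 0,
      forall a b l1 i j l2,
        w a b (l1 ++ i :: j :: l2) = - w a b (l1 ++ j :: i :: l2) &
      exists N, forall a b l, ~~ all (fun i => (i < N)%N) l -> w a b l = 0]].

Definition del (j : nat) (l : seq nat) : seq nat := take j l ++ drop j.+1 l.

Definition fun_form f : bform R :=
  fun a b l => if [&& ~~ a, ~~ b & nilp l] then f else 0.

Definition dx_wedge w : bform R :=
  fun a b l => if b then (-1) ^+ a *: w a false l else 0.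

Definition dt_wedge w : bform R :=
  fun a b l => if a then w false b l else 0.

Definition theta_wedge (k : nat) w : bform R := fun a b l =>
  (-1) ^+ (a + b) *:
    \sum_(j < size l | nth 0%N l j == k) (-1) ^+ j *: w a b (del j l).

(* interior product with the vector field d/du_k *)
Definition du_contract (k : nat) w : bform R := fun a b l =>
  (-1) ^+ (a + b) *: w a b (k :: l).

(* Lie derivative along X: X(theta^i) = theta^(i+1) *)
Definition Xform w : bform R := fun a b l p =>
  Xfun (w a b l) p +
  \sum_(j < size l | (0 < nth 0 l j)%N)
    w a b (set_nth 0%N l j (nth 0%N l j).-1) p.

(* Lie derivative along T: T(theta^i) = d_V (X^i(K)) *)
Definition Tform K w : bform R := fun a b l p =>
  Tfun K (w a b l) p +
  \sum_(j < size l) \sum_(k \in [set: nat])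
    pd (Cu (nth 0%N l j)) (iter k (@Xfun R) K) p * w a b (set_nth 0%N l j k) p.

Definition dH K w : bform R := dx_wedge (Xform w) + dt_wedge (Tform K w).

(* d - dH is the anti-derivation with f |-> \sum_i (df/du_i) theta^i, and it
   kills dt, dx and theta^i, since
   d theta^i = dx /\ theta^(i+1) + dt /\ d_V (X^i(K)) = dH theta^i.
   Hence it is \sum_i theta^i /\ (d/du_i acting on coefficients). On forms on
   E the same formula is d_V^E. *)
Definition dV w : bform R := fun a b l =>
  (-1) ^+ (a + b) *:
    \sum_(j < size l) (-1) ^+ j *: pd (Cu (nth 0%N l j)) (w a b (del j l)).

(* I_E on forms dx /\ (contact s-form); on forms on E, D_x is Xform *)
Definition IE (s : nat) w : bform R :=
  s%:R^-1 *: theta_wedge 0 (fun a b l p =>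
    \sum_(i \in [set: nat]) (-1) ^+ i * iter i Xform (du_contract i w) a b l p).

(* delta_V^E on forms dx /\ (contact s-form) *)
Definition deltaVE (s : nat) w : bform R := IE s.+1 (dV w).

(* Cohomology classes are cosets, as sets of forms. *)
Definition coset_mod (B : set (bform R)) w : set (bform R) :=
  [set w' | B (w' - w)].

Definition dH_closed K (r s : nat) : set (bform R) :=
  [set w | Omega r s w /\ dH K w = 0].

Definition dH_exact K (r s : nat) : set (bform R) :=
  if r is r'.+1 then dH K @` Omega r' s else [set 0].

Definition cls K (r s : nat) w : set (bform R) :=
  coset_mod (dH_exact K r s) w.

Definition Hcoh K (r s : nat) : set (set (bform R)) :=
  cls K r s @` dH_closed K r s.

(* the class a * c + d *)
Definition lin_class (a : R) c d : set (bform R) :=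
  [set a *: v + w | v in c & w in d].

(* d_V : H^{r,s} -> H^{r,s+1}, c |-> d_V(c) + d_H(Omega^{r-1,s+1}) *)
Definition dV_cls K (r s : nat) c : set (bform R) :=
  [set w | exists2 v, c v & dH_exact K r s.+1 (w - dV v)].

(* the coset c + d_V(H^{1,0}) in H^{1,1}, a set of classes *)
Definition mod_dV K c : set (set (bform R)) :=
  [set lin_class 1 c (dV_cls K 1 0 d) | d in Hcoh K 1 0].

Definition H11_mod_dV K : set (set (set (bform R))) := mod_dV K @` Hcoh K 1 1.

(* dx /\ theta^0 . Q - dt /\ beta *)
Definition normal_form Q w : bform R :=
  dx_wedge (theta_wedge 0 (fun_form Q)) - dt_wedge w.

(* the value l = [lambda] of Lambda at the class c = [dV eta] *)
Definition Lambda_graph K c (l : set (bform R)) : Prop :=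
  exists Q gamma lambda,
    [/\ smooth Q, Omega 0 1 gamma & Omega 2 0 lambda] /\
    [/\ c (dV (normal_form Q gamma)),
        dH K (normal_form Q gamma) = dV lambda &
        l = cls K 2 0 lambda].

(* A total function: its value would be the zero class on a class without a
   representative dV eta of the required form. *)
Definition Lambda K c : set (bform R) :=
  xget (cls K 2 0 0) [set l | Lambda_graph K c l].

Definition ker_Lambda K : set (set (bform R)) :=
  [set c | Hcoh K 1 2 c /\ Lambda K c = cls K 2 0 0].

(* the function Q of the representative dx /\ theta^0 . Q - dt /\ beta of c *)
Definition char_fun c : jet R nat -> R^o :=
  xget 0 [set Q | smooth Q /\
                  exists2 beta, Omega 0 1 beta & c (normal_form Q beta)].

End Forms.

(* Main.v *)
Require Import Defs.
From HB Require Import structures.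
From mathcomp Require Import all_boot all_order all_algebra.
From mathcomp Require Import all_classical all_reals all_analysis.
From mathcomp Require Import ring.

Set Implicit Arguments.
Unset Strict Implicit.
Unset Printing Implicit Defensive.

Import Order.TTheory GRing.Theory Num.Theory.
Import numFieldNormedType.Exports.

Local Open Scope classical_set_scope.
Local Open Scope ring_scope.

(** The forms on the equation manifold are encoded by their coefficients in
    the coframe (dt, dx, theta^i).  Writing a form of bidegree (1, s) as
    dx /\ A + dt /\ B, with A and B contact forms of degree s, it is
    dH-closed iff T A = X B, it is dH-exact iff (A, B) = (X rho, T rho), and
    dV acts on A and B by the vertical differential d, up to sign.  The
    theorem is then a diagram chase with the commuting operators X, T and d,
    which rests on four facts.

    - Vertical exactness ([poincare], [poincare0]): d A = 0 implies A = d B in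
      positive degree; a function without vertical differential depends on
      (t, x) only, and is T g for another such g.

    - X is injective on contact forms of positive degree ([XV_inj]).  Hence
      a primitive rho of d A = X rho is itself d-closed, hence d-exact.

    - Integration by parts ([bypartsP], [euler_XV]): every contact tensor is
      theta^0 times its interior Euler operator plus an X-derivative, and
      the Euler operator kills X-derivatives.  So the Euler operator decides
      exactness modulo X.  In degree 1 this gives the representatives
      dx /\ theta^0 . Q - dt /\ beta, and in degree 2 it is I_E.

    - Conserved contact forms of degree at least 3 are X-exact
      ([conserved_vform_exact]).  The Euler operator turns T A in im X
      into the adjoint linearised equation
      T P + \sum_i (-X)^i ((dK/du_i) P) = 0 for P = E(A).  A solution P
      with at least two contact indices vanishes, because n >= 2 and dK/du_n is
      nowhere zero: the symbol of this equation is dK/du_n times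
      xi_1^n + xi_2^n + ..., restricted to xi_1 + xi_2 + ... = 0, which is not
      the zero polynomial ([adjoint_inj]).

    The last fact shows that d A is X-exact for every class dx /\ A + dt /\ B
    in H^{1,2}; by the first two the class is then represented by dV eta with
    eta in normal form ([H12_representative]), so Lambda is defined
    everywhere.  The first two facts also give that Lambda is well defined
    ([Lambda_well_defined]) and that the kernel of dV on H^{1,1} is
    dV(H^{1,0}) ([dV_kernel]).  If Lambda kills [dV eta], then dH eta = dV dH mu
    for some mu, so eta + dV mu is closed and has the same image: the induced
    map is onto ker Lambda.

    For the second part, T (Q theta^0) is X-exact iff Q solves the adjoint
    linearised equation ([conserved_charP]), and a direct computation on
    J^oo(R^2, R) gives
    F_Q^*(u_t - K) - F_Q(u_t - K) - E(Q (u_t - K)) = T Q + F_K^*(Q)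
    ([char_equationP]).  The class of Q lies in dV(H^{1,0}) iff d (Q theta^0)
    is X-exact, which is what delta_V^E tests ([deltaVE_exactP]).

    The analysis behind these facts is an antiderivative operator
    f |-> \int_0^1 u_c f(.., t u_c, ..) dt in each coordinate c, which
    preserves smoothness and commutes with the other partial derivatives.
    It provides the vertical exactness, and also the symmetry of second
    partial derivatives ([pd_comm]). *)

(** * Cosets of a submodule *)
Section Cosets.
Variables (R : pzRingType) (V : lmodType R).
Implicit Types (B Z O : set V) (v w x y : V) (D : V -> V).

Record submodule B : Prop := Submodule {
  submodule0 : B 0;
  submoduleB : forall x y, B x -> B y -> B (x - y);
  submoduleZ : forall r x, B x -> B (r *: x) }.

Lemma submoduleN B x : submodule B -> B x -> B (- x).
Proof. by move=> sB Bx; rewrite -sub0r; exact: (submoduleB sB (submodule0 sB) Bx). Qed.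

Lemma submoduleD B x y : submodule B -> B x -> B y -> B (x + y).
Proof.
by move=> sB Bx By; rewrite -[y]opprK; apply: submoduleB => //; apply: submoduleN.
Qed.

Definition coset B v : set V := [set w | B (w - v)].

Lemma coset_refl B v : submodule B -> coset B v v.
Proof. by move=> sB; rewrite /coset /= subrr; apply: submodule0. Qed.

Lemma coset_eqP B v w : submodule B -> coset B v = coset B w <-> B (v - w).
Proof.
move=> sB; split=> [e|Bvw]; first by have := coset_refl v sB; rewrite e.
apply/seteqP; split=> x /= Bx; rewrite /coset /=.
  by have := submoduleD sB Bx Bvw; rewrite addrA subrK.
by have := submoduleB sB Bx Bvw; rewrite opprB addrA subrK.
Qed.

Lemma coset_lin B (r : R) v w : submodule B ->
  [set r *: x + y | x in coset B v & y in coset B w] = coset B (r *: v + w).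
Proof.
move=> sB; apply/seteqP; split=> [_ [x hx [y hy <-]]|x hx].
  rewrite /coset /= opprD addrACA -scalerBr.
  by apply: submoduleD => //; apply: submoduleZ.
exists v; first exact: coset_refl.
exists (x - r *: v); last by rewrite addrC subrK.
by move: hx; rewrite /coset /= opprD addrA.
Qed.

Lemma coset_map B B' O D v : submodule B -> submodule B' -> submodule O ->
  B `<=` O -> O v ->
  (forall x y, O x -> O y -> D (x - y) = D x - D y) ->
  (forall x, B x -> B' (D x)) ->
  [set w | exists2 x, coset B v x & B' (w - D x)] = coset B' (D v).
Proof.
move=> sB sB' sO BO Ov DB DBB'; apply/seteqP; split=> [w [x hx hw]|w hw].
  have Ox : O x by rewrite -[x](subrK v); apply: submoduleD => //; apply: BO.
  have := submoduleD sB' hw (DBB' _ hx).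
  by rewrite DB // addrA subrK.
by exists v; [exact: coset_refl|exact: hw].
Qed.

(** The coset of v in the quotient of V / B by the image of D, as a set of
    cosets of B. *)
Definition translates B Z D v : set (set V) := [set coset B (v + D x) | x in Z].

Lemma translates_eqP B Z D v w : submodule B -> submodule Z ->
  (forall x y, Z x -> Z y -> D (x - y) = D x - D y) ->
  translates B Z D v = translates B Z D w <->
  exists2 x, Z x & B (v - w - D x).
Proof.
move=> sB sZ DB.
have Z0 := submodule0 sZ.
have D0 : D 0 = 0 by have := DB _ _ Z0 Z0; rewrite !subrr.
have DN x : Z x -> D (- x) = - D x by move=> Zx; rewrite -sub0r DB // D0 sub0r.
have DD x y : Z x -> Z y -> D (x + y) = D x + D y.
  by move=> Zx Zy; rewrite -[y]opprK DB ?DN ?opprK //; exact: submoduleN.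
have sub a b : (exists2 x, Z x & B (a - b - D x)) ->
    translates B Z D a `<=` translates B Z D b.
  move=> [x Zx Bx] _ [y Zy <-]; exists (y + x); first exact: submoduleD.
  apply/coset_eqP => //; rewrite DD //.
  have -> : b + (D y + D x) - (a + D y) = - (a - b - D x); last exact: submoduleN.
  by rewrite [D y + _]addrC addrA opprD addrACA subrr addr0 !opprB addrA [b + _]addrC.
split=> [e|[x Zx Bx]].
  have : translates B Z D v (coset B v) by exists 0 => //; rewrite D0 addr0.
  rewrite e => -[x Zx /esym/coset_eqP h]; exists x => //.
  by rewrite -addrA -opprD; apply: h.
apply/seteqP; split; apply: sub; first by exists x.
exists (- x); first exact: submoduleN.
by have := submoduleN sB Bx; rewrite DN // opprB opprB addrC opprK.
Qed.

End Cosets.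

(** * The algebra of functions on the equation manifold *)

(** All that the cohomological argument uses of the smooth functions on the
    equation manifold of u_t = K: [pu i] is the derivation d/du_i, [tdx] and
    [tdt] are X and T, [rhs] is K, and [primu i] is an antiderivative in u_i.
    The bracket [d/du_i, X] = d/du_(i-1) is [pu_tdx]; the bracket of d/du_i
    with T is [pu_tdt].  Working over this interface keeps smoothness out of
    the algebra. *)
Record evolution_algebra := EvolutionAlgebra {
  fn :> comNzRingType;
  pu : nat -> {additive fn -> fn};
  tdx : {additive fn -> fn};
  tdt : {additive fn -> fn};
  rhs : fn;
  rhs_order : nat;
  primu : nat -> {additive fn -> fn};
  pu_mul : forall i f g, pu i (f * g) = pu i f * g + f * pu i g;
  tdx_mul : forall f g, tdx (f * g) = tdx f * g + f * tdx g;
  tdt_mul : forall f g, tdt (f * g) = tdt f * g + f * tdt g;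
  pu_comm : forall i j f, pu i (pu j f) = pu j (pu i f);
  pu_fin : forall f, exists N, forall i, (N <= i)%N -> pu i f = 0;
  pu_tdx : forall i f,
    pu i (tdx f) = tdx (pu i f) + (if i is i'.+1 then pu i' f else 0);
  pu_tdt : forall N i f, (forall k, (N <= k)%N -> pu k f = 0) ->
    pu i (tdt f) =
      tdt (pu i f) + \sum_(k < N) pu i (iter k tdx rhs) * pu k f;
  tdx_tdt : forall f, tdx (tdt f) = tdt (tdx f);
  pu_primu : forall i f, pu i (primu i f) = f;
  pu_primu_neq : forall i j f, i != j -> pu j (primu i f) = primu i (pu j f);
  base_primitive : forall f, (forall i, pu i f = 0) ->
    exists2 g, forall i, pu i g = 0 & tdt g = f;
  torsion_free : forall k (f : fn), f *+ k.+1 = 0 -> f = 0;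
  order_ge2 : (2 <= rhs_order)%N;
  pu_rhs : forall i, (rhs_order < i)%N -> pu i rhs = 0;
  separant_regular : forall f, pu rhs_order rhs * f = 0 -> f = 0 }.

(** * Contact tensors and the operators X, T and d_V *)
Section Tensors.
Variable J : evolution_algebra.
Notation pu := (@pu J).
Notation primu := (@primu J).
Notation X := (@tdx J).
Notation T := (@tdt J).
Notation n := (rhs_order J).
Implicit Types (f g : J) (A B C P : seq nat -> J) (i j k N s : nat) (l : seq nat).

(** The matrix of T on contact forms: T(theta^i) = d_V (X^i K) is the sum of the
    [linrhs k i] theta^k. *)
Definition linrhs i k : J := pu i (iter k X (rhs J)).

(** A contact form of degree s is given by its coefficients, indexed by lists
    of length s; [slot i] is the contraction with d/du_i.  Alternation is not
    built in: X, T and d_V are defined on all tensors by recursion on the first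
    index, and most identities then follow by induction on the list. *)
Definition slot i A : seq nat -> J := fun l => A (i :: l).
Definition scal f A : seq nat -> J := fun l => f * A l.
Definition puV i A : seq nat -> J := fun l => pu i (A l).

Fixpoint xlie l A : J :=
  if l is i :: l' then
    xlie l' (slot i A) + (if i is i'.+1 then A (i' :: l') else 0)
  else X (A [::]).
Definition XV A : seq nat -> J := xlie^~ A.

(** The row [linrhs i] of T has infinitely many nonzero entries, so the sum over
    k is finite only because A vanishes on large indices; N is any bound for
    them (see [TV_widen]). *)
Fixpoint tlie N l A : J :=
  if l is i :: l' then
    tlie N l' (slot i A) + \sum_(k < N) linrhs i k * A (nat_of_ord k :: l')
  else T (A [::]).
Definition TV N A : seq nat -> J := (tlie N)^~ A.

Fixpoint dlie l A : J :=
  if l is i :: l' then pu i (A l') - dlie l' (slot i A) else 0.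
Definition dvert A : seq nat -> J := dlie^~ A.

Definition bounded N A := forall l, ~~ all (fun i => (i < N)%N) l -> A l = 0.
Definition degree s A := forall l, size l != s -> A l = 0.
Definition alternating A := forall l1 i j l2,
  A (l1 ++ i :: j :: l2) = - A (l1 ++ j :: i :: l2).

Definition vform s A :=
  [/\ degree s A, alternating A & exists N, bounded N A].

Definition pred_slot i A : seq nat -> J := if i is i'.+1 then slot i' A else 0.

Lemma slotE i l A : A (i :: l) = slot i A l. Proof. by []. Qed.

Lemma slotD i A B : slot i (A + B) = slot i A + slot i B. Proof. by []. Qed.
Lemma slotN i A : slot i (- A) = - slot i A. Proof. by []. Qed.
Lemma slotB i A B : slot i (A - B) = slot i A - slot i B. Proof. by []. Qed.
Lemma slot0 i : slot i 0 = 0. Proof. by []. Qed.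

Lemma eq_slot A B : A [::] = B [::] -> (forall i, slot i A = slot i B) -> A = B.
Proof. by move=> h0 h; apply/funext => -[|i l]; rewrite ?h0 ?slotE ?h. Qed.

Lemma XV_nil A : XV A [::] = X (A [::]). Proof. by []. Qed.
Lemma slot_XV i A : slot i (XV A) = XV (slot i A) + pred_slot i A.
Proof. by apply/funext => l; rewrite addrfctE; case: i. Qed.

Lemma slot_XV0 A : slot 0 (XV A) = XV (slot 0 A).
Proof. by rewrite slot_XV addr0. Qed.

Lemma XV_is_additive : nmod_morphism XV.
Proof.
split.
  apply/funext => l; rewrite /XV; elim: l => [|i l IH] /=; first by rewrite raddf0.
  by rewrite slot0 IH; case: i => *; rewrite addr0.
move=> A B; apply/funext => l; rewrite /XV.
elim: l A B => [|i l IH] A B /=; first by rewrite raddfD.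
rewrite slotD IH !addrfctE /=; case: i => [|i]; first by rewrite !addr0.
by rewrite addrACA.
Qed.
HB.instance Definition _ := GRing.isNmodMorphism.Build _ _ XV XV_is_additive.

Lemma slot_scal i f A : slot i (scal f A) = scal f (slot i A). Proof. by []. Qed.

Lemma scal0l A : scal 0 A = 0.
Proof. by apply/funext => l; rewrite /scal mul0r. Qed.
Lemma scal0r f : scal f 0 = 0.
Proof. by apply/funext => l; rewrite /scal mulr0. Qed.

Lemma XV_scal f A : XV (scal f A) = scal (X f) A + scal f (XV A).
Proof.
apply/funext => l; rewrite /XV; elim: l A => [|i l IH] A.
  by rewrite /= tdx_mul.
rewrite /= slot_scal IH !addrfctE /scal /=; case: i => [|i].
  by rewrite !addr0.
by rewrite mulrDr addrA.
Qed.

Lemma slot_TV N i A :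
  slot i (TV N A) = TV N (slot i A) + \sum_(k < N) scal (linrhs i k) (slot k A).
Proof. by apply/funext => l; rewrite addrfctE fct_sumE. Qed.

Lemma TV_nil N A : TV N A [::] = T (A [::]). Proof. by []. Qed.

Lemma TV_is_additive N : nmod_morphism (TV N).
Proof.
split.
  apply/funext => l; rewrite /TV; elim: l => [|i l IH] /=; first by rewrite raddf0.
  by rewrite slot0 IH big1 ?addr0 // => k _; rewrite mulr0.
move=> A B; apply/funext => l; rewrite /TV.
elim: l A B => [|i l IH] A B /=; first by rewrite raddfD.
rewrite slotD IH !addrfctE /= addrACA -big_split /=; congr (_ + _ + _).
by apply: eq_bigr => k _; rewrite mulrDr.
Qed.
HB.instance Definition _ N :=
  GRing.isNmodMorphism.Build _ _ (TV N) (TV_is_additive N).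

Lemma TV_scal N f A : TV N (scal f A) = scal (T f) A + scal f (TV N A).
Proof.
apply/funext => l; rewrite /TV; elim: l A => [|i l IH] A.
  by rewrite /= tdt_mul.
rewrite /= slot_scal IH !addrfctE /scal /= -addrA mulrDr mulr_sumr.
by do 2!congr (_ + _); apply: eq_bigr => k _; rewrite mulrCA.
Qed.

Lemma dvert_nil A : dvert A [::] = 0. Proof. by []. Qed.
Lemma slot_dvert i A : slot i (dvert A) = puV i A - dvert (slot i A).
Proof. by []. Qed.

Lemma slot_puV i j A : slot i (puV j A) = puV j (slot i A). Proof. by []. Qed.

Lemma puV_is_additive i : nmod_morphism (puV i).
Proof.
by split=> [|A B]; apply/funext => l; rewrite /puV ?raddf0 // raddfD.
Qed.
HB.instance Definition _ i :=
  GRing.isNmodMorphism.Build _ _ (puV i) (puV_is_additive i).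

Lemma dvert_is_additive : nmod_morphism dvert.
Proof.
split.
  apply/funext => l; rewrite /dvert; elim: l => [|i l IH] //=.
  by rewrite slot0 IH raddf0 subr0.
move=> A B; apply/funext => l; rewrite /dvert.
elim: l A B => [|i l IH] A B /=; first by rewrite addrfctE /= addr0.
by rewrite slotD IH !addrfctE /= raddfD /= opprD addrACA.
Qed.
HB.instance Definition _ :=
  GRing.isNmodMorphism.Build _ _ dvert dvert_is_additive.

(** The exterior product of d_V f with A. *)
Fixpoint dwedge f l A : J :=
  if l is i :: l' then pu i f * A l' - dwedge f l' (slot i A) else 0.

Lemma dvert_scal f A l : dvert (scal f A) l = dwedge f l A + f * dvert A l.
Proof.
rewrite /dvert; elim: l A => [|i l IH] A /=; first by rewrite mulr0 addr0.
rewrite slot_scal IH {1}/scal pu_mul; ring.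
Qed.

Lemma boundedW N N' A : (N <= N')%N -> bounded N A -> bounded N' A.
Proof.
move=> le bA l hl; apply: bA; apply: contra hl; apply: sub_all => i h.
exact: leq_trans h le.
Qed.

Lemma bounded_slot N A i : bounded N A -> bounded N (slot i A).
Proof. by move=> bA l hl; apply: bA; rewrite /= negb_and hl orbT. Qed.

Lemma bounded_slot0 N A i : bounded N A -> (N <= i)%N -> slot i A = 0.
Proof. by move=> bA hi; apply/funext => l; apply: bA; rewrite /= negb_and -leqNgt hi. Qed.

Lemma boundedP N A : (forall i, bounded N (slot i A)) ->
  (forall i, (N <= i)%N -> slot i A = 0) -> bounded N A.
Proof.
move=> h1 h2 [|i l] //=; rewrite negb_and -leqNgt => /orP[hi|hl].
  by rewrite slotE h2.
exact: h1.
Qed.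

Lemma boundedD N A B : bounded N A -> bounded N B -> bounded N (A + B).
Proof. by move=> hA hB l hl; rewrite addrfctE hA ?hB ?addr0. Qed.
Lemma boundedN N A : bounded N A -> bounded N (- A).
Proof. by move=> hA l hl; rewrite opprfctE hA ?oppr0. Qed.
Lemma boundedB N A B : bounded N A -> bounded N B -> bounded N (A - B).
Proof. by move=> hA hB; apply/boundedD/boundedN. Qed.
Lemma bounded_scal N f A : bounded N A -> bounded N (scal f A).
Proof. by move=> hA l hl; rewrite /scal hA ?mulr0. Qed.
Lemma bounded_sum N m (F : nat -> seq nat -> J) :
  (forall k, (k < m)%N -> bounded N (F k)) -> bounded N (\sum_(k < m) F k).
Proof.
move=> h; elim: m h => [|m IH] h; first by rewrite big_ord0.
rewrite big_ord_recr /=; apply: boundedD; last exact: h.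
by apply: IH => k hk; apply/h/ltnW.
Qed.

Lemma bounded_XV N A : bounded N A -> bounded N.+1 (XV A).
Proof.
move=> + l; rewrite /XV; elim: l A => [|i l IH] A bA //=.
rewrite negb_and -leqNgt => /orP[hi|hl].
  rewrite (bounded_slot0 bA) ?(ltnW hi) // -[xlie _ _]/(XV 0 l) raddf0 add0r.
  by case: i hi => [|i] // hi; rewrite slotE (bounded_slot0 bA).
rewrite IH ?add0r //; last exact: bounded_slot.
case: i => // i; apply: bA; rewrite /= negb_and; apply/orP; right.
by apply: contra hl; apply: sub_all => k /leqW.
Qed.

Lemma linrhsS i k : linrhs i k.+1 =
  X (linrhs i k) + (if i is i'.+1 then linrhs i' k else 0).
Proof. by rewrite /linrhs /= pu_tdx. Qed.

(** X^k K has order k + n, its separant is that of K, and its next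
    coefficient picks up k times the X-derivative of the separant. *)
Lemma linrhs_big i k : (k + n < i)%N -> linrhs i k = 0.
Proof.
elim: k i => [|k IH] i hi; first by rewrite /linrhs /= pu_rhs.
rewrite linrhsS IH ?raddf0 ?add0r; last by apply: leq_ltn_trans hi; rewrite leq_add2r.
by case: i hi => // i hi; rewrite IH.
Qed.

Lemma linrhs_top k : linrhs (k + n) k = pu n (rhs J).
Proof.
elim: k => [|k IH] //; rewrite linrhsS linrhs_big ?raddf0 ?add0r // ltn_add2r.
Qed.

Lemma linrhs_subtop m k : n = m.+1 ->
  linrhs (k + m) k = pu m (rhs J) + X (pu n (rhs J)) *+ k.
Proof.
move=> nm; elim: k => [|k IH]; first by rewrite addr0.
rewrite addSn linrhsS IH -addnS -nm linrhs_top mulrSr; ring.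
Qed.

Lemma linrhs_sym i j k : pu i (linrhs j k) = pu j (linrhs i k).
Proof. exact: pu_comm. Qed.

Lemma bounded_TV N A : bounded N A -> bounded (N + n).+1 (TV N A).
Proof.
move=> + l; rewrite /TV; elim: l A => [|i l IH] A bA //=.
rewrite negb_and -leqNgt => /orP[hi|hl].
  rewrite (bounded_slot0 bA); last by apply: leq_trans hi; rewrite -addnS leq_addr.
  rewrite -[tlie _ _ _]/(TV N 0 l) raddf0 add0r big1 // => k _.
  by rewrite linrhs_big ?mul0r // (leq_trans _ hi) // ltnS leq_add2r ltnW.
rewrite IH ?add0r //; last exact: bounded_slot.
rewrite big1 // => k _; rewrite bA ?mulr0 //= negb_and; apply/orP; right.
by apply: contra hl; apply: sub_all => j hj; rewrite ltnS (leq_trans (ltnW hj)) ?leq_addr.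
Qed.

Lemma TV_widen N N' A : bounded N A -> (N <= N')%N -> TV N' A = TV N A.
Proof.
move=> bA le; apply/funext => l; rewrite /TV; elim: l A bA => [|i l IH] A bA //=.
rewrite IH; last exact: bounded_slot.
congr (_ + _); rewrite -(subnKC le) big_split_ord /= addrC big1 ?add0r // => k _.
by rewrite slotE (bounded_slot0 bA) ?mulr0 ?leq_addr.
Qed.

Lemma degree_slot s A i : degree s.+1 A -> degree s (slot i A).
Proof. by move=> dA l hl; apply: dA. Qed.
Lemma degreeP s A :
  A [::] = 0 -> (forall i, degree s (slot i A)) -> degree s.+1 A.
Proof. by move=> h0 h [|i l] //= hl; apply: h. Qed.
Lemma degreeD s A B : degree s A -> degree s B -> degree s (A + B).
Proof. by move=> hA hB l hl; rewrite addrfctE hA ?hB ?addr0. Qed.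
Lemma degreeN s A : degree s A -> degree s (- A).
Proof. by move=> hA l hl; rewrite opprfctE hA ?oppr0. Qed.
Lemma degreeB s A B : degree s A -> degree s B -> degree s (A - B).
Proof. by move=> hA hB; apply/degreeD/degreeN. Qed.
Lemma degree_scal s f A : degree s A -> degree s (scal f A).
Proof. by move=> hA l hl; rewrite /scal hA ?mulr0. Qed.
Lemma degree0_slot A i : degree 0 A -> slot i A = 0.
Proof. by move=> hA; apply/funext => l; apply: hA. Qed.

Lemma degree_XV s A : degree s A -> degree s (XV A).
Proof.
move=> + l; rewrite /XV; elim: l s A => [|i l IH] s A dA /= hl.
  by rewrite dA ?raddf0.
case: s dA hl => [|s] dA hl.
  rewrite degree0_slot // -[xlie _ _]/(XV 0 l) raddf0 add0r.
  by case: i => // i; apply: dA.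
rewrite (IH s) ?add0r //; last exact: degree_slot.
by case: i => // i; apply: dA.
Qed.

Lemma degree_TV N s A : degree s A -> degree s (TV N A).
Proof.
move=> + l; rewrite /TV; elim: l s A => [|i l IH] s A dA /= hl.
  by rewrite dA ?raddf0.
case: s dA hl => [|s] dA hl.
  rewrite degree0_slot // -[tlie _ _ _]/(TV N 0 l) raddf0 add0r.
  by rewrite big1 // => k _; rewrite dA ?mulr0.
rewrite (IH s) ?add0r //; last exact: degree_slot.
by rewrite big1 // => k _; rewrite dA ?mulr0.
Qed.

Lemma degree_dvert s A : degree s A -> degree s.+1 (dvert A).
Proof.
move=> + l; rewrite /dvert; elim: l s A => [|i l IH] s A dA //= hl.
rewrite dA ?raddf0 ?sub0r; last by apply: contra hl.
case: s dA hl => [|s] dA hl.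
  by rewrite degree0_slot // -[dlie _ _]/(dvert 0 l) raddf0 oppr0.
by rewrite (IH s) ?oppr0 //; exact: degree_slot.
Qed.

Lemma alternating_slot A i : alternating A -> alternating (slot i A).
Proof. by move=> aA l1 j k l2; rewrite /slot -cat_cons aA. Qed.
Lemma alternating_slot2 A i j : alternating A ->
  slot j (slot i A) = - slot i (slot j A).
Proof. by move=> aA; apply/funext => l; apply: (aA [::]). Qed.
Lemma alternating0 : alternating (0 : seq nat -> J).
Proof. by move=> l1 i j l2; rewrite /= oppr0. Qed.
Lemma alternatingD A B : alternating A -> alternating B -> alternating (A + B).
Proof. by move=> hA hB l1 i j l2; rewrite !addrfctE hA hB opprD. Qed.
Lemma alternatingN A : alternating A -> alternating (- A).
Proof. by move=> hA l1 i j l2; rewrite !opprfctE hA. Qed.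
Lemma alternatingB A B : alternating A -> alternating B -> alternating (A - B).
Proof. by move=> hA hB; apply/alternatingD/alternatingN. Qed.
Lemma alternating_scal f A : alternating A -> alternating (scal f A).
Proof. by move=> hA l1 i j l2; rewrite /scal hA mulrN. Qed.
Lemma alternating_puV i A : alternating A -> alternating (puV i A).
Proof. by move=> hA l1 j k l2; rewrite /puV hA raddfN. Qed.
Lemma alternating_sum m (F : nat -> seq nat -> J) :
  (forall k, alternating (F k)) -> alternating (\sum_(k < m) F k).
Proof.
move=> h; elim: m => [|m IH]; first by rewrite big_ord0; apply: alternating0.
by rewrite big_ord_recr /=; apply: alternatingD.
Qed.

Lemma alternating_low s A : degree s A -> (s < 2)%N -> alternating A.
Proof.
move=> dA hs l1 i j l2; rewrite !dA ?oppr0 // size_cat /= !addnS;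
by case: s hs {dA} => [|[|]].
Qed.

Lemma alternating_pred_slot i A : alternating A -> alternating (pred_slot i A).
Proof.
by case: i => [|i] aA; [apply: alternating0 | apply: alternating_slot].
Qed.

Lemma pred_slot_slot i j A : slot j (pred_slot i A) =
  if i is i'.+1 then slot j (slot i' A) else 0.
Proof. by case: i. Qed.

Lemma alternating_XV A : alternating A -> alternating (XV A).
Proof.
move=> aA l1; elim: l1 A aA => [|c l1 IH] A aA i j l2.
  suff H : slot j (slot i (XV A)) = - slot i (slot j (XV A)).
    by move/(congr1 (@^~ l2)): H.
  rewrite !slot_XV !slotD !slot_XV !pred_slot_slot (alternating_slot2 i j aA).
  rewrite raddfN !opprD -!addrA; congr (_ + _); rewrite addrC.
  by case: i j => [|i] [|j] /=; rewrite ?oppr0 ?opprK //;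
     rewrite -?(alternating_slot2 _ _ aA) ?addr0 ?add0r.
rewrite !cat_cons slotE [in RHS]slotE !slot_XV !addrfctE opprD.
rewrite (IH _ (alternating_slot c aA)); congr (_ + _).
exact: alternating_pred_slot.
Qed.

Lemma alternating_TV N A : alternating A -> alternating (TV N A).
Proof.
move=> aA l1; elim: l1 A aA => [|c l1 IH] A aA i j l2.
  suff H : slot j (slot i (TV N A)) = - slot i (slot j (TV N A)).
    by move/(congr1 (@^~ l2)): H.
  have slot_sum m (F : 'I_N -> seq nat -> J) :
      slot m (\sum_k F k) = \sum_k slot m (F k).
    by apply/funext => l; rewrite /slot !fct_sumE.
  rewrite !slot_TV !slotD !slot_TV !slot_sum (alternating_slot2 i j aA).
  rewrite raddfN !opprD -!addrA; congr (_ + _); rewrite addrC.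
  by congr (_ + _); rewrite -sumrN; apply: eq_bigr => k _;
    apply/funext => l; rewrite opprfctE /scal /slot (aA [::]) /= mulrN.
rewrite !cat_cons slotE [in RHS]slotE !slot_TV !addrfctE opprD.
rewrite (IH _ (alternating_slot c aA)); congr (_ + _).
rewrite [LHS](@alternating_sum N (fun k => scal (linrhs c k) (slot k A))) //.
by move=> k; apply/alternating_scal/alternating_slot.
Qed.

Lemma alternating_dvert A : alternating A -> alternating (dvert A).
Proof.
move=> aA l1; elim: l1 A aA => [|c l1 IH] A aA i j l2.
  suff H : slot j (slot i (dvert A)) = - slot i (slot j (dvert A)).
    by move/(congr1 (@^~ l2)): H.
  rewrite !slot_dvert !slotB !slot_dvert (alternating_slot2 i j aA).
  rewrite raddfN !slot_puV; apply/funext => l.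
  rewrite !(addrfctE, opprfctE); ring.
rewrite !cat_cons slotE [in RHS]slotE !slot_dvert !addrfctE !opprfctE opprD.
rewrite (IH _ (alternating_slot c aA)); congr (_ + _).
exact: alternating_puV.
Qed.

Lemma puV_XV i A : puV i (XV A) = XV (puV i A) + puV i.-1 (if i is 0 then 0 else A).
Proof.
apply/funext => l; rewrite addrfctE /XV /puV.
elim: l A => [|j l IH] A /=; first by rewrite pu_tdx; case: i => [|i] //=; rewrite raddf0.
rewrite raddfD IH /= -!addrA; congr (_ + _); rewrite addrC.
by case: i {IH} => [|i]; case: j => [|j] //=; rewrite ?raddf0.
Qed.

Lemma puV_dvert i A : puV i (dvert A) = dvert (puV i A).
Proof.
apply/funext => l; rewrite /dvert /puV; elim: l A => [|j l IH] A /=; first by rewrite raddf0.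
by rewrite raddfB /= IH pu_comm.
Qed.

(** Only the symmetry of second derivatives is used: the formula for d_V is a
    complex on all tensors. *)
Lemma dvert_dvert A : dvert (dvert A) = 0.
Proof.
apply/funext => l; elim: l A => [|i l IH] A //.
rewrite slotE !slot_dvert raddfB /= puV_dvert opprB addrCA subrr addr0.
exact: IH.
Qed.

Lemma dvert_XV A : dvert (XV A) = XV (dvert A).
Proof.
apply/funext => l; elim: l A => [|i l IH] A; first by rewrite XV_nil dvert_nil raddf0.
rewrite slotE [RHS]slotE slot_dvert !slot_XV slot_dvert puV_XV.
rewrite !raddfB /= !raddfD /= !(addrfctE, opprfctE) /= IH.
case: i => [|i] /=; first by rewrite !raddf0 /= !addr0.
rewrite slot_dvert !(addrfctE, opprfctE) /=; ring.
Qed.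

(** The matrix m acting on one slot of A at a time, as T does with [linrhs].
    It appears when d/du_i is moved past T. *)
Fixpoint coef_lie N (m : nat -> nat -> J) l A : J :=
  if l is i :: l' then
    coef_lie N m l' (slot i A) + \sum_(k < N) m i k * A (nat_of_ord k :: l')
  else 0.

Definition dep_below N A := forall i l, (N <= i)%N -> pu i (A l) = 0.

Lemma dep_slot N A i : dep_below N A -> dep_below N (slot i A).
Proof. by move=> h j l hj; apply: h. Qed.

Lemma puV_TV N i A l : dep_below N A ->
  pu i (TV N A l) = TV N (puV i A) l + \sum_(k < N) linrhs i k * pu k (A l)
    + coef_lie N (fun j k => pu i (linrhs j k)) l A.
Proof.
elim: l A => [|j l IH] A dA.
  by rewrite !TV_nil /= addr0 (@pu_tdt _ N) // => k hk; apply: dA.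
have -> B : TV N B (j :: l) =
    TV N (slot j B) l + \sum_(k < N) linrhs j k * B (nat_of_ord k :: l) by [].
rewrite raddfD /= IH; last exact: dep_slot.
rewrite raddf_sum /=.
under [X in _ + X = _]eq_bigr do rewrite pu_mul.
rewrite big_split /= /puV /slot; ring.
Qed.

Lemma dwedgeN f l A : dwedge f l (- A) = - dwedge f l A.
Proof.
elim: l A => [|i l IH] A /=; first by rewrite oppr0.
by rewrite slotN IH opprfctE mulrN opprB opprK addrC.
Qed.

(** The rows of [linrhs] are gradients, [linrhs_sym]; together with the
    alternation of A this is what makes T commute with d_V. *)
Lemma coef_lie_dwedge N i l A : alternating A ->
  coef_lie N (fun j k => pu i (linrhs j k)) l A =
  \sum_(k < N) dwedge (linrhs i k) l (slot k A).
Proof.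
elim: l A => [|j l IH] A aA /=; first by rewrite big1.
rewrite IH; last exact: alternating_slot.
rewrite addrC -big_split /=; apply: eq_bigr => k _.
rewrite linrhs_sym; congr (_ + _).
by rewrite alternating_slot2 // dwedgeN.
Qed.

Lemma dvert_TV N A : alternating A -> dep_below N A ->
  dvert (TV N A) = TV N (dvert A).
Proof.
move=> + + ; move=> aA dA; apply/funext => l.
elim: l A aA dA => [|i l IH] A aA dA; first by rewrite TV_nil dvert_nil raddf0.
rewrite slotE [RHS]slotE slot_dvert !slot_TV slot_dvert.
rewrite raddfB raddfD /= raddf_sum /= !(addrfctE, opprfctE) /=.
rewrite IH; [|exact: alternating_slot|exact: dep_slot].
rewrite !fct_sumE [puV _ _ l]puV_TV // coef_lie_dwedge //.
under [in X in _ - (_ + X)]eq_bigr do rewrite dvert_scal.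
under [in RHS]eq_bigr do rewrite slot_dvert /scal !(addrfctE, opprfctE) mulrBr.
rewrite big_split sumrB /= /puV /slot; ring.
Qed.

(** The bracket [X, T] = 0 on functions extends to tensors because
    d/du_i (X (X^k K)) = X (d/du_i X^k K) + d/du_(i-1) X^k K. *)
Lemma XV_TV N A : bounded N A -> XV (TV N.+1 A) = TV N.+1 (XV A).
Proof.
move=> bA; apply/funext => l; elim: l A bA => [|i l IH] A bA.
  by rewrite !XV_nil !TV_nil XV_nil tdx_tdt.
rewrite slotE [RHS]slotE !(slot_XV, slot_TV) !raddfD /= raddf_sum /=.
have -> : pred_slot i (TV N.+1 A) = TV N.+1 (pred_slot i A) +
   \sum_(k < N.+1) scal (if i is i'.+1 then linrhs i' k else 0) (slot k A).
  case: i => [|i] /=; last by rewrite slot_TV.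
  rewrite raddf0 add0r big1 // => k _.
  by apply/funext => l'; rewrite /scal mul0r.

rewrite !(addrfctE) /= IH; last exact: bounded_slot.
rewrite !fct_sumE.
under eq_bigr => k _ do rewrite XV_scal addrfctE.
under [X in _ = _ + X]eq_bigr => k _ do rewrite slot_XV /scal addrfctE mulrDr.
rewrite !big_split /=.
have -> : \sum_(k < N.+1) linrhs i k * pred_slot k A l =
  \sum_(k < N.+1) linrhs i k.+1 * A (nat_of_ord k :: l).
  rewrite [LHS]big_ord_recl [RHS]big_ord_recr /= mulr0 add0r.
  by rewrite (bA (_ :: _)) ?mulr0 ?addr0 //= ltnn.
under [X in _ = _ + (_ + X)]eq_bigr => k _ do rewrite linrhsS mulrDl.
rewrite big_split /= /scal /slot; ring.
Qed.

(** If the slots above j vanish, the slot j + 1 of X A is the slot j of A. *)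
Lemma XV_inj N A : A [::] = 0 -> bounded N A -> XV A = 0 -> A = 0.
Proof.
move=> A0 bA XA0; apply: eq_slot => // i; rewrite slot0.
have H m j : (N <= j + m)%N -> slot j A = 0.
  elim: m j => [|m IH] j; first by rewrite addn0 => /(bounded_slot0 bA).
  rewrite addnS -addSn => /IH hj.
  have /= : slot j.+1 (XV A) = 0 by rewrite XA0.
  by rewrite slot_XV hj raddf0 add0r.
by apply: (H N); rewrite leq_addl.
Qed.

Fixpoint swap_entries m l : seq nat :=
  match m, l with
  | 0, i :: j :: l' => j :: i :: l'
  | m'.+1, i :: l' => i :: swap_entries m' l'
  | _, _ => l
  end.

Definition swapV m A : seq nat -> J := fun l => A (swap_entries m l).

Lemma swap_entries_cat l1 i j l2 :
  swap_entries (size l1) (l1 ++ i :: j :: l2) = l1 ++ j :: i :: l2.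
Proof. by elim: l1 => //= a l1 ->. Qed.

Lemma XV_swap m A : XV (swapV m A) = swapV m (XV A).
Proof.
apply/funext => l; elim: m l A => [|m IH] [|i l] A //; last first.
  by rewrite slotE slot_XV addrfctE [slot i _]/(swapV m (slot i A)) IH; case: i.
case: l => [|j l].
  by case: i.
rewrite -[LHS]/(slot j (slot i (XV (swapV 0 A))) l).
rewrite -[RHS]/(slot i (slot j (XV A)) l) !slot_XV !slotD !slot_XV !addrfctE.
rewrite [slot j (slot i (swapV 0 A))]/(slot i (slot j A)) -!addrA; congr (_ + _).
by rewrite addrC; case: i => [|i]; case: j => [|j].
Qed.

Lemma size_swap_entries m l : size (swap_entries m l) = size l.
Proof. by elim: m l => [|m IH] [|i [|j l]] //=; rewrite IH. Qed.

Lemma all_swap_entries p m l : all p (swap_entries m l) = all p l.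
Proof.
elim: m l => [|m IH] [|i l] //=; last by rewrite IH.
by case: l => [|j l] //=; rewrite andbCA.
Qed.

(** X commutes with permutations of the slots and is injective, so a tensor
    whose X-derivative alternates is itself alternating.  Reductions modulo X
    may therefore leave the alternating tensors. *)
Lemma alternating_of_XV N s A : bounded N A -> degree s.+1 A ->
  alternating (XV A) -> alternating A.
Proof.
move=> bA dA aXA l1 i j l2.
have [szl|szl] := eqVneq (size (l1 ++ i :: j :: l2)) s.+1; last first.
  by rewrite !dA ?oppr0 //; apply: contra szl; rewrite !size_cat.
suff /(congr1 (@^~ (l1 ++ i :: j :: l2))) : A + swapV (size l1) A = 0.
  by rewrite addrfctE /swapV swap_entries_cat => /eqP; rewrite addr_eq0 => /eqP.
have bS : bounded N (swapV (size l1) A).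
  by move=> l hl; apply: bA; rewrite all_swap_entries.
apply: (@XV_inj N); [|exact: boundedD|].
  by rewrite addrfctE /swapV dA // dA ?addr0 // size_swap_entries.
rewrite raddfD /= XV_swap; apply/funext => l; rewrite addrfctE /swapV.
have [szl'|szl'] := eqVneq (size l) s.+1; last first.
  by rewrite !(degree_XV dA) ?addr0 // size_swap_entries.
have hl : ((size l1).+1 < size l)%N.
  by rewrite szl' -szl size_cat /= !addnS !ltnS leq_addr.
have [l1' [a [b [l2' [-> <-]]]]] : exists l1' a b l2',
    l = l1' ++ a :: b :: l2' /\ size l1' = size l1.
  exists (take (size l1) l), (nth 0%N l (size l1)), (nth 0%N l (size l1).+1).
  exists (drop (size l1).+2 l); rewrite size_takel ?(ltnW (ltnW hl)) //.
  by rewrite -!drop_nth ?(ltnW hl) // cat_take_drop.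
by rewrite swap_entries_cat aXA addNr.
Qed.

(** * Integration by parts and the interior Euler operator *)
Definition nX A := - XV A.
Definition euler N A : seq nat -> J := \sum_(i < N) iter i nX (slot i A).

Lemma nX0 : nX 0 = 0. Proof. by rewrite /nX raddf0 oppr0. Qed.
Lemma iter_nX_additive m : {morph iter m nX : A B / A + B}.
Proof. by elim: m => [|m IH] A B //=; rewrite IH /nX raddfD opprD. Qed.
Lemma iter_nX0 m : iter m nX 0 = 0.
Proof. by elim: m => //= m ->; exact: nX0. Qed.

Lemma eulerD N A B : euler N (A + B) = euler N A + euler N B.
Proof.
by rewrite /euler -big_split; apply: eq_bigr => i _; rewrite slotD iter_nX_additive.
Qed.

Lemma euler_widen N N' A : bounded N A -> (N <= N')%N -> euler N' A = euler N A.
Proof.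
move=> bA le; rewrite /euler -(subnKC le) big_split_ord /= [X in _ + X]big1 ?addr0 //.
by move=> k _; rewrite (bounded_slot0 bA) ?leq_addr // iter_nX0.
Qed.

(** The contraction of X A with d/du_i is X of the contraction plus the
    contraction with d/du_(i-1), so the alternating sum telescopes. *)
Lemma euler_XV N A : bounded N A -> euler N.+1 (XV A) = 0.
Proof.
move=> bA; suff : forall m, euler m.+1 (XV A) = - iter m.+1 nX (slot m A).
  by move->; rewrite (bounded_slot0 bA) // iter_nX0 oppr0.
elim=> [|m IH].
  by rewrite /euler big_ord1 /= slot_XV0 /nX opprK.
rewrite /euler big_ord_recr -/(euler m.+1 _) IH slot_XV iter_nX_additive.
rewrite [pred_slot _ _]/= -[LHS]/(- iter m.+1 nX (slot m A) +
  (iter m.+1 nX (XV (slot m.+1 A)) + iter m.+1 nX (slot m A))) addrCA addNr addr0 [in RHS]iterSr -[nX (slot _ _)]/(- XV _).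
have -> B : iter m.+1 nX (- B) = - iter m.+1 nX B.
  by apply/eqP; rewrite -addr_eq0 -iter_nX_additive addNr iter_nX0.
by rewrite opprK.
Qed.

(** The tensor product of theta^0 with P. *)
Definition theta0 P : seq nat -> J := fun l =>
  if l is 0%N :: l' then P l' else 0.

Lemma slotS_theta0 P i : slot i.+1 (theta0 P) = 0. Proof. by []. Qed.

(** The remainder of the integration by parts: solving
    A_(j+1) = X C_(j+1) + C_j downwards gives C_j = \sum_m (-X)^m A_(j+1+m). *)
Definition byparts N A : seq nat -> J := fun l =>
  if l is j :: l' then (\sum_(m < N) iter m nX (slot (j + m).+1 A)) l' else 0.

Lemma slot_byparts N j A :
  slot j (byparts N A) = \sum_(m < N) iter m nX (slot (j + m).+1 A).
Proof. by []. Qed.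

Lemma bypartsP N A : A [::] = 0 -> bounded N A ->
  A = theta0 (euler N A) + XV (byparts N A).
Proof.
move=> A0 bA; apply: eq_slot => [|i]; first by rewrite A0 addrfctE /= add0r raddf0.
rewrite slotD slot_XV slot_byparts.
have nXsum (F : nat -> seq nat -> J) m :
    XV (\sum_(k < m) iter k nX (F k)) = - \sum_(k < m) iter k.+1 nX (F k).
  by rewrite raddf_sum -sumrN; apply: eq_bigr => k _; rewrite /= /nX opprK.
rewrite (nXsum (fun k => slot (i + k).+1 A)).
pose G m := iter m nX (slot (i + m) A).
have GN : G N = 0 by rewrite /G (bounded_slot0 bA) ?leq_addl ?iter_nX0.
have tel : \sum_(k < N) G k = slot i A + \sum_(k < N) G k.+1.
  have := erefl (\sum_(k < N.+1) G k).
  by rewrite {1}big_ord_recr big_ord_recl /= GN addr0 {2}/G addn0.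
have -> : \sum_(k < N) iter k.+1 nX (slot (i + k).+1 A) = \sum_(k < N) G k.+1.
  by apply: eq_bigr => k _; rewrite /G addnS.
have -> : slot i (theta0 (euler N A)) + (- \sum_(k < N) G k.+1 + pred_slot i (byparts N A))
   = \sum_(k < N) G k - \sum_(k < N) G k.+1.
  rewrite addrCA addrC; congr (_ - _); case: i @G GN tel => [|i] G GN tel.
    by rewrite addr0.
  rewrite slotS_theta0 add0r /pred_slot slot_byparts.
  by apply: eq_bigr => k _; rewrite /G addSn.
by rewrite tel addrK.
Qed.

Lemma bounded_iter_nX m N A : bounded N A -> bounded (N + m) (iter m nX A).
Proof.
by elim: m => [|m IH] bA; rewrite ?addn0 // addnS; apply/boundedN/bounded_XV/IH.
Qed.

Lemma bounded_byparts N A : bounded N A -> bounded (N + N) (byparts N A).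
Proof.
move=> bA; apply: boundedP => i; rewrite slot_byparts.
  apply: (@bounded_sum _ _ (fun k => iter k nX (slot (i + k).+1 A))) => k hk.
  apply: (@boundedW (N + k)); first by rewrite leq_add2l ltnW.
  exact/bounded_iter_nX/bounded_slot.
move=> hi; rewrite big1 // => k _; rewrite (bounded_slot0 bA) ?iter_nX0 //.
by rewrite (leq_trans (leq_addr N N)) // (leq_trans hi) // -addnS leq_addr.
Qed.

Lemma degree_iter_nX m s A : degree s A -> degree s (iter m nX A).
Proof. by move=> dA; elim: m => //= m IH; apply/degreeN/degree_XV. Qed.

Lemma degree_sum s m (F : nat -> seq nat -> J) :
  (forall k, degree s (F k)) -> degree s (\sum_(k < m) F k).
Proof.
move=> h; elim: m => [|m IH]; first by rewrite big_ord0.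
by rewrite big_ord_recr /=; apply: degreeD.
Qed.

Lemma degree_byparts N s A : degree s.+1 A -> degree s.+1 (byparts N A).
Proof.
move=> dA; apply: degreeP => // i; rewrite slot_byparts.
apply: (@degree_sum _ _ (fun k => iter k nX (slot (i + k).+1 A))) => k.
exact/degree_iter_nX/degree_slot.
Qed.

Lemma degree_euler N s A : degree s.+1 A -> degree s (euler N A).
Proof.
move=> dA; apply: (@degree_sum _ _ (fun k => iter k nX (slot k A))) => k.
exact/degree_iter_nX/degree_slot.
Qed.

Lemma bounded_euler N A : bounded N A -> bounded (N + N) (euler N A).
Proof.
move=> bA; apply: (@bounded_sum _ _ (fun k => iter k nX (slot k A))) => k hk.
apply: (@boundedW (N + k)); first by rewrite leq_add2l ltnW.
exact/bounded_iter_nX/bounded_slot.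
Qed.

Lemma bounded_theta0 N P : bounded N P -> bounded N.+1 (theta0 P).
Proof.
move=> bP; apply: boundedP => [[|i]|[|i]] //.
  exact: boundedW bP.
Qed.

(** * The adjoint linearised equation *)

(** The adjoint of the linearisation of u_t = K, up to sign. *)
Definition adjoint N P : seq nat -> J :=
  TV N P + \sum_(i < n.+1) iter i nX (scal (pu i (rhs J)) P).

(** Modulo X a tensor is theta^0 times P = E(A), and T commutes with X, so
    E (T A) is computed from T (theta^0) = \sum_i (dK/du_i) theta^i alone. *)
Lemma euler_TV N N' A : A [::] = 0 -> bounded N A -> (N + N < N')%N ->
  forall N2, ((N' + n).+1 < N2)%N ->
  euler N2 (TV N' A) = adjoint N' (euler N A).
Proof.
move=> A0 bA hN N2 hN2.
have bC := bounded_byparts bA.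
rewrite {1}(bypartsP A0 bA) raddfD /= eulerD.
have -> : euler N2 (TV N' (XV (byparts N A))) = 0.
  case: N' hN hN2 => // N' hN hN2.
  have bC' : bounded N' (byparts N A) by apply: boundedW bC.
  rewrite -XV_TV //; case: N2 hN2 => // N2; rewrite !ltnS => hN2.
  apply: euler_XV; apply: boundedW (bounded_TV (boundedW (leqnSn _) bC')).
  exact: hN2.
rewrite addr0 /euler /adjoint -/(euler N A).
have hsl i : slot i (TV N' (theta0 (euler N A))) =
    (if i is 0 then TV N' (euler N A) else 0) + scal (pu i (rhs J)) (euler N A).
  rewrite slot_TV; case: N' hN {hN2} => // N' hN; rewrite big_ord_recl big1 ?addr0.
    by case: i => [|i]; rewrite ?slotS_theta0 ?raddf0.
  by move=> k _; apply/funext => l; rewrite /scal /= mulr0.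
under eq_bigr do rewrite hsl iter_nX_additive.
rewrite big_split /=; congr (_ + _).
  case: N2 hN2 {hsl} => // N2 _; rewrite big_ord_recl big1 ?addr0 // => k _.
  exact: iter_nX0.
have le : (n.+1 <= N2)%N by apply: leq_trans (ltnW hN2); rewrite ltnS leq_addl.
rewrite -(subnKC le) big_split_ord /= [X in _ + X]big1 ?addr0 // => k _.
by rewrite pu_rhs ?leq_addr // scal0l -iterS iter_nX0.
Qed.

(** The two leading slots of X^m P when the slots of P above i vanish. *)
Lemma iter_XV_top m i P : (forall j, (i < j)%N -> slot j P = 0) ->
  [/\ forall j, (i + m < j)%N -> slot j (iter m XV P) = 0,
      slot (i + m) (iter m XV P) = slot i P &
      slot (i + m) (iter m.+1 XV P) = pred_slot i P + XV (slot i P) *+ m.+1].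
Proof.
move=> hP; elim: m => [|m [IH1 IH2 IH3]].
  rewrite addn0; split => //=; by rewrite slot_XV addrC mulr1n.
have H1 j : (i + m.+1 < j)%N -> slot j (iter m.+1 XV P) = 0.
  case: j => // j; rewrite addnS ltnS => hj.
  by rewrite iterS slot_XV /= !IH1 ?raddf0 ?addr0 // ltnW.
have H2 : slot (i + m.+1) (iter m.+1 XV P) = slot i P.
  by rewrite iterS addnS slot_XV /= IH1 ?raddf0 ?add0r.
split => //.
by rewrite iterS addnS slot_XV -addnS H2 addnS /pred_slot IH3 addrCA -mulrS.
Qed.

Lemma iter_nXE m A :
  iter m nX A = if odd m then - iter m XV A else iter m XV A.
Proof.
elim: m => //= m ->; rewrite /nX; case: (odd m) => //=.
by rewrite raddfN opprK.
Qed.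

Lemma tensor_torsion_free k A : A *+ k.+1 = 0 -> A = 0.
Proof.
move=> h; apply/funext => l; apply: (@torsion_free J k).
by move/(congr1 (@^~ l)): h; rewrite natmulfctE.
Qed.

Lemma scal_separant A : scal (pu n (rhs J)) A = 0 -> A = 0.
Proof.
move=> h; apply/funext => l; apply: separant_regular.
exact: (congr1 (@^~ l) h).
Qed.

(** In the slot i + n, T P contributes (dK/du_n) P_i, and so does
    (-X)^n ((dK/du_n) P) when n is even. *)
Lemma adjoint_top_even N i P : ~~ odd n -> bounded N P ->
  (forall j, (i < j)%N -> slot j P = 0) -> adjoint N P = 0 -> slot i P = 0.
Proof.
move=> en bP hP h0; have [hN|hN] := leqP N i; first exact: bounded_slot0 bP hN.
have : slot (i + n) (adjoint N P) = 0 by rewrite h0.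
have n0 : (0 < n)%N := ltnW (order_ge2 J).
have npos : (i < i + n)%N by rewrite -{1}(addn0 i) ltn_add2l.
have hs f j : (i < j)%N -> slot j (scal f P) = 0.
  by move=> hj; rewrite slot_scal hP //; apply/funext => l; rewrite /scal mulr0.
rewrite /adjoint slotD slot_TV (hP _ npos) raddf0 add0r.
rewrite (bigD1 (Ordinal hN)) //= linrhs_top big1 ?addr0; last first.
  move=> k hk; have [ki|ki] := ltnP k i.
    by rewrite linrhs_big ?ltn_add2r // scal0l.
  rewrite -slot_scal hs // ltn_neqAle ki andbT eq_sym.
  by apply: contra hk => /eqP ki'; apply/eqP/val_inj.
rewrite big_ord_recr /= slotD iter_nXE (negbTE en).
have -> m : slot m (\sum_(k < n) iter k nX (scal (pu k (rhs J)) P)) =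
    \sum_(k < n) slot m (iter k nX (scal (pu k (rhs J)) P)).
  by apply/funext => l; rewrite /slot !fct_sumE.
rewrite big1 ?add0r; last first.
  move=> k _; rewrite iter_nXE; have [h1 _ _] := iter_XV_top k (hs (pu k (rhs J))).
  by case: odd; rewrite ?slotN h1 ?oppr0 // ltn_add2l.
have [_ -> _] := iter_XV_top n (hs (pu n (rhs J))).
by rewrite slot_scal -mulr2n => /tensor_torsion_free/scal_separant.
Qed.

Lemma linrhs_sum_subtop m N i P : n = m.+1 -> (i < N)%N ->
  (forall j, (i < j)%N -> slot j P = 0) ->
  \sum_(k < N) scal (linrhs (i + m) k) (slot k P) =
  scal (pu m (rhs J) + X (pu n (rhs J)) *+ i) (slot i P)
    + scal (pu n (rhs J)) (pred_slot i P).
Proof.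
move=> en iN hP; rewrite (bigD1 (Ordinal iN)) //= (linrhs_subtop _ en).
congr (_ + _).
have hk (k : 'I_N) : k != Ordinal iN -> (i <= k)%N -> slot k P = 0.
  by move=> ne ik; apply: hP; rewrite ltn_neqAle ik andbT eq_sym.
case: i iN hP hk => [|i] iN hP hk.
  by rewrite scal0r big1 // => k /hk ->; rewrite ?scal0r.
rewrite (bigD1 (Ordinal (ltnW iN))) /=; last by rewrite -val_eqE /= ltn_eqF.
rewrite addSnnS -en linrhs_top big1 ?addr0 // => k /andP[k1 k2].
have [ki|ki] := leqP i.+1 k; first by rewrite hk ?scal0r.
rewrite linrhs_big ?scal0l // ltn_add2r ltn_neqAle -ltnS ki andbT.
exact: k2.
Qed.

(** The top index b + 1 of B determines the index b through
    X (K_n B)_(b+1) = X (K_n B_(b+1)) + K_n B_b, where K_n = dK/du_n; so all of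
    B vanishes. *)
Lemma separant_chain f B m N : B [::] = 0 -> bounded N B ->
  scal f B = XV (scal (pu n (rhs J)) B) *+ m.+1 -> B = 0.
Proof.
move=> B0 bB hB; apply: eq_slot => // i; rewrite slot0.
(* Descending induction on j, the slots from N on being zero. *)
have H k j : (N <= j + k)%N -> slot j B = 0.
  elim: k j => [|k IH] j; first by rewrite addn0 => /(bounded_slot0 bB).
  rewrite addnS -addSn => /IH hj; apply/scal_separant/(@tensor_torsion_free m).
  have := congr1 (slot j.+1) hB.
  have -> : slot j.+1 (XV (scal (pu n (rhs J)) B) *+ m.+1) =
    slot j.+1 (XV (scal (pu n (rhs J)) B)) *+ m.+1.
    by apply/funext => l; rewrite /slot !natmulfctE.
  rewrite slot_XV !slot_scal hj !scal0r raddf0 add0r.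
  exact: esym.
by apply: (H N); rewrite leq_addl.
Qed.

(** For n odd the two contributions in the slot i + n cancel.  In the slot
    i + n - 1 those of P_(i-1) cancel too, and what remains is
    n X (K_n P_i) = (2 K_(n-1) + i X(K_n)) P_i, with K_j = dK/du_j; the
    remaining contact index of P_i then forces P_i = 0. *)
Lemma adjoint_top_odd N i P : odd n -> bounded N P -> slot i P [::] = 0 ->
  (forall j, (i < j)%N -> slot j P = 0) -> adjoint N P = 0 -> slot i P = 0.
Proof.
move=> on bP Pi0 hP h0.
have [hN|hN] := leqP N i; first exact: bounded_slot0 bP hN.
have [m en] : exists m, n = m.+1 by case: n (order_ge2 J) => // m _; exists m.
have m0 : (0 < m)%N by have := order_ge2 J; rewrite en.
have om : odd m = false by move: on; rewrite en /=; case: odd.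
have npos : (i < i + m)%N by rewrite -{1}(addn0 i) ltn_add2l.
have hs f j : (i < j)%N -> slot j (scal f P) = 0.
  by move=> hj; rewrite slot_scal hP // scal0r.
have : slot (i + m) (adjoint N P) = 0 by rewrite h0.
rewrite /adjoint slotD slot_TV (hP _ npos) raddf0 add0r.
rewrite (linrhs_sum_subtop en hN hP).
set K1 := pu n (rhs J); set K0 := pu m (rhs J).
have -> : slot (i + m) (\sum_(k < n.+1) iter k nX (scal (pu k (rhs J)) P)) =
    \sum_(k < n.+1) slot (i + m) (iter k nX (scal (pu k (rhs J)) P)).
  by apply/funext => l; rewrite /slot !fct_sumE.
have en' := en; rewrite {}en in on K1 *.
rewrite 2!big_ord_recr /= -iterS !iter_nXE on om big1 ?add0r; last first.
  move=> k _; rewrite iter_nXE; have [h1 _ _] := iter_XV_top k (hs (pu k (rhs J))).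
  by case: odd; rewrite ?slotN h1 ?oppr0 // ltn_add2l.
have [_ -> _] := iter_XV_top m (hs K0); have [_ _ h] := iter_XV_top m (hs K1).
rewrite slotN {}h => h.
apply: (@separant_chain (K0 *+ 2 + X K1 *+ i) _ m N) => //.
  exact: bounded_slot.
rewrite en' -/K1 -[scal K1 (slot i P)]/(slot i (scal K1 P)).
apply/funext => l; move/(congr1 (@^~ l)): h.
have -> : pred_slot i (scal K1 P) = scal K1 (pred_slot i P).
  by case: (i) => //=; rewrite scal0r.
rewrite !(addrfctE, opprfctE, natmulfctE) /scal /=.
set Z := (XV _ _ *+ _); set c := (X K1 *+ i) => h.
apply/eqP; rewrite -subr_eq0 -[X in _ == X]h; apply/eqP.
rewrite /slot; ring.
Qed.

(** Descending induction on the slots.  Two contact indices are needed for odd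
    n only: with a single one the symbol, a multiple of xi^n + (-xi)^n, is zero,
    and for K = u_3 the equation has the solution P = theta^1. *)
Lemma adjoint_inj s N P : degree s.+2 P -> bounded N P ->
  adjoint N P = 0 -> P = 0.
Proof.
move=> dP bP h0; apply: eq_slot => [|i]; first exact: dP.
have H k j : (N <= j + k)%N -> slot j P = 0.
  elim: k j => [|k IH] j; first by rewrite addn0 => /(bounded_slot0 bP).
  rewrite addnS => hj.
  have hP j' : (j < j')%N -> slot j' P = 0.
    by move=> jj'; apply: IH; apply: leq_trans hj _; rewrite -addSn leq_add2r.
  have [on|en] := boolP (odd n).
    by apply: (adjoint_top_odd on bP) => //; apply: dP.
  exact: (adjoint_top_even en bP).
by rewrite slot0; apply: (H N); rewrite leq_addl.
Qed.

(** * Vertical exactness *)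
Definition primV i A : seq nat -> J := fun l => primu i (A l).

Lemma puV_primV i A : puV i (primV i A) = A.
Proof. by apply/funext => l; rewrite /puV /primV pu_primu. Qed.

Lemma bounded_primV N i A : bounded N A -> bounded N (primV i A).
Proof. by move=> bA l hl; rewrite /primV bA // raddf0. Qed.
Lemma degree_primV s i A : degree s A -> degree s (primV i A).
Proof. by move=> dA l hl; rewrite /primV dA // raddf0. Qed.
Lemma alternating_primV i A : alternating A -> alternating (primV i A).
Proof. by move=> aA l1 j k l2; rewrite /primV aA raddfN. Qed.
Lemma dep_primV N i A : (i < N)%N -> dep_below N A -> dep_below N (primV i A).
Proof.
move=> iN dA j l hj; rewrite /primV pu_primu_neq ?dA ?raddf0 //.
by rewrite ltn_eqF // (leq_trans iN).
Qed.

Lemma depB N A B : dep_below N A -> dep_below N B -> dep_below N (A - B).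
Proof. by move=> dA dB i l hi; rewrite addrfctE opprfctE raddfB /= dA ?dB ?subr0. Qed.

Lemma dep_dvert N A : dep_below N A -> dep_below N (dvert A).
Proof.
move=> dA i l hi; rewrite -[LHS]/(puV i (dvert A) l) puV_dvert.
suff -> : puV i A = 0 by rewrite raddf0.
by apply/funext => l'; exact: dA.
Qed.

Lemma bounded_dvert N A : bounded N A -> dep_below N A -> bounded N (dvert A).
Proof.
move=> + + l; elim: l A => [|i l IH] A bA dA //.
rewrite [all _ _]/= negb_and -leqNgt slotE slot_dvert addrfctE opprfctE => /orP[hi|hl].
  by rewrite /puV dA // (bounded_slot0 bA) // raddf0 subr0.
rewrite IH ?subr0 //; [|exact: bounded_slot|exact: dep_slot].
by rewrite /puV bA // raddf0.
Qed.

(** Alternation moves the index N to the front. *)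
Lemma bounded_pred N A : alternating A -> bounded N.+1 A -> slot N A = 0 ->
  bounded N A.
Proof.
move=> + + + l; elim: l A => [|i l IH] A aA bA A0 //.
rewrite [all _ _]/= negb_and -leqNgt => /orP[hi|hl].
  have [<-|ne] := eqVneq N i; first by rewrite slotE A0.
  by rewrite slotE (bounded_slot0 bA) // ltn_neqAle ne.
rewrite slotE IH //; [exact: alternating_slot|exact: bounded_slot|].
by rewrite alternating_slot2 // A0 slot0 oppr0.
Qed.

(** A tensor has finitely many nonzero coefficients, each of which depends on
    finitely many u_i. *)
Lemma dep_ex s N A : degree s A -> bounded N A -> exists N', dep_below N' A.
Proof.
elim: s A => [|s IH] A dA bA.
  have [N' hN'] := pu_fin (A [::]); exists N' => i [|j l] hi; first exact: hN'.
  by rewrite dA // raddf0.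
have [N' hN'] : exists N', forall i, (i < N)%N -> dep_below N' (slot i A).
  have H : forall k, exists N', forall i, (i < k)%N -> dep_below N' (slot i A).
    elim=> [|k [N1 h1]]; first by exists 0%N.
    have [N2 h2] := IH _ (degree_slot k dA) (bounded_slot k bA).
    exists (maxn N1 N2) => i; rewrite ltnS leq_eqVlt => /orP[/eqP ->|ik] j l.
      by rewrite geq_max => /andP[_]; apply: h2.
    by rewrite geq_max => /andP[+ _]; apply: h1.
  exact: H.
exists N' => i [|j l] hi; first by rewrite dA // raddf0.
have [jN|jN] := ltnP j N; first exact: hN'.
by rewrite slotE (bounded_slot0 bA) // raddf0.
Qed.

(** The coordinate u_N is removed from a closed form in two steps.  Subtracting
    the differential of a u_N-antiderivative of the theta^N-part removes
    theta^N; closedness then says that the coefficients do not depend on u_N. *)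
Lemma poincare_dep N s A : degree s.+1 A -> alternating A -> bounded N A ->
  dep_below N A -> dvert A = 0 ->
  exists B, [/\ degree s B, alternating B, bounded N B & A = dvert B].
Proof.
elim: N A => [|N IH] A dA aA bA pA cA.
  exists 0; split => //; first exact: alternating0.
  rewrite raddf0; apply: eq_slot => [|i]; first exact: dA.
  by rewrite (bounded_slot0 bA).
pose S := primV N (slot N A).
(* Alternation gives A_NN = - A_NN. *)
have NN : slot N (slot N A) = 0.
  apply: (@tensor_torsion_free 1); rewrite mulr2n {2}alternating_slot2 //.
  exact: addrN.
have sNS : slot N S = 0.
  by apply/funext => l; rewrite -[LHS]/(primu N (slot N (slot N A) l)) NN raddf0.
have bS : bounded N.+1 S by apply/bounded_primV/bounded_slot.
have pS : dep_below N.+1 S by apply: dep_primV => //; apply: dep_slot.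
have dS : degree s S by apply/degree_primV/degree_slot.
have aS : alternating S by apply/alternating_primV/alternating_slot.
have aA' : alternating (A - dvert S) by apply/alternatingB/alternating_dvert.
have sA' : slot N (A - dvert S) = 0.
  by rewrite slotB slot_dvert sNS puV_primV raddf0 subr0 subrr.
have bA' : bounded N (A - dvert S).
  by apply: bounded_pred => //; apply/boundedB/bounded_dvert.
have cA' : dvert (A - dvert S) = 0 by rewrite raddfB /= cA dvert_dvert subr0.
have pA' : dep_below N (A - dvert S).
  move=> i l; rewrite leq_eqVlt => /orP[/eqP <-|]; last first.
    by apply: depB => //; exact: dep_dvert.
  have : slot N (dvert (A - dvert S)) = 0 by rewrite cA'.
  by rewrite slot_dvert sA' raddf0 subr0 => /(congr1 (@^~ l)).
have [B [dB aB bB eB]] :=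
  IH _ (degreeB dA (degree_dvert dS)) aA' bA' pA' cA'.
exists (B + S); split; [exact: degreeD|exact: alternatingD| |].
  by apply: boundedD => //; apply: boundedW bB.
by rewrite raddfD /= -eB subrK.
Qed.

(** * Conserved contact forms *)
Definition index_bound A : nat :=
  if pselect (exists N, bounded N A) is left h then projT1 (cid h) else 0%N.
Definition tdtV A := TV (index_bound A) A.

Lemma tdtVE N A : bounded N A -> tdtV A = TV N A.
Proof.
move=> bA; have bA' : bounded (index_bound A) A.
  by rewrite /index_bound; case: pselect => [h|[]]; [case: (cid h)|exists N].
have [le|/ltnW le] := leqP N (index_bound A); rewrite /tdtV.
  exact: TV_widen.
by rewrite (TV_widen bA').
Qed.

Lemma vformD s A B : vform s A -> vform s B -> vform s (A + B).
Proof.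
move=> [dA aA [N bA]] [dB aB [M bB]]; split; [exact: degreeD|exact: alternatingD|].
exists (maxn N M); apply: boundedD.
  by apply: boundedW bA; rewrite leq_maxl.
by apply: boundedW bB; rewrite leq_maxr.
Qed.
Lemma vformN s A : vform s A -> vform s (- A).
Proof.
move=> [dA aA [N bA]]; split; [exact: degreeN|exact: alternatingN|].
by exists N; apply: boundedN.
Qed.
Lemma vformB s A B : vform s A -> vform s B -> vform s (A - B).
Proof. by move=> vA vB; apply/vformD/vformN. Qed.
Lemma vform0 s : vform s (0 : seq nat -> J).
Proof. by split => //; [exact: alternating0|exists 0%N]. Qed.
Lemma vform_XV s A : vform s A -> vform s (XV A).
Proof.
move=> [dA aA [N bA]]; split; [exact: degree_XV|exact: alternating_XV|].
by exists N.+1; apply: bounded_XV.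
Qed.
Lemma vform_tdtV s A : vform s A -> vform s (tdtV A).
Proof.
move=> [dA aA [N bA]]; rewrite (tdtVE bA).
split; [exact: degree_TV|exact: alternating_TV|].
by exists (N + n).+1; apply: bounded_TV.
Qed.
Lemma vform_dvert s A : vform s A -> vform s.+1 (dvert A).
Proof.
move=> [dA aA [N bA]]; split; [exact: degree_dvert|exact: alternating_dvert|].
have [M hM] := dep_ex dA bA; exists (maxn N M); apply: bounded_dvert.
  by apply: boundedW bA; rewrite leq_maxl.
by move=> i l; rewrite geq_max => /andP[_]; apply: hM.
Qed.

Lemma tdtVD s A B : vform s A -> vform s B -> tdtV (A + B) = tdtV A + tdtV B.
Proof.
move=> [_ _ [N bA]] [_ _ [M bB]].
have bA' := boundedW (leq_maxl N M) bA; have bB' := boundedW (leq_maxr N M) bB.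
by rewrite (tdtVE bA') (tdtVE bB') (tdtVE (boundedD bA' bB')) raddfD.
Qed.
Lemma tdtVN s A : vform s A -> tdtV (- A) = - tdtV A.
Proof.
by move=> [_ _ [N bA]]; rewrite (tdtVE bA) (tdtVE (boundedN bA)) raddfN.
Qed.
Lemma tdtVB s A B : vform s A -> vform s B -> tdtV (A - B) = tdtV A - tdtV B.
Proof.
by move=> vA vB; rewrite (tdtVD vA (vformN vB)) (tdtVN vB).
Qed.
Lemma tdtV0 : tdtV 0 = 0. Proof. by rewrite /tdtV raddf0. Qed.

Lemma dvert_tdtV s A : vform s A -> dvert (tdtV A) = tdtV (dvert A).
Proof.
move=> [dA aA [N bA]]; have [M hM] := dep_ex dA bA.
have bA' := boundedW (leq_maxl N M) bA.
have dA' : dep_below (maxn N M) A.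
  by move=> i l; rewrite geq_max => /andP[_]; apply: hM.
by rewrite (tdtVE bA') (tdtVE (bounded_dvert bA' dA')) dvert_TV.
Qed.

Lemma XV_tdtV s A : vform s A -> XV (tdtV A) = tdtV (XV A).
Proof.
move=> [dA aA [N bA]].
by rewrite (tdtVE (boundedW (leqnSn N) bA)) (tdtVE (bounded_XV bA)) XV_TV.
Qed.

Lemma XV_inj_vform s A : vform s.+1 A -> XV A = 0 -> A = 0.
Proof. by move=> [dA aA [N bA]]; apply: XV_inj bA => //; apply: dA. Qed.

Lemma poincare s A : vform s.+1 A -> dvert A = 0 ->
  exists2 B, vform s B & A = dvert B.
Proof.
move=> [dA aA [N bA]] cA; have [M hM] := dep_ex dA bA.
have bA' := boundedW (leq_maxl N M) bA.
have dA' : dep_below (maxn N M) A.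
  by move=> i l; rewrite geq_max => /andP[_]; apply: hM.
have [B [dB aB bB eB]] := poincare_dep dA aA bA' dA' cA.
by exists B => //; split => //; exists (maxn N M).
Qed.

Definition fun0 f : seq nat -> J := fun l => if l is [::] then f else 0.

Lemma vform_fun0 f : vform 0 (fun0 f).
Proof.
have d0 : degree 0 (fun0 f) by case.
split=> //; first exact: alternating_low d0 _.
by exists 0%N => -[].
Qed.

Lemma fun0E A : degree 0 A -> A = fun0 (A [::]).
Proof. by move=> dA; apply/funext => -[|i l] //; apply: dA. Qed.

Lemma poincare0 A : vform 0 A -> dvert A = 0 ->
  exists B, [/\ vform 0 B, dvert B = 0 & tdtV B = A].
Proof.
move=> [dA _ _] cA.
have [g g1 g2] : exists2 g, forall i, pu i g = 0 & T g = A [::].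
  apply: base_primitive => i; have := congr1 (@^~ [:: i]) cA.
  by rewrite /dvert /= subr0.
have vg := vform_fun0 g; exists (fun0 g); split => //.
  apply/funext => -[|i [|j l]] //; first by rewrite /dvert /= g1 subr0.
  rewrite slotE slot_dvert (degree0_slot (A := fun0 g)); last by case.
  by rewrite raddf0 subr0; apply: raddf0.
rewrite (fun0E dA) (fun0E (A := tdtV _)); last by case: (vform_tdtV vg).
by rewrite /tdtV TV_nil /= g2.
Qed.

Lemma vform_theta0 Q : vform 1 (theta0 (fun0 Q)).
Proof.
have d1 : degree 1 (theta0 (fun0 Q)) by case=> [|[|i] [|j l]].
split => //; first exact: alternating_low d1 _.
by exists 1%N; apply: bounded_theta0; case.
Qed.


Lemma byparts1 A : vform 1 A ->
  exists Q C, vform 1 C /\ A = theta0 (fun0 Q) + XV C.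
Proof.
move=> [dA aA [N bA]]; have A0 : A [::] = 0 by apply: dA.
exists (euler N A [::]), (byparts N A); split; last first.
  by rewrite -fun0E -?bypartsP //; exact: degree_euler.
have dC := degree_byparts N dA; split => //; first exact: alternating_low dC _.
by exists (N + N)%N; apply: bounded_byparts.
Qed.

Lemma theta0_inj_mod_XV Q C : vform 1 C -> theta0 (fun0 Q) = XV C -> Q = 0.
Proof.
move=> [dC aC [N bC]] e; suff C0 : C = 0.
  by move/(congr1 (@^~ [:: 0%N])): e; rewrite C0 raddf0.
apply: eq_slot => [|i]; first exact: dC.
have H k j : (N <= j + k)%N -> slot j C = 0.
  elim: k j => [|k IH] j; first by rewrite addn0 => /(bounded_slot0 bC).
  rewrite addnS -addSn => /IH hj; have := congr1 (slot j.+1) e.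
  by rewrite slotS_theta0 slot_XV hj raddf0 add0r => /esym.
by apply: (H N); rewrite leq_addl.
Qed.

Lemma euler0_exact s N A : vform s.+1 A -> bounded N A -> euler N A = 0 ->
  exists2 C, vform s.+1 C & A = XV C.
Proof.
move=> [dA aA _] bA e0; have A0 : A [::] = 0 by apply: dA.
have dC := degree_byparts N dA; have bC := bounded_byparts bA.
have eA : A = XV (byparts N A).
  rewrite {1}(bypartsP A0 bA) e0 -[RHS]add0r; congr (_ + _).
  by apply/funext => -[|[|i] l].
exists (byparts N A) => //; split => //; last by exists (N + N)%N.
by apply: alternating_of_XV bC dC _; rewrite -eA.
Qed.

(** The converse of [euler0_exact]. *)
Lemma exact_euler0 s N A C : bounded N A -> vform s C -> A = XV C ->
  euler N A = 0.
Proof.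
move=> bA [dC aC [M bC]] eA.
rewrite -(euler_widen bA (leq_maxl N M.+1)) -(euler_widen (N' := (maxn N M.+1).+1) _ (leqnSn _)).
  by rewrite eA euler_XV //; apply: boundedW bC; rewrite leq_max leqnSn orbT.
by apply: boundedW bA; rewrite leq_maxl.
Qed.

Lemma adjoint_of_conserved s N A B : vform s.+1 A -> bounded N A -> vform s.+1 B ->
  tdtV A = XV B -> adjoint (N + N).+1 (euler N A) = 0.
Proof.
move=> [dA aA _] bA vB e; have A0 : A [::] = 0 by apply: dA.
have bA' : bounded (N + N).+1 A by apply: boundedW bA; rewrite ltnW // ltnS leq_addr.
rewrite -(euler_TV A0 bA (ltnSn _) (ltnSn _)) -(tdtVE bA').
apply: exact_euler0 vB e; rewrite (tdtVE bA').
by apply: boundedW (bounded_TV bA'); exact: leqnSn.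
Qed.

(** Then X B = T (X C) = X (T C) and B = T C, so this is the vanishing of H^{1,s}
    for s >= 3. *)
Lemma conserved_vform_exact s A B : vform s.+3 A -> vform s.+3 B -> tdtV A = XV B ->
  exists2 C, vform s.+3 C & A = XV C.
Proof.
move=> vA vB e; case: (vA) => dA aA [N bA].
have h := adjoint_of_conserved vA bA vB e; apply: (euler0_exact vA bA).
apply: (adjoint_inj _ _ h); first exact: (degree_euler N dA).
by apply: boundedW (bounded_euler bA); exact: leqnSn.
Qed.

(** d_V commutes with X, which is injective. *)
Lemma closed_of_XV_closed s C : vform s.+1 C -> dvert (XV C) = 0 ->
  dvert C = 0.
Proof.
by move=> vC; rewrite dvert_XV; exact: (XV_inj_vform (vform_dvert vC)).
Qed.

(** rho is closed, hence rho = d_V sigma, and subtracting the dH-exact form of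
    sigma leaves d_V-closed coefficients. *)
Lemma dvert_exact_mod A B rho : vform 1 A -> vform 1 B -> vform 2 rho ->
  dvert A = XV rho -> dvert B = tdtV rho ->
  exists mu nu sigma, [/\ vform 0 mu, vform 0 nu, vform 1 sigma,
    A = dvert mu + XV sigma & B = dvert nu + tdtV sigma].
Proof.
move=> vA vB vr eA eB.
have : dvert rho = 0.
  by apply: (closed_of_XV_closed vr); rewrite -eA dvert_dvert.
move=> /(poincare vr) [sigma vs es].
have [|f vf ef] := @poincare 0 (A - XV sigma) (vformB vA (vform_XV vs)).
  by rewrite raddfB /= dvert_XV -es eA subrr.
have [|g vg eg] := @poincare 0 (B - tdtV sigma) (vformB vB (vform_tdtV vs)).
  by rewrite raddfB /= (dvert_tdtV vs) -es eB subrr.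
by exists f, g, sigma; rewrite -ef -eg !subrK.
Qed.

Lemma dvert_exact_dt A B rho : vform 1 A -> vform 1 B -> vform 2 rho ->
  tdtV A = XV B -> dvert A = XV rho -> dvert B = tdtV rho.
Proof.
move=> vA vB vr e eA; apply/eqP; rewrite -subr_eq0; apply/eqP.
apply: (@XV_inj_vform 1); first exact: vformB (vform_dvert vB) (vform_tdtV vr).
rewrite raddfB /= (XV_tdtV vr) -dvert_XV -e -eA.
by rewrite (dvert_tdtV vA) subrr.
Qed.

(** With dx /\ A + dt /\ B = dV mu + dH sigma, the function h differs from the
    dH-derivative of mu by a function of (t, x), which is itself dH-exact. *)
Lemma Lambda_well_defined A B rho h : vform 1 A -> vform 1 B -> vform 2 rho ->
  vform 0 h -> dvert A = XV rho -> dvert B = tdtV rho ->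
  tdtV A - XV B = dvert h ->
  exists mu nu, [/\ vform 0 mu, vform 0 nu & h = tdtV mu - XV nu].
Proof.
move=> vA vB vr vh eA eB e.
have [f [g [sigma [vf vg vs eA' eB']]]] := dvert_exact_mod vA vB vr eA eB.
have vTX : vform 0 (tdtV f - XV g) by apply/vformB/vform_XV => //; apply: vform_tdtV.
have [|g0 [vg0 cg0 eg0]] := poincare0 (vformB vh vTX).
  rewrite raddfB /= -e eA' eB' (tdtVD (vform_dvert vf) (vform_XV vs)) raddfD /=.
  rewrite -(XV_tdtV vs) raddfB /= (dvert_tdtV vf) dvert_XV.
  by rewrite opprD addrACA subrr addr0 subrr.
exists (f + g0), g; split => //; first exact: vformD.
by rewrite (tdtVD vf vg0) eg0 addrAC addrCA subrr addr0.
Qed.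

(** The form mu of [dvert_exact_mod] is dH-closed up to a function of
    (t, x); absorbing it makes mu closed. *)
Lemma dV_kernel A B rho : vform 1 A -> vform 1 B -> vform 2 rho ->
  tdtV A = XV B -> dvert A = XV rho ->
  exists mu nu sigma, [/\ vform 0 mu, vform 0 nu, vform 1 sigma,
    A = dvert mu + XV sigma & B = dvert nu + tdtV sigma /\ tdtV mu = XV nu].
Proof.
move=> vA vB vr e eA; have eB := dvert_exact_dt vA vB vr e eA.
have [f [g [sigma [vf vg vs eA' eB']]]] := dvert_exact_mod vA vB vr eA eB.
have vTX : vform 0 (tdtV f - XV g) by apply/vformB/vform_XV => //; apply: vform_tdtV.
have [|g0 [vg0 cg0 eg0]] := poincare0 vTX.
  rewrite raddfB /= (dvert_tdtV vf) dvert_XV.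
  move: e; rewrite eA' eB' (tdtVD (vform_dvert vf) (vform_XV vs)) raddfD /=.
  by rewrite -(XV_tdtV vs) => /addIr ->; rewrite subrr.
exists (f - g0), g, sigma; rewrite raddfB /= cg0 subr0 (tdtVB vf vg0) eg0.
by rewrite opprB addrCA subrr addr0; split => //; exact: vformB.
Qed.

(** d_V A is conserved of degree 3, hence equal to X C; then C = d_V rho, and
    A - X rho is d_V-exact. *)
Lemma H12_representative A B : vform 2 A -> vform 2 B -> tdtV A = XV B ->
  exists Q gamma rho h,
    [/\ vform 1 gamma, vform 2 rho, vform 0 h,
        A = dvert (theta0 (fun0 Q)) + XV rho &
        B = dvert gamma + tdtV rho /\
        tdtV (theta0 (fun0 Q)) - XV gamma = dvert h].
Proof.
move=> vA vB e.
have [|C vC eC] := conserved_vform_exact (vform_dvert vA) (vform_dvert vB).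
  by rewrite -(dvert_tdtV vA) e dvert_XV.
have : dvert C = 0.
  by apply: (closed_of_XV_closed vC); rewrite -eC dvert_dvert.
move=> /(poincare vC) [rho vr er].
have [|alpha va ea] := @poincare 1 (A - XV rho) (vformB vA (vform_XV vr)).
  by rewrite raddfB /= dvert_XV -er eC subrr.
have [Q [sigma [vs es]]] := byparts1 va.
have vQ := vform_theta0 Q; have vr' := vformD vr (vform_dvert vs).
have eA : A = dvert (theta0 (fun0 Q)) + XV (rho + dvert sigma).
  rewrite raddfD /= -dvert_XV addrCA addrC -raddfD /= -es -ea.
  by rewrite subrK.
have [|gamma vg eg] :=
    @poincare 1 (B - tdtV (rho + dvert sigma)) (vformB vB (vform_tdtV vr')).
  apply: (@XV_inj_vform 2); first exact/vform_dvert/vformB/vform_tdtV.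
  rewrite -dvert_XV raddfB /= -e eA (XV_tdtV vr').
  rewrite (tdtVD (vform_dvert vQ) (vform_XV vr')) addrK.
  by rewrite -(dvert_tdtV vQ) dvert_dvert.
have [|h vh eh] :=
    @poincare 0 (tdtV (theta0 (fun0 Q)) - XV gamma) (vformB (vform_tdtV vQ) (vform_XV vg)).
  rewrite raddfB /= dvert_XV -eg (dvert_tdtV vQ) raddfB /= -e eA (XV_tdtV vr').
  by rewrite (tdtVD (vform_dvert vQ) (vform_XV vr')) addrK subrr.
by exists Q, gamma, (rho + dvert sigma), h; rewrite -eg subrK.
Qed.

(** The case of degree 1: E (T (Q theta^0)) is the left-hand side. *)
Lemma conserved_charP Q :
  (exists2 C, vform 1 C & tdtV (theta0 (fun0 Q)) = XV C) <->
  T Q + \sum_(i < n.+1) (-1) ^+ i * iter i X (pu i (rhs J) * Q) = 0.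
Proof.
have vQ := vform_theta0 Q.
have b1 : bounded 1 (theta0 (fun0 Q)) by apply: bounded_theta0; case.
have iterX m f : iter m nX (fun0 f) [::] = (-1) ^+ m * iter m X f.
  elim: m => [|m IH]; first by rewrite mul1r.
  rewrite iterS exprS mulN1r mulNr -[LHS]/(- X (iter m nX (fun0 f) [::])) IH.
  by congr (- _); rewrite -signr_odd !mulr_sign; case: odd; rewrite ?raddfN.
have adjE : adjoint 3 (fun0 Q) = fun0 (T Q +
    \sum_(i < n.+1) (-1) ^+ i * iter i X (pu i (rhs J) * Q)).
  have d0 : degree 0 (adjoint 3 (fun0 Q)).
    have dQ : degree 0 (fun0 Q) by case.
    apply: degreeD; first exact: degree_TV.
    apply: (@degree_sum _ _ (fun i => iter i nX (scal (pu i (rhs J)) (fun0 Q)))) => k.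
    exact/degree_iter_nX/degree_scal.
  rewrite [LHS]fun0E // /adjoint addrfctE fct_sumE TV_nil /=.
  congr (fun0 (_ + _)); apply: eq_bigr => i _; rewrite -iterX.
  by congr (iter _ _ _ _); apply/funext => -[|j l] //; rewrite /scal mulr0.
have eulerE : euler 1 (theta0 (fun0 Q)) = fun0 Q by rewrite /euler big_ord1.
split=> [[C vC e]|e].
  have := adjoint_of_conserved vQ b1 vC e; rewrite eulerE adjE.
  by move/(congr1 (@^~ [::])).
have b3 : bounded 3 (theta0 (fun0 Q)) by apply: boundedW b1.
apply: (@euler0_exact 0 (3 + n).+2); first exact: vform_tdtV.
  by rewrite (tdtVE b3); apply: boundedW (bounded_TV b3); exact: leqnSn.
have := @euler_TV 1 3 _ (erefl : theta0 (fun0 Q) [::] = 0) b1 isT _ (ltnSn _).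
rewrite (tdtVE b3) => ->; rewrite eulerE adjE e.
by apply/funext => -[|i l].
Qed.

(** theta^0 /\ E(A) does not see the component e of E(A) on theta^0.  That
    component vanishes: A = e theta^0 (x) theta^0 + X C, and adding the
    transposed equation gives 2 e theta^0 (x) theta^0 in im X. *)
Lemma exact_of_euler_pos N A : vform 2 A -> bounded N A ->
  (forall k, (0 < k)%N -> euler N A [:: k] = 0) ->
  exists2 C, vform 2 C & A = XV C.
Proof.
move=> vA bA h; case: (vA) => dA aA _; apply: (euler0_exact vA bA).
have A0 : A [::] = 0 by apply: dA.
have dE := degree_euler N dA.
set e := euler N A [:: 0%N].
have eE : euler N A = theta0 (fun0 e).
  apply: eq_slot => [|[|i]]; first exact: dE.
    by apply/funext => -[|j l] //; apply: dE.
  by apply/funext => -[|j l]; [apply: h|apply: dE].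
pose C := byparts N A; have bC := bounded_byparts bA.
have eA : A = theta0 (theta0 (fun0 e)) + XV C by rewrite -eE; apply: bypartsP.
have b1 : bounded 2 (theta0 (theta0 (fun0 e))).
  by do 2![apply: bounded_theta0]; case.
have sw : swapV 0 (theta0 (theta0 (fun0 e))) = theta0 (theta0 (fun0 e)).
  by apply/funext => -[|[|i] [|[|j] l]].
have swA : swapV 0 A = - A.
  apply/funext => -[|i [|j l]]; last exact: (aA [::] j i l).
    by rewrite opprfctE /swapV /= dA ?oppr0.
  by rewrite opprfctE /swapV /= dA ?oppr0.
have bS : bounded (N + N) (swapV 0 C).
  by move=> l hl; apply: bC; rewrite all_swap_entries.
have : XV (C + swapV 0 C) = - theta0 (theta0 (fun0 e)) *+ 2.
  have : A + swapV 0 A = 0 by rewrite swA addrN.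
  rewrite {1 2}eA [swapV 0 (_ + _)](_ : _ =
    swapV 0 (theta0 (theta0 (fun0 e))) + swapV 0 (XV C)) // sw -XV_swap.
  rewrite addrACA -raddfD /= => /eqP; rewrite addrC addr_eq0 => /eqP ->.
  by rewrite mulNrn mulr2n.
move/(congr1 (euler (N + N).+2)).
rewrite (@euler_XV (N + N).+1); last by apply/boundedD; apply: boundedW (leqnSn _) _.
rewrite mulNrn mulr2n.
have -> B : euler (N + N).+2 (- B) = - euler (N + N).+2 B.
  by apply/eqP; rewrite -addr_eq0 -eulerD addNr /euler big1 // => k _; exact: iter_nX0.
rewrite eulerD (euler_widen (N := 2) b1) // /euler 2!big_ord_recr big_ord0 /= add0r.
rewrite slotS_theta0 nX0 addr0 => /esym/(congr1 -%R); rewrite opprK oppr0 -mulr2n.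
move/tensor_torsion_free => /(congr1 (@^~ [:: 0%N])) h0; have {h0} e0 : e = 0 := h0.
by rewrite -/(euler N A) eE e0; apply/funext => -[|[|i] [|j l]].
Qed.

End Tensors.

(** * Integrals depending on a parameter *)
Lemma pair_continuous (X Y Z : topologicalType) (f : X -> Y) (g : X -> Z) :
  continuous f -> continuous g -> continuous (fun x => (f x, g x)).
Proof. by move=> cf cg x; exact: (cvg_pair (cf x) (cg x)). Qed.

Lemma comp_continuous (X Y Z : topologicalType) (f : X -> Y) (g : Y -> Z) :
  continuous f -> continuous g -> continuous (fun x => g (f x)).
Proof. by move=> cf cg x; apply: continuous_comp; [exact: cf|exact: cg]. Qed.

Section Integral01.
Variable R : realType.
Notation mu := (@lebesgue_measure R).

Definition int01 (g : R -> R) : R := \int[mu]_(t in `[0, 1]) g t.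

Lemma integrable01 (g : R -> R^o) : continuous g ->
  mu.-integrable `[0%R, 1%R] (EFin \o g).
Proof.
move=> cg; apply: continuous_compact_integrable; first exact: segment_compact.
by apply: continuous_subspaceT.
Qed.

Lemma int01D (g h : R -> R^o) : continuous g -> continuous h ->
  int01 (fun t => g t + h t) = int01 g + int01 h.
Proof.
by move=> cg ch; rewrite /int01 RintegralD //; exact: integrable01.
Qed.

Lemma int01B (g h : R -> R^o) : continuous g -> continuous h ->
  int01 (fun t => g t - h t) = int01 g - int01 h.
Proof.
by move=> cg ch; rewrite /int01 RintegralB //; exact: integrable01.
Qed.

Lemma int01_cst (c : R) : int01 (fun=> c) = c.
Proof.
rewrite /int01 Rintegral_cst //= lebesgue_measure_itv /= lte_fin ltr01.
by rewrite oppr0 adde0 mulr1.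
Qed.

Lemma int01_bound (g : R -> R^o) (e : R) : continuous g ->
  (forall t, 0 <= t <= 1 -> `|g t| <= e) -> `|int01 g| <= e.
Proof.
move=> cg ge; rewrite -[leRHS]int01_cst /int01.
apply: le_trans (le_normr_Rintegral _ (integrable01 cg)) _ => //.
apply: le_Rintegral => //.
- apply: (@integrable01 (fun t => `|g t|)) => t.
  by apply: cvg_norm; exact: cg.
- by apply: (@integrable01 (fun=> e)) => t; exact: cvg_cst.
Qed.

(** By compactness of [0, 1], F(t, q) is close to F(t, p) uniformly in t. *)
Lemma int01_continuous (P : topologicalType) (F : R -> P -> R^o) :
  continuous (fun q : R^o * P => F q.1 q.2) ->
  continuous (fun p => int01 (F^~ p) : R^o).
Proof.
move=> cF p.
have cFp q : continuous (F^~ q : R -> R^o).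
  apply: (@comp_continuous _ _ _ (fun t : R^o => (t, q)) _ _ cF).
  apply: pair_continuous => t; [exact: cvg_id | exact: cvg_cst].
apply/cvgrPdist_le => e e0.
have /compact_near_coveringP K01 := @segment_compact R 0 1.
pose close q t' := `|F t' p - F t' q| <= e.
have /(K01 _ _ close (nbhs_filter p)) : forall t : R, `[0, 1]%classic t ->
   \forall t' \near t & q \near p, close q t'.
  move=> t _.
  have : \forall r \near (t, p), `|F t p - F r.1 r.2| <= e / 2.
    have /cvgrPdist_le H := cF (t, p). apply: (H (e/2)). by rewrite divr_gt0.
  move=> [[U V] /= [Ut Vp] UV].
  exists (U, V) => //= -[t' q] /= [Ut' Vq].
  have h1 : `|F t p - F t' q| <= e / 2 by apply: (UV (t', q)).
  have h2 : `|F t p - F t' p| <= e / 2.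
    by apply: (UV (t', p)); split => //=; exact: nbhs_singleton.
  rewrite /= /close (_ : _ - _ = (F t p - F t' q) - (F t p - F t' p)); last by ring.
  by rewrite (le_trans (ler_normB _ _)) // (le_trans (lerD h1 h2)) // -splitr.
apply: filterS => q hq; rewrite -int01B //; apply: int01_bound.
  by move=> t; apply: cvgB; exact: cFp.
by move=> t t01; apply: hq; rewrite /= in_itv.
Qed.

Lemma int01_derive (F F' : R -> R -> R^o) (a : R) :
  (forall t s, is_derive s (1 : R^o) (F t : R^o -> R^o) (F' t s)) ->
  (forall s, continuous (F^~ s)) ->
  continuous (fun q : R^o * R^o => F' q.1 q.2) ->
  is_derive a (1 : R^o) (fun s => int01 (F^~ s) : R^o) (int01 (F'^~ a)).
Proof.
move=> dF cF cF'.
have [M hM] : exists M : R, forall t s, 0 <= t <= 1 -> a - 1 <= s <= a + 1 ->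
    `|F' t s| <= M.
  have cK : compact (`[0, 1]%classic `*` `[a - 1, a + 1]%classic : set (R^o * R^o)).
    by apply: compact_setX; exact: segment_compact.
  have /compact_bounded [M [_ hM]] : compact ((fun q : R^o * R^o => F' q.1 q.2) @`
     (`[0, 1]%classic `*` `[a - 1, a + 1]%classic)).
    by apply: continuous_compact cK; exact: continuous_subspaceT.
  exists (M + 1) => t s ht hs; apply: hM; first by rewrite ltrDl.
  by exists (t, s) => //=; rewrite !in_itv.
have Ia : `]a - 1, a + 1[%classic a by rewrite /= in_itv /= ltrBlDr ltrDl ltr01.
pose f s t := F t s.
have d1 s t : partial1of2 f s t = F' t s.
  by rewrite /partial1of2 derive1E; have := dF t s => dts; rewrite derive_val.
have df x y : `]a - 1, a + 1[%classic x -> `[0, 1]%classic y -> derivable (f^~ y) x 1.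
  by move=> _ _; apply: @ex_derive (dF y x).
have intf x : `]a - 1, a + 1[%classic x -> mu.-integrable `[0%R, 1%R] (EFin \o f x).
  by move=> _; apply: integrable01; exact: cF.
have M0 : 0 <= M.
  apply: le_trans (normr_ge0 (F' 0 a)) _; apply: hM; rewrite ?lexx ?ler01 //.
  by rewrite lerBlDr lerDl ler01.
have G_ub x y : `]a - 1, a + 1[%classic x -> `[0, 1]%classic y -> `|partial1of2 f x y| <= M.
  move=> /=; rewrite !in_itv /= => /andP[h1 h2] h3; rewrite d1; apply: hM => //.
  by rewrite !ltW.
have iM : mu.-integrable `[0%R, 1%R] (EFin \o (fun=> M)).
  by apply: (@integrable01 (fun=> M)) => t; exact: cvg_cst.
have m01 : measurable (`[0%R, 1%R] : set (measurableTypeR R)) by [].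
apply: DeriveDef.
  exact: (derivable_under_integral m01 Ia intf df (fun=> M0) iM G_ub).
rewrite -derive1E (differentiation_under_integral m01 Ia intf df (fun=> M0) iM G_ub).
by apply: eq_Rintegral => t _; rewrite -d1.
Qed.

Lemma int01_FTC (g g' : R -> R^o) :
  (forall t, is_derive t (1 : R^o) (g : R^o -> R^o) (g' t)) -> continuous g' ->
  int01 g' = g 1 - g 0.
Proof.
move=> dg cg'.
have cg : continuous g.
  by move=> t; apply/differentiable_continuous/derivable1_diffP/(@ex_derive _ _ _ _ _ _ _ (dg t)).
rewrite /int01 /Rintegral (@continuous_FTC2 _ g' g) //.
- exact: continuous_subspaceT.
- split.
  + by move=> t _; exact: (@ex_derive _ _ _ _ _ _ _ (dg t)).
  + exact: cvg_at_right_filter (cg 0).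
  + exact: cvg_at_left_filter (cg 1).
- by move=> t _; rewrite derive1E; have dgt := dg t; rewrite derive_val.
Qed.

End Integral01.

(** * Smooth functions on jet spaces *)
Section Jets.
Variables (R : realType) (I : choiceType).
Implicit Types (f g : jet R I -> R^o) (p q : jet R I) (c d : Defs.coord I) (s t : R^o).

Lemma coord_set_id c p : coord_set c p (coord_val c p) = p.
Proof.
case: c => [||i]; case: p => [[a b] u] //=; congr (_, _).
by apply/funext => j; case: eqP => [->|].
Qed.

Lemma coord_val_set c p s : coord_val c (coord_set c p s) = s.
Proof. by case: c => [||i] //=; rewrite eqxx. Qed.

Lemma coord_val_set_neq c d p s : d <> c ->
  coord_val d (coord_set c p s) = coord_val d p.
Proof.
case: c d => [||i] [||j] //= ne; case: eqP => // e.
by case: ne; rewrite e.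
Qed.

Lemma coord_set_set c p s t : coord_set c (coord_set c p s) t = coord_set c p t.
Proof.
case: c => [||i] //=; congr (_, _).
by apply/funext => j; case: eqP.
Qed.

Lemma coord_setC c d p s t : c <> d ->
  coord_set d (coord_set c p s) t = coord_set c (coord_set d p t) s.
Proof.
case: c d => [||i] [||j] //= ne; congr (_, _).
apply/funext => k; case: eqP => [->|//]; case: eqP => // e.
by case: ne; rewrite e.
Qed.

(** The universal property of the product topology. *)
Lemma ptws_continuous (X : topologicalType) (h : X -> {ptws I -> R^o}) :
  (forall i, continuous (fun x => h x i)) -> continuous h.
Proof.
move=> ch x; apply/cvg_sup => i A /= [_ [[B Bop <-] Bh sBA]].
have : nbhs (h x i) B by apply: open_nbhs_nbhs; split=> //; exact: Bh.
move=> /(ch i x) hB; have {}hB : nbhs x (fun y => B (h y i)) := hB.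
suff : nbhs x (fun y => A (h y)) by [].
by apply: filterS hB => y By; apply: sBA.
Qed.

Lemma coord_val_continuous c : continuous (coord_val c : jet R I -> R^o).
Proof.
case: c => [||i].
- apply: (@comp_continuous _ _ _ (fst : jet R I -> _) (fst : R^o * R^o -> R^o)) => ?; exact: cvg_fst.
- apply: (@comp_continuous _ _ _ (fst : jet R I -> _) (snd : R^o * R^o -> R^o)) => ?; [exact: cvg_fst|exact: cvg_snd].
- apply: (@comp_continuous _ _ _ (snd : jet R I -> _) (fun u : {ptws I -> R^o} => u i)).
    by move=> ?; exact: cvg_snd.
  exact: (@proj_continuous I (fun=> R^o) i).
Qed.

Lemma jet_continuous (X : topologicalType) (h : X -> jet R I) :
  (forall c, continuous (fun x => coord_val c (h x) : R^o)) -> continuous h.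
Proof.
move=> ch; rewrite (_ : h = fun x => ((coord_val Ct (h x), coord_val Cx (h x)), (h x).2)).
  apply: pair_continuous; first by apply: pair_continuous; exact: ch.
  by apply: ptws_continuous => i; exact: (ch (Cu i)).
by apply/funext => x; case: (h x) => -[].
Qed.

Lemma coord_set_continuous (X : topologicalType) c (h : X -> jet R I) (s : X -> R^o) :
  continuous h -> continuous s -> continuous (fun x => coord_set c (h x) (s x)).
Proof.
move=> ch cs; apply: jet_continuous => d.
have [->|ne] := pselect (d = c).
  by rewrite (_ : (fun x => _) = s) //; apply/funext => x; rewrite coord_val_set.
rewrite (_ : (fun x => _) = fun x => coord_val d (h x)).
  by apply: comp_continuous ch (@coord_val_continuous d).
by apply/funext => x; rewrite coord_val_set_neq.
Qed.

(** Differentiability and the value of the partial derivative in one relation,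
    which composes better than [pd]. *)
Definition is_pd c f g := forall p,
  is_derive (coord_val c p) (1 : R^o) (fun s : R^o => f (coord_set c p s)) (g p).

Lemma is_pdE c f g : is_pd c f g -> pd c f = g.
Proof. by move=> h; apply/funext => p; rewrite /pd derive1E; have := h p => hp; rewrite derive_val. Qed.

Lemma is_pd_at c f g p s : is_pd c f g ->
  is_derive s (1 : R^o) (fun s : R^o => f (coord_set c p s)) (g (coord_set c p s)).
Proof.
move/(_ (coord_set c p s)); rewrite coord_val_set.
rewrite (_ : (fun r : R^o => f (coord_set c (coord_set c p s) r)) = fun r => f (coord_set c p r)) //.
by apply/funext => r; rewrite coord_set_set.
Qed.

Lemma derivable_is_pd c f :
  (forall p, derivable (fun s : R^o => f (coord_set c p s)) (coord_val c p) 1) ->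
  is_pd c f (pd c f).
Proof. by move=> h p; apply: DeriveDef => //; rewrite /pd derive1E. Qed.

Lemma CkS k f : continuous f ->
  (forall c, exists2 g, is_pd c f g & Ck k g) -> Ck k.+1 f.
Proof.
move=> cf h; split => // c; have [g hg Cg] := h c; rewrite (is_pdE hg).
by split => // p; apply: (@ex_derive _ _ _ _ _ _ _ (hg p)).
Qed.

Lemma Ck_continuous k f : Ck k f -> continuous f.
Proof. by case: k => [|k] []. Qed.

Lemma Ck_pd k c f : Ck k.+1 f -> is_pd c f (pd c f) /\ Ck k (pd c f).
Proof. by case=> _ /(_ c) [h1 h2]; split => //; apply: derivable_is_pd. Qed.

Lemma CkW k f : Ck k.+1 f -> Ck k f.
Proof.
elim: k f => [|k IH] f hf; first by split; first exact: Ck_continuous hf.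
apply: CkS; first exact: Ck_continuous hf.
by move=> c; have [h1 h2] := Ck_pd c hf; exists (pd c f) => //; apply: IH.
Qed.

Lemma Ck_cst k (r : R) : Ck k (fun _ : jet R I => r : R^o).
Proof.
have cr : continuous (fun _ : jet R I => r : R^o) by exact: cst_continuous.
elim: k r cr => [|k IH] r cr; first by split; first exact: cr.
apply: CkS; first exact: cr.
move=> c; exists (fun=> 0); first by move=> p; exact: is_derive_cst.
by apply: IH; exact: cst_continuous.
Qed.

Lemma is_pdD c f f' g g' : is_pd c f g -> is_pd c f' g' -> is_pd c (f + f') (g + g').
Proof. by move=> h h' p; have hp := h p; have hp' := h' p; apply: is_deriveD. Qed.

Lemma is_pdN c f g : is_pd c f g -> is_pd c (- f) (- g).
Proof. by move=> h p; have hp := h p; apply: is_deriveN. Qed.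

Lemma is_pdM c f f' g g' : is_pd c f g -> is_pd c f' g' ->
  is_pd c (f * f') (g * f' + f * g').
Proof.
move=> h h' p; have hp := h p; have hp' := h' p.
have := is_deriveM hp hp'; rewrite !coord_set_id => H; apply: is_derive_eq.
by rewrite !fctE /GRing.scale /=; ring.
Qed.

Lemma Ck0 f : continuous f -> Ck 0 f.
Proof. by move=> cf; split; first exact: cf. Qed.

Lemma add_continuous (f g : jet R I -> R^o) :
  continuous f -> continuous g -> continuous (f + g).
Proof.
move=> cf cg; rewrite addrfctE => x.
exact: (@cvgD _ _ _ _ _ f g _ _ (cf x) (cg x)).
Qed.
Lemma opp_continuous (f : jet R I -> R^o) : continuous f -> continuous (- f).
Proof.
move=> cf; rewrite opprfctE => x; exact: (@cvgN _ _ _ _ _ f _ (cf x)).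
Qed.
Lemma mul_continuous (f g : jet R I -> R^o) :
  continuous f -> continuous g -> continuous (f * g).
Proof.
move=> cf cg; rewrite mulrfctE => x.
exact: (@cvgM _ _ _ _ f g _ _ (cf x) (cg x)).
Qed.

Lemma Ck_add k f g : Ck k f -> Ck k g -> Ck k (f + g).
Proof.
elim: k f g => [|k IH] f g hf hg.
  apply: Ck0; exact: add_continuous (Ck_continuous hf) (Ck_continuous hg).
apply: CkS; first exact: add_continuous (Ck_continuous hf) (Ck_continuous hg).
move=> c; have [f1 f2] := Ck_pd c hf; have [g1 g2] := Ck_pd c hg.
by exists (pd c f + pd c g); [exact: is_pdD|exact: IH].
Qed.

Lemma Ck_opp k f : Ck k f -> Ck k (- f).
Proof.
elim: k f => [|k IH] f hf.
  by apply: Ck0; exact: opp_continuous (Ck_continuous hf).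
apply: CkS; first exact: opp_continuous (Ck_continuous hf).
move=> c; have [f1 f2] := Ck_pd c hf.
by exists (- pd c f); [exact: is_pdN|exact: IH].
Qed.

Lemma Ck_mul k f g : Ck k f -> Ck k g -> Ck k (f * g).
Proof.
elim: k f g => [|k IH] f g hf hg.
  apply: Ck0; exact: mul_continuous (Ck_continuous hf) (Ck_continuous hg).
apply: CkS; first exact: mul_continuous (Ck_continuous hf) (Ck_continuous hg).
move=> c; have [f1 f2] := Ck_pd c hf; have [g1 g2] := Ck_pd c hg.
exists (pd c f * g + f * pd c g); first exact: is_pdM.
apply: Ck_add; first exact: IH f2 (CkW hg).
exact: IH (CkW hf) g2.
Qed.

Lemma depends_onW (S S' : pred I) f : (forall i, S i -> S' i) ->
  depends_on S f -> depends_on S' f.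
Proof. by move=> h d p q e1 e2; apply: d => // i /h; apply: e2. Qed.

Lemma depends_on_pd (S : pred I) c f : depends_on S f -> depends_on S (pd c f).
Proof.
move=> df p q e1 e2; rewrite /pd.
have [cS|cS] : (coord_val c p = coord_val c q) \/ (exists2 i, c = Cu i & ~~ S i).
- case: c => [||i]; rewrite /= ?e1; [by left|by left|].
  by have [Si|nSi] := boolP (S i); [left; apply: e2|right; exists i].
- rewrite cS; congr (derive1 _ _); apply/funext => s; apply: df.
    by case: (c) => /=; rewrite ?e1.
  by case: (c) => //= j i Si; case: eqP => // _; apply: e2.
- case: cS => i -> nSi; rewrite [X in derive1 X _](_ : _ = fun=> f p); last first.
    by apply/funext => s; apply: df => //= j Sj; case: eqP Sj nSi => // -> ->.
  rewrite [X in _ = derive1 X _](_ : _ = fun=> f q); last first.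
    by apply/funext => s; apply: df => //= j Sj; case: eqP Sj nSi => // -> ->.
  by rewrite !derive1_cst.
Qed.

Lemma pd_indep (S : pred I) i f : depends_on S f -> ~~ S i -> pd (Cu i) f = 0.
Proof.
move=> df nSi; apply/funext => p; rewrite /pd [X in derive1 X _](_ : _ = fun=> f p).
  by rewrite derive1_cst.
by apply/funext => s; apply: df => //= j Sj; case: eqP Sj nSi => // -> ->.
Qed.

Lemma smooth_cst (r : R) : smooth (fun _ : jet R I => r : R^o).
Proof. by split=> [|k]; [exists [::]|exact: Ck_cst]. Qed.

Lemma smooth_add f g : smooth f -> smooth g -> smooth (f + g).
Proof.
move=> [[S dS] Cf] [[S' dS'] Cg]; split=> [|k]; last exact: Ck_add.
exists (S ++ S'); have [h h'] : depends_on (mem (S ++ S')) f /\ depends_on (mem (S ++ S')) g.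
  split; [apply: depends_onW dS|apply: depends_onW dS'] => i /= iS;
    by rewrite mem_cat iS ?orbT.
by move=> p q e1 e2; rewrite !fctE (h p q) // (h' p q).
Qed.

Lemma smooth_opp f : smooth f -> smooth (- f).
Proof.
move=> [[S dS] Cf]; split=> [|k]; last exact: Ck_opp.
by exists S => p q e1 e2; rewrite !fctE (dS p q).
Qed.

Lemma smooth_mul f g : smooth f -> smooth g -> smooth (f * g).
Proof.
move=> [[S dS] Cf] [[S' dS'] Cg]; split=> [|k]; last exact: Ck_mul.
exists (S ++ S'); have [h h'] : depends_on (mem (S ++ S')) f /\ depends_on (mem (S ++ S')) g.
  split; [apply: depends_onW dS|apply: depends_onW dS'] => i /= iS;
    by rewrite mem_cat iS ?orbT.
by move=> p q e1 e2; rewrite !fctE (h p q) // (h' p q).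
Qed.

Lemma smooth_pd c f : smooth f -> smooth (pd c f).
Proof.
move=> [[S dS] Cf]; split=> [|k]; last by have [] := Ck_pd c (Cf k.+1).
by exists S; apply: depends_on_pd.
Qed.

Lemma smooth_is_pd c f : smooth f -> is_pd c f (pd c f).
Proof. by move=> [_ Cf]; have [] := Ck_pd c (Cf 1%N). Qed.

Lemma smooth_continuous f : smooth f -> continuous f.
Proof. by move=> [_ /(_ 0%N) []]. Qed.

Lemma is_pd_coord c d : is_pd d (coord_val c) (fun=> (`[< d = c >])%:R).
Proof.
move=> p; case: asboolP => [->|ne].
  rewrite (_ : (fun s => _) = id); first exact: is_derive_id.
  by apply/funext => s; rewrite coord_val_set.
rewrite (_ : (fun s => _) = cst (coord_val c p)); first exact: is_derive_cst.
by apply/funext => s; rewrite coord_val_set_neq // => e; apply: ne.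
Qed.

Lemma smooth_coord c : smooth (coord_val c : jet R I -> R^o).
Proof.
split=> [|[|k]].
- exists (if c is Cu i then [:: i] else [::]) => p q e1 e2.
  by case: c e2 => [||i] e2 /=; rewrite ?e1 //; apply: e2; exact: mem_head.
- by split; first exact: coord_val_continuous.
- apply: CkS; first exact: coord_val_continuous.
  by move=> d; exists (fun=> (`[< d = c >])%:R); [exact: is_pd_coord|exact: Ck_cst].
Qed.

(** The antiderivative of f in the coordinate c that vanishes where c does; the
    fixed domain of integration makes it easy to differentiate. *)
Definition prim c f : jet R I -> R^o := fun p =>
  int01 (fun t => coord_val c p * f (coord_set c p (t * coord_val c p))).

End Jets.

Section Primitives.
Variables (R : realType) (I : choiceType).
Implicit Types (f g : jet R I -> R^o) (p q : jet R I) (c d : Defs.coord I) (s t : R^o).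

Lemma prim_integrand_continuous (X : topologicalType) c f (h : X -> jet R I) (r s : X -> R^o) :
  continuous f -> continuous h -> continuous r -> continuous s ->
  continuous (fun x => r x * f (coord_set c (h x) (s x)) : R^o).
Proof.
move=> cf ch cr cs x; apply: cvgM; first exact: cr.
have cc : continuous (fun x => coord_set c (h x) (s x)) by exact: coord_set_continuous.
exact: (@comp_continuous X _ _ (fun x => coord_set c (h x) (s x)) f cc cf x).
Qed.

Lemma prim_continuous c f : continuous f -> continuous (prim c f).
Proof.
move=> cf.
apply: (@int01_continuous _ _ (fun t p => coord_val c p * f (coord_set c p (t * coord_val c p)))).
have c2 : continuous (fun q : R^o * jet R I => coord_val c q.2 : R^o).
  apply: (comp_continuous _ (@coord_val_continuous R I c)) => q; exact: cvg_snd.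
apply: prim_integrand_continuous => //.
  by move=> q; exact: cvg_snd.
by move=> q; apply: cvgM; [exact: cvg_fst|exact: c2].
Qed.

(** Differentiation under the integral sign. *)
Lemma is_pd_prim_neq c d f : c <> d -> smooth f ->
  is_pd d (prim c f) (prim c (pd d f)).
Proof.
move=> ne sf p; have ne' : d <> c by move=> e; apply: ne.
set u := coord_val c p.
pose F t s : R^o := u * f (coord_set d (coord_set c p (t * u)) s).
pose F' t s : R^o := u * pd d f (coord_set d (coord_set c p (t * u)) s).
have -> : (fun s : R^o => prim c f (coord_set d p s)) = (fun s => int01 (F^~ s)).
  apply/funext => s; rewrite /prim; congr (int01 _); apply/funext => t.
  rewrite (coord_val_set_neq p s ne) -/u /F.
  by rewrite (coord_setC p s (t * u) ne').
have -> : prim c (pd d f) p = int01 (F'^~ (coord_val d p)).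
  rewrite /prim; congr (int01 _); apply/funext => t; rewrite /F' -/u.
  by rewrite -(coord_val_set_neq p (t * u) ne') coord_set_id.
have cm : continuous (fun t : R^o => t * u : R^o).
  by move=> t; apply: cvgM; [exact: cvg_id|exact: cvg_cst].
have cfs (X : topologicalType) (a b : X -> R^o) g : smooth g -> continuous a -> continuous b ->
    continuous (fun x => u * g (coord_set d (coord_set c p (a x)) (b x)) : R^o).
  move=> sg ca cb.
  apply: (@prim_integrand_continuous _ d g (fun x => coord_set c p (a x)) (fun=> u) b) => //.
  - exact: smooth_continuous.
  - by apply: coord_set_continuous => //; exact: cst_continuous.
  - exact: cst_continuous.
apply: int01_derive.
- move=> t s; rewrite /F /F'.
  have h := is_pd_at (coord_set c p (t * u)) s (smooth_is_pd d sf).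
  exact: is_deriveZ.
- by move=> s; apply: cfs => //; exact: cst_continuous.
- apply: cfs; first exact: smooth_pd.
    by apply: (@comp_continuous _ _ _ (fst : R^o * R^o -> R^o) _ _ cm) => q; exact: cvg_fst.
  by move=> q; exact: cvg_snd.
Qed.

Lemma is_derive_mulr (a x : R^o) : is_derive x (1 : R^o) (fun s : R^o => a * s : R^o) a.
Proof.
have := is_deriveZ (f := id) a (is_derive_id x (1 : R^o)).
by rewrite /GRing.scale /= mulr1.
Qed.

Lemma is_derive_mull (a x : R^o) : is_derive x (1 : R^o) (fun s : R^o => s * a : R^o) a.
Proof.
rewrite (_ : (fun _ => _) = (fun s : R^o => a * s)); first exact: is_derive_mulr.
by apply/funext => s; rewrite mulrC.
Qed.

Lemma is_derive_comp_lin (g : R^o -> R^o) (g' : R^o -> R^o) (a s : R^o) :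
  (forall r, is_derive r (1 : R^o) g (g' r)) ->
  is_derive s (1 : R^o) (fun s : R^o => g (s * a)) (a * g' (s * a)).
Proof.
move=> dg; have h := dg (s * a); have h' := is_derive_mull a s.
rewrite mulrC; exact: (is_derive1_comp (f := g) (g := fun s => s * a)).
Qed.

Lemma is_derive_mul_comp_lin (g g' : R^o -> R^o) (a s : R^o) :
  (forall r, is_derive r (1 : R^o) g (g' r)) ->
  is_derive s (1 : R^o) (fun s : R^o => s * g (s * a) : R^o)
    (g (s * a) + s * (a * g' (s * a))).
Proof.
move=> dg; have h := is_derive_comp_lin a s dg.
have := is_deriveM (f := id) (is_derive_id s (1 : R^o)) h.
by move=> H; apply: is_derive_eq; rewrite /GRing.scale /=; ring.
Qed.

(** With g the restriction of f to the line of the coordinate c, the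
    derivative of s g(t s) in s is the derivative of t g(t s) in t, so the
    integral is g(s). *)
Lemma is_pd_prim c f : smooth f -> is_pd c (prim c f) f.
Proof.
move=> sf p; set u := coord_val c p.
pose g s : R^o := f (coord_set c p s).
pose g' s : R^o := pd c f (coord_set c p s).
have dg r : is_derive r (1 : R^o) g (g' r) by apply: is_pd_at; exact: smooth_is_pd.
have cg : continuous g.
  apply: comp_continuous (smooth_continuous sf); apply: coord_set_continuous.
    exact: cst_continuous.
  by move=> t; exact: cvg_id.
have cg' : continuous g'.
  apply: comp_continuous (smooth_continuous (smooth_pd c sf)); apply: coord_set_continuous.
    exact: cst_continuous.
  by move=> t; exact: cvg_id.
have -> : (fun s : R^o => prim c f (coord_set c p s)) =
    (fun s => int01 (fun t => s * g (s * t))).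
  apply/funext => s; rewrite /prim; congr (int01 _); apply/funext => t.
  by rewrite coord_val_set coord_set_set /g mulrC [t * s]mulrC mulrC.
have -> : f p = int01 (fun t => g (u * t) + u * (t * g' (u * t))).
  have H1 t : is_derive t (1 : R^o) (fun t : R^o => t * g (t * u) : R^o)
      (g (u * t) + u * (t * g' (u * t))).
    have := is_derive_mul_comp_lin u t dg; rewrite mulrC.
    by move=> H; apply: is_derive_eq; ring.
  have cm : continuous (fun t : R^o => u * t : R^o).
    by move=> t; apply: cvgM; [exact: cvg_cst|exact: cvg_id].
  have H2 : continuous (fun t : R^o => g (u * t) + u * (t * g' (u * t)) : R^o).
    move=> t; apply: cvgD; first exact: (comp_continuous cm cg).
    apply: cvgM; first exact: cvg_cst.
    by apply: cvgM; [exact: cvg_id|exact: (comp_continuous cm cg')].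
  by rewrite (int01_FTC H1 H2) mul1r mul1r mul0r subr0 /g coord_set_id.
have cfst : continuous (fst : R^o * R^o -> R^o) by move=> q; exact: cvg_fst.
have csnd : continuous (snd : R^o * R^o -> R^o) by move=> q; exact: cvg_snd.
have cmul : continuous (fun q : R^o * R^o => q.2 * q.1 : R^o).
  by move=> q; apply: cvgM; [exact: csnd|exact: cfst].
apply: (@int01_derive _ (fun t s => s * g (s * t))
   (fun t s => g (s * t) + s * (t * g' (s * t)))).
- by move=> t s; exact: is_derive_mul_comp_lin.
- move=> s t; apply: cvgM; first exact: cvg_cst.
  apply: (comp_continuous _ cg) => r.
  by apply: cvgM; [exact: cvg_cst|exact: cvg_id].
- move=> q; apply: cvgD; first exact: (comp_continuous cmul cg).
  apply: cvgM; first exact: csnd.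
  by apply: cvgM; [exact: cfst|exact: (comp_continuous cmul cg')].
Qed.

Lemma smooth_prim c f : smooth f -> smooth (prim c f).
Proof.
move=> sf; split.
  have [[S dS] _] := sf.
  exists ((if c is Cu i then [:: i] else [::]) ++ S) => p q e1 e2.
  have ev : coord_val c p = coord_val c q.
    by case: c e2 => [||i] e2 /=; rewrite ?e1 //; apply: e2; exact: mem_head.
  rewrite /prim; congr (int01 _); apply/funext => t; rewrite ev; congr (_ * _).
  apply: dS; first by case: (c) => /=; rewrite ?e1.
  move=> i iS; have e2i : p.2 i = q.2 i by apply: e2; rewrite /= mem_cat [i \in S]iS orbT.
  by case: (c) => //= j; rewrite e2i.
move=> k; elim: k f sf => [|k IH] f sf.
  by split; first by apply: prim_continuous; exact: smooth_continuous.
apply: CkS; first by apply: prim_continuous; exact: smooth_continuous.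
move=> d; have [->|ne] := pselect (c = d).
  by exists f; [exact: is_pd_prim|case: sf].
by exists (prim c (pd d f)); [exact: is_pd_prim_neq|apply/IH/smooth_pd].
Qed.

Lemma prim_integrand1_continuous c f p : smooth f ->
  continuous (fun t : R^o => coord_val c p * f (coord_set c p (t * coord_val c p)) : R^o).
Proof.
move=> sf.
apply: (@prim_integrand_continuous _ c f (fun=> p) (fun=> coord_val c p)).
- exact: smooth_continuous.
- exact: cst_continuous.
- exact: cst_continuous.
- by move=> t; apply: cvgM; [exact: cvg_id|exact: cvg_cst].
Qed.

Lemma primD c f g : smooth f -> smooth g -> prim c (f + g) = prim c f + prim c g.
Proof.
move=> sf sg; apply/funext => p; rewrite !fctE /prim -int01D.
- by congr (int01 _); apply/funext => t; rewrite mulrDr.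
- exact: prim_integrand1_continuous.
- exact: prim_integrand1_continuous.
Qed.

Lemma prim_pd c f p : smooth f -> prim c (pd c f) p = f p - f (coord_set c p 0).
Proof.
move=> sf; have H1 t : is_derive t (1 : R^o)
    (fun t : R^o => f (coord_set c p (t * coord_val c p)))
    (coord_val c p * pd c f (coord_set c p (t * coord_val c p))).
  apply: (@is_derive_comp_lin (fun s => f (coord_set c p s))
    (fun s => pd c f (coord_set c p s))).
  by move=> r; apply: is_pd_at; exact: smooth_is_pd.
have H2 := @prim_integrand1_continuous c _ p (smooth_pd c sf).
by rewrite /prim (int01_FTC H1 H2) mul1r mul0r coord_set_id.
Qed.

(** f is its value at c = 0 plus the antiderivative of its c-derivative.
    Applying d/dd, which commutes with the antiderivative, and then d/dc gives
    the symmetry. *)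
Lemma pd_comm c d f : smooth f -> pd c (pd d f) = pd d (pd c f).
Proof.
move=> sf; have [->//|ne] := pselect (c = d).
apply: is_pdE.
pose f0 : jet R I -> R^o := fun p => f (coord_set c p 0).
have ne' : d <> c by move=> e; apply: ne.
have d0 : is_pd d f0 (fun p => pd d f (coord_set c p 0)).
  move=> p; have := smooth_is_pd d sf (coord_set c p 0).
  rewrite coord_val_set_neq // (_ : (fun s => _) = (fun s : R^o => f0 (coord_set d p s))) //.
  by apply/funext => s; rewrite /f0 coord_setC.
have e1 : pd d f = (fun p => pd d f (coord_set c p 0)) + prim c (pd d (pd c f)).
  apply: is_pdE.
  have {1}-> : f = f0 + prim c (pd c f).
    by apply/funext => p; rewrite fctE prim_pd // addrC subrK.
  by apply: is_pdD => //; apply: is_pd_prim_neq => //; exact: smooth_pd.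
rewrite e1 -[X in is_pd _ _ X]add0r; apply: is_pdD.
  move=> p; rewrite (_ : (fun s => _) = cst (pd d f (coord_set c p 0))).
    exact: is_derive_cst.
  by apply/funext => s; rewrite coord_set_set.
by apply/is_pd_prim/smooth_pd/smooth_pd.
Qed.

End Primitives.

(** * The ring of smooth functions and vector fields *)
Lemma fsbig_uniq_seq (V : nmodType) (I : choiceType) (F : I -> V) (s : seq I) :
  uniq s -> (forall k, k \notin s -> F k = 0) ->
  \sum_(k \in [set: I]) F k = \sum_(k <- s) F k.
Proof.
move=> us h; rewrite [RHS]fsbig_seq //; symmetry.
rewrite (fsbig_widen [set` s] setT F) // => k [_ /= ks].
by apply: h; apply/negP.
Qed.

Section SmoothRing.
Variables (R : realType) (I : choiceType).

Definition smooth_pred : {pred (jet R I -> R^o)} := fun f => `[< smooth f >].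

Fact smooth_subring_closed : subring_closed smooth_pred.
Proof.
split=> [|f g /asboolP sf /asboolP sg|f g /asboolP sf /asboolP sg]; apply/asboolP.
- exact: smooth_cst.
- exact/smooth_add/smooth_opp.
- exact: smooth_mul.
Qed.
HB.instance Definition _ :=
  GRing.isSubringClosed.Build (jet R I -> R^o) smooth_pred smooth_subring_closed.

Record smoothfun := SmoothFun { fval :> jet R I -> R^o; _ : fval \in smooth_pred }.
HB.instance Definition _ := [isSub for fval].
HB.instance Definition _ := [Choice of smoothfun by <:].
HB.instance Definition _ := [SubChoice_isSubComNzRing of smoothfun by <:].

Implicit Types (f g : smoothfun) (c d : Defs.coord I).

Lemma fval_smooth f : smooth (fval f). Proof. by case: f => f /= /asboolP. Qed.
Lemma fval_inj : injective fval. Proof. exact: val_inj. Qed.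
Definition mksmooth h (sh : smooth h) : smoothfun := SmoothFun (asboolT sh).
Lemma fvalD f g : fval (f + g) = fval f + fval g. Proof. by []. Qed.
Lemma fvalN f : fval (- f) = - fval f. Proof. by []. Qed.
Lemma fvalM f g : fval (f * g) = fval f * fval g. Proof. by []. Qed.
Lemma fval0 : fval 0 = 0. Proof. by []. Qed.
Lemma fval1 : fval 1 = 1. Proof. by []. Qed.
Lemma fval_sum (T : Type) (s : seq T) (F : T -> smoothfun) p :
  fval (\sum_(k <- s) F k) p = \sum_(k <- s) fval (F k) p.
Proof.
elim: s => [|k s IH]; first by rewrite !big_nil.
by rewrite !big_cons fvalD fctE IH.
Qed.

Definition pdS c f : smoothfun := mksmooth (smooth_pd c (fval_smooth f)).
Lemma pdS_is_additive c : nmod_morphism (pdS c).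
Proof.
split; first apply: fval_inj.
  apply: is_pdE => p; exact: (is_derive_cst (0 : R^o)).
move=> f g; apply: fval_inj.
exact: is_pdE (is_pdD (smooth_is_pd c (fval_smooth f)) (smooth_is_pd c (fval_smooth g))).
Qed.
HB.instance Definition _ c :=
  GRing.isNmodMorphism.Build _ _ (pdS c) (pdS_is_additive c).

Lemma pdS_mul c f g : pdS c (f * g) = pdS c f * g + f * pdS c g.
Proof.
apply: fval_inj.
exact: is_pdE (is_pdM (smooth_is_pd c (fval_smooth f)) (smooth_is_pd c (fval_smooth g))).
Qed.

Lemma pdS_comm c d f : pdS c (pdS d f) = pdS d (pdS c f).
Proof. by apply: fval_inj; apply: pd_comm; exact: fval_smooth. Qed.

Definition primS c f : smoothfun := mksmooth (smooth_prim c (fval_smooth f)).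
Lemma primS_is_additive c : nmod_morphism (primS c).
Proof.
have D f g : primS c (f + g) = primS c f + primS c g.
  by apply: fval_inj; apply: primD; exact: fval_smooth.
by split=> //; apply: (addrI (primS c 0)); rewrite -D !addr0.
Qed.
HB.instance Definition _ c :=
  GRing.isNmodMorphism.Build _ _ (primS c) (primS_is_additive c).

Lemma pdS_primS c f : pdS c (primS c f) = f.
Proof. by apply: fval_inj; apply: is_pdE; apply: is_pd_prim; exact: fval_smooth. Qed.
Lemma pdS_primS_neq c d f : c <> d -> pdS d (primS c f) = primS c (pdS d f).
Proof.
by move=> ne; apply: fval_inj; apply: is_pdE; apply: is_pd_prim_neq => //; exact: fval_smooth.
Qed.

Definition coordS c : smoothfun := mksmooth (@smooth_coord R I c).
Lemma pdS_coordS c d : pdS d (coordS c) = (`[< d = c >])%:R.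
Proof.
by apply: fval_inj; rewrite [LHS](is_pdE (@is_pd_coord R I c d)); case: asboolP.
Qed.

Lemma sfun_torsion_free k f : f *+ k.+1 = 0 -> f = 0.
Proof.
move=> h; apply: fval_inj; apply/funext => p.
have : fval (f *+ k.+1) p = 0 by rewrite h.
have -> : fval (f *+ k.+1) p = fval f p *+ k.+1.
  elim: (k.+1) => [//|m IH]; by rewrite !mulrS fvalD fctE IH.
by move/eqP; rewrite mulrn_eq0 /= => /eqP.
Qed.

Lemma sfun_support f : {s : seq I | uniq s /\ forall k, k \notin s -> pdS (Cu k) f = 0}.
Proof.
apply: cid; have [[s ds] _] := fval_smooth f; exists (undup s).
split=> [|k ks]; first exact: undup_uniq.
by apply: fval_inj; apply: pd_indep ds _; rewrite mem_undup in ks.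
Qed.
Definition supp f : seq I := projT1 (sfun_support f).
Lemma supp_uniq f : uniq (supp f).
Proof. by rewrite /supp; case: sfun_support => s []. Qed.
Lemma suppP f k : k \notin supp f -> pdS (Cu k) f = 0.
Proof. by move: k; rewrite /supp; case: sfun_support => s []. Qed.

(** X, T, D_x and D_t all have this shape: d/db + \sum_k a_k d/du_k. *)
Definition vfield (b : Defs.coord I) (a : I -> jet R I -> R^o) (h : jet R I -> R^o) : jet R I -> R^o :=
  fun p => pd b h p + \sum_(k \in [set: I]) a k p * pd (Cu k) h p.

Definition vfieldS b (a : I -> smoothfun) f : smoothfun :=
  pdS b f + \sum_(k <- supp f) a k * pdS (Cu k) f.

Lemma vfieldSE b a f (s : seq I) : uniq s ->
  (forall k, k \notin s -> pdS (Cu k) f = 0) ->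
  vfieldS b a f = pdS b f + \sum_(k <- s) a k * pdS (Cu k) f.
Proof.
move=> us h; rewrite /vfieldS; congr (_ + _).
transitivity (\sum_(k \in [set: I]) a k * pdS (Cu k) f).
  symmetry; apply: fsbig_uniq_seq; first exact: supp_uniq.
  by move=> k /suppP ->; rewrite mulr0.
by apply: fsbig_uniq_seq => // k /h ->; rewrite mulr0.
Qed.

Lemma fval_vfieldS b a f : fval (vfieldS b a f) = vfield b (fun k => fval (a k)) (fval f).
Proof.
apply/funext => p; rewrite /vfield (fsbig_uniq_seq (supp_uniq f)).
  by rewrite fvalD fctE fval_sum.
move=> k /suppP /(congr1 (fun g => fval g p)) /= ->.
exact: mulr0.
Qed.

Lemma common_supp f g : exists s, [/\ uniq s, (forall k, k \notin s -> pdS (Cu k) f = 0) &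
  (forall k, k \notin s -> pdS (Cu k) g = 0)].
Proof.
exists (undup (supp f ++ supp g)); split; first exact: undup_uniq.
  by move=> k; rewrite mem_undup mem_cat negb_or => /andP[/suppP].
by move=> k; rewrite mem_undup mem_cat negb_or => /andP[_ /suppP].
Qed.

Lemma vfieldS_is_additive b a : nmod_morphism (vfieldS b a).
Proof.
have D f g : vfieldS b a (f + g) = vfieldS b a f + vfieldS b a g.
  have [s [us hf hg]] := common_supp f g.
  rewrite !(@vfieldSE _ _ _ s) // => [|k ks]; last by rewrite raddfD /= hf // hg // addr0.
  rewrite raddfD /= addrACA -big_split /=; congr (_ + _).
  by apply: eq_bigr => k _; rewrite raddfD mulrDr.
by split=> //; apply: (addrI (vfieldS b a 0)); rewrite -D !addr0.
Qed.
HB.instance Definition _ b a :=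
  GRing.isNmodMorphism.Build _ _ (vfieldS b a) (vfieldS_is_additive b a).

Lemma vfieldS_mul b a f g : vfieldS b a (f * g) = vfieldS b a f * g + f * vfieldS b a g.
Proof.
have [s [us hf hg]] := common_supp f g.
rewrite !(@vfieldSE _ _ _ s) // => [|k ks]; last first.
  by rewrite pdS_mul hf // hg // mulr0 mul0r addr0.
rewrite pdS_mul mulrDl mulrDr addrACA mulr_suml mulr_sumr -big_split /=; congr (_ + _).
apply: eq_bigr => k _; rewrite pdS_mul; ring.
Qed.

Lemma vfieldS_coord b a k : vfieldS b a (coordS (Cu k)) = pdS b (coordS (Cu k)) + a k.
Proof.
rewrite (@vfieldSE _ _ _ [:: k]) // => [|j]; last first.
  by rewrite inE pdS_coordS; case: asboolP => // -[->]; rewrite eqxx.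
by rewrite big_seq1 (pdS_coordS (Cu k) (Cu k)) asboolT // mulr1.
Qed.

Lemma pdS_vfieldS b a c f s : uniq s -> (forall k, k \notin s -> pdS (Cu k) f = 0) ->
  pdS c (vfieldS b a f) = vfieldS b a (pdS c f) + \sum_(k <- s) pdS c (a k) * pdS (Cu k) f.
Proof.
move=> us h; rewrite (vfieldSE _ _ us h).
rewrite (vfieldSE (f := pdS c f) _ _ us) => [|k ks]; last by rewrite pdS_comm h ?raddf0.
rewrite raddfD raddf_sum /= pdS_comm -addrA -big_split /=; congr (_ + _).
by apply: eq_bigr => k _; rewrite pdS_mul pdS_comm addrC.
Qed.

End SmoothRing.

(** * The evolution algebra of u_t = K *)
Lemma Cu_inj (I : Type) (i j : I) : Cu i = Cu j -> i = j.
Proof. by case. Qed.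

Section Evolution.
Variables (R : realType).
Notation S := (smoothfun R nat).
Notation pu i := (@pdS R nat (@Cu nat i)).
Implicit Types (f g : S).

Definition XS : {additive S -> S} := vfieldS Cx (fun i => coordS R (Cu i.+1)).
Definition TS (Kf : S) : {additive S -> S} := vfieldS Ct (fun i => iter i XS Kf).

Lemma fval_XS f : fval (XS f) = Xfun (fval f).
Proof. exact: fval_vfieldS. Qed.
Lemma fval_iter_XS k f : fval (iter k XS f) = iter k (@Xfun R) (fval f).
Proof. by elim: k => //= k IH; rewrite -IH; exact: fval_XS. Qed.
Lemma fval_TS Kf f : fval (TS Kf f) = Tfun (fval Kf) (fval f).
Proof.
rewrite fval_vfieldS /vfield /Tfun; apply/funext => p; congr (_ + _).
by apply: eq_fsbigr => k _; rewrite fval_iter_XS.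
Qed.

Lemma nat_bound f : exists N, forall k, (N <= k)%N -> pu k f = 0.
Proof.
exists (\max_(k <- supp f) k).+1 => k hk; apply: suppP; apply: contraL hk => ks.
by rewrite -ltnNge ltnS; apply: leq_bigmax_seq.
Qed.

Lemma iota_off N (P : nat -> Prop) : (forall k, (N <= k)%N -> P k) ->
  forall k, k \notin iota 0 N -> P k.
Proof. by move=> h k; rewrite mem_iota /= add0n -leqNgt; apply: h. Qed.

Lemma vfieldS_nat b a f N : (forall k, (N <= k)%N -> pu k f = 0) ->
  vfieldS b a f = pdS b f + \sum_(k < N) a k * pu k f.
Proof.
move=> h; rewrite (vfieldSE b a (iota_uniq 0 N) (iota_off h)).
by rewrite -[in iota 0 N](subn0 N) big_mkord.
Qed.

Lemma pu_vfieldS b a i f N : (forall k, (N <= k)%N -> pu k f = 0) ->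
  pu i (vfieldS b a f) = vfieldS b a (pu i f) + \sum_(k < N) pu i (a k) * pu k f.
Proof.
move=> h; rewrite (pdS_vfieldS b a _ (iota_uniq 0 N) (iota_off h)).
by rewrite -[in iota 0 N](subn0 N) big_mkord.
Qed.

Lemma pu_XS i f : pu i (XS f) = XS (pu i f) + (if i is i'.+1 then pu i' f else 0).
Proof.
have [N hN] := nat_bound f.
have h k : (maxn N i <= k)%N -> pu k f = 0 by rewrite geq_max => /andP[/hN].
rewrite [LHS](pu_vfieldS _ _ _ h); congr (_ + _).
have E (k : nat) : pu i (coordS R (Cu k.+1)) = (i == k.+1)%:R.
  rewrite pdS_coordS; congr (nat_of_bool _)%:R.
  by apply/asboolP/eqP => [[]//|->].
case: i h E => [|i] h E; first by rewrite big1 // => k _; rewrite E mul0r.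
have iN : (i < maxn N i.+1)%N by rewrite leq_max ltnSn orbT.
rewrite (bigD1 (Ordinal iN)) //= E eqxx mul1r big1 ?addr0 // => k hk.
by rewrite E eqSS (_ : (i == k) = false) ?mul0r //; apply: contraNF hk => /eqP e; apply/eqP/val_inj.
Qed.

(** A bracket of vector fields has no second-order part. *)
Lemma vfieldS_comm (b b' : Defs.coord nat) (a a' : nat -> S) f :
  (forall k, vfieldS b a (a' k) = vfieldS b' a' (a k)) ->
  vfieldS b a (vfieldS b' a' f) = vfieldS b' a' (vfieldS b a f).
Proof.
move=> haa; have [N hN] := nat_bound f.
have hd c k : (N <= k)%N -> pu k (pdS c f) = 0 by move=> /hN h; rewrite pdS_comm h raddf0.
rewrite [in LHS](vfieldS_nat b' a' hN) [in RHS](vfieldS_nat b a hN) !raddfD !raddf_sum /=.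
under eq_bigr => k _ do rewrite vfieldS_mul haa.
under [in RHS]eq_bigr => k _ do rewrite vfieldS_mul.
rewrite !big_split /=.
suff E : vfieldS b a (pdS b' f) + \sum_(k < N) a' k * vfieldS b a (pu k f) =
         vfieldS b' a' (pdS b f) + \sum_(k < N) a k * vfieldS b' a' (pu k f).
  by rewrite addrCA E addrCA.
rewrite (vfieldS_nat b a (hd b')) (vfieldS_nat b' a' (hd b)) pdS_comm -!addrA; congr (_ + _).
under [X in _ + X]eq_bigr => k _ do rewrite (vfieldS_nat b a (hd (Cu (nat_of_ord k)))) mulrDr.
under [X in _ = _ + X]eq_bigr => k _ do rewrite (vfieldS_nat b' a' (hd (Cu (nat_of_ord k)))) mulrDr.
rewrite !big_split /= addrCA; congr (_ + _); first by apply: eq_bigr => k _; rewrite pdS_comm.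
congr (_ + _); first by apply: eq_bigr => k _; rewrite pdS_comm.
under eq_bigr => k _ do rewrite mulr_sumr.
under [in RHS]eq_bigr => k _ do rewrite mulr_sumr.
rewrite exchange_big /=; apply: eq_bigr => i _; apply: eq_bigr => j _.
by rewrite pdS_comm mulrCA.
Qed.

Lemma XS_TS Kf f : XS (TS Kf f) = TS Kf (XS f).
Proof.
apply: vfieldS_comm => k; rewrite vfieldS_coord pdS_coordS asboolF //.
by rewrite add0r.
Qed.

Lemma base_primitiveS Kf f : (forall i, pu i f = 0) ->
  exists2 g, forall i, pu i g = 0 & TS Kf g = f.
Proof.
move=> h; have g0 i : pu i (primS Ct f) = 0 by rewrite pdS_primS_neq // h raddf0.
exists (primS Ct f) => //.
rewrite [LHS](@vfieldS_nat Ct _ _ 0) => [|k _]; last exact: g0.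
by rewrite big_ord0 addr0 pdS_primS.
Qed.

Section Build.
Variables (n : nat) (Kf : S).
Hypotheses (n_ge2 : (2 <= n)%N)
  (K_order : depends_on (fun i => (i <= n)%N) (fval Kf))
  (K_sep : forall p, pd (Cu n) (fval Kf) p <> 0).

Fact pu_rhsS i : (n < i)%N -> pu i Kf = 0.
Proof.
by move=> ni; apply: fval_inj; apply: pd_indep K_order _; rewrite -ltnNge.
Qed.

Fact separant_regularS f : pu n Kf * f = 0 -> f = 0.
Proof.
move=> h; apply: fval_inj; apply/funext => p.
have : fval (pu n Kf * f) p = 0 by rewrite h.
by rewrite fvalM fctE => /eqP; rewrite mulf_eq0 => /orP[/eqP /K_sep//|/eqP].
Qed.

Definition evolution : evolution_algebra :=
  @EvolutionAlgebra S (fun i => pu i) XS (TS Kf) Kf n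
    (fun i => @primS R nat (Cu i))
    (fun i => @pdS_mul R nat (Cu i)) (vfieldS_mul _ _) (vfieldS_mul _ _)
    (fun i j => @pdS_comm R nat (Cu i) (Cu j))
    nat_bound pu_XS (fun N i f h => pu_vfieldS _ _ i h) (XS_TS Kf)
    (fun i => @pdS_primS R nat (Cu i))
    (fun i j f ne => @pdS_primS_neq R nat (Cu i) (Cu j) f (fun e => elimN eqP ne (Cu_inj e)))
    (base_primitiveS Kf) (@sfun_torsion_free R nat) n_ge2 pu_rhsS separant_regularS.

End Build.
End Evolution.

(** * The Euler operator on J^oo(R^2, R) *)
Section EulerOnJ.
Variables (R : realType).
Notation S := (smoothfun R nat).
Notation SJ := (smoothfun R (nat * nat)%type).
Notation pu i := (@pdS R nat (@Cu nat i)).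
Implicit Types (f g Q : S).

Definition proj_J (p : jet R (nat * nat)%type) : jet R nat := (p.1, fun i => p.2 (0%N, i)).

Lemma proj_J_continuous : continuous proj_J.
Proof.
apply: jet_continuous => -[||i].
- exact: (@coord_val_continuous R _ Ct).
- exact: (@coord_val_continuous R _ Cx).
- exact: (@coord_val_continuous R _ (Cu (0%N, i))).
Qed.

(** The functions pulled back to J^oo(R^2, R) depend on t, x and the u_(0,i)
    only. *)
Definition pull_coord (c : Defs.coord (nat * nat)%type) : option (Defs.coord nat) :=
  match c with
  | Ct => Some Ct | Cx => Some Cx | Cu (0, i) => Some (Cu i) | Cu _ => None
  end.

Lemma is_pd_to_J (h : jet R nat -> R^o) c : smooth h ->
  is_pd c (to_J h) (if pull_coord c is Some d then to_J (pd d h) else 0).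
Proof.
move=> sh p; case: c => [||[[|a] i]] /=.
- exact: (smooth_is_pd Ct sh (proj_J p)).
- exact: (smooth_is_pd Cx sh (proj_J p)).
- exact: (smooth_is_pd (Cu i) sh (proj_J p)).
- rewrite (_ : (fun s => _) = cst (to_J h p)); first exact: is_derive_cst.
  by apply/funext => s; congr (h (_, _)).
Qed.

Lemma smooth_to_J (h : jet R nat -> R^o) : smooth h -> smooth (to_J h).
Proof.
move=> sh; split.
  have [[s ds] _] := sh; exists [seq (0%N, i) | i <- s] => p q e1 e2.
  apply: ds => //= i iS; apply: e2; apply: map_f; exact: iS.
have ch (h' : jet R nat -> R^o) : smooth h' -> continuous (to_J h').
  by move=> sg; exact: comp_continuous proj_J_continuous (smooth_continuous sg).
move=> k; elim: k h sh => [|k IH] h sh; first by apply: (@Ck0 R _ (to_J h)); apply: ch.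
apply: CkS; first exact: ch.
move=> c; exists (if pull_coord c is Some d then to_J (pd d h) else 0); first exact: is_pd_to_J.
case: pull_coord => [d|]; first exact/IH/smooth_pd.
exact: (@Ck_cst R _ k 0).
Qed.

Definition toJ f : SJ := mksmooth (smooth_to_J (fval_smooth f)).

Lemma toJ_is_additive : nmod_morphism toJ.
Proof. by split=> [|f g]; apply: fval_inj; apply/funext => p. Qed.
HB.instance Definition _ := GRing.isNmodMorphism.Build _ _ toJ toJ_is_additive.
Lemma toJM f g : toJ (f * g) = toJ f * toJ g.
Proof. by apply: fval_inj; apply/funext => p. Qed.
Lemma toJ1 : toJ 1 = 1.
Proof. by apply: fval_inj; apply/funext => p. Qed.

Lemma toJ_inj : injective toJ.
Proof.
move=> f g /(congr1 (@fval _ _)) e; apply: fval_inj; apply/funext => p.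
have := congr1 (fun h : jet R (nat * nat)%type -> R^o => h (p.1, fun k => p.2 k.2)) e.
by rewrite /= /to_J /=; case: p.
Qed.

Lemma pdS_toJ c f :
  pdS c (toJ f) = if pull_coord c is Some d then toJ (pdS d f) else 0.
Proof.
apply: fval_inj; rewrite [LHS](is_pdE (is_pd_to_J c (fval_smooth f))).
by case: pull_coord.
Qed.

Definition DxS : {additive SJ -> SJ} :=
  vfieldS Cx (fun k : nat * nat => coordS R (Cu (k.1, k.2.+1))).
Definition DtS : {additive SJ -> SJ} :=
  vfieldS Ct (fun k : nat * nat => coordS R (Cu (k.1.+1, k.2))).

Lemma fval_DxS F : fval (DxS F) = Dx (fval F).
Proof. exact: fval_vfieldS. Qed.
Lemma fval_DtS F : fval (DtS F) = Dt (fval F).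
Proof. exact: fval_vfieldS. Qed.
Lemma fval_iter_DxS i F : fval (iter i DxS F) = iter i (@Dx R) (fval F).
Proof. by elim: i => //= i IH; rewrite -IH; exact: fval_DxS. Qed.
Lemma fval_iter_DtS i F : fval (iter i DtS F) = iter i (@Dt R) (fval F).
Proof. by elim: i => //= i IH; rewrite -IH; exact: fval_DtS. Qed.

(** The indices of the u_(0,i), i < N. *)
Definition row0 N : seq (nat * nat) := [seq (0%N, i) | i <- iota 0 N].

Lemma row0_uniq N : uniq (row0 N).
Proof. by rewrite map_inj_uniq ?iota_uniq // => i j []. Qed.

Lemma mem_row0 N a i : ((a, i) \in row0 N) = (a == 0%N) && (i < N)%N.
Proof.
apply/mapP/andP => [[j + [-> ->]]|[/eqP -> iN]]; first by rewrite mem_iota.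
by exists i; rewrite ?mem_iota.
Qed.

Lemma toJ_off f N : (forall k, (N <= k)%N -> pu k f = 0) ->
  forall k, k \notin row0 N -> pdS (Cu k) (toJ f) = 0.
Proof.
move=> h [a i]; rewrite mem_row0 negb_and -leqNgt pdS_toJ.
by case: a => [|a] //= iN; rewrite h ?raddf0.
Qed.

Lemma sum_row0 (V : nmodType) N (F : nat * nat -> V) :
  \sum_(k <- row0 N) F k = \sum_(i < N) F (0%N, nat_of_ord i).
Proof. by rewrite big_map -[in iota 0 N](subn0 N) big_mkord. Qed.

Lemma DxS_toJ f : DxS (toJ f) = toJ (XS R f).
Proof.
have [N hN] := nat_bound f.
rewrite [LHS](vfieldSE _ _ (row0_uniq N) (toJ_off hN)) sum_row0.
rewrite [XS R f](vfieldS_nat _ _ hN) raddfD raddf_sum /= pdS_toJ; congr (_ + _).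
apply: eq_bigr => i _; rewrite pdS_toJ toJM; congr (_ * _).
by apply: fval_inj.
Qed.

Lemma iter_DxS_toJ i f : iter i DxS (toJ f) = toJ (iter i (XS R) f).
Proof. by elim: i => //= i ->; rewrite DxS_toJ. Qed.

Lemma DtS_toJ f N : (forall k, (N <= k)%N -> pu k f = 0) ->
  DtS (toJ f) = toJ (pdS Ct f) + \sum_(i < N) coordS R (Cu (1%N, nat_of_ord i)) * toJ (pu i f).
Proof.
move=> hN; rewrite [LHS](vfieldSE _ _ (row0_uniq N) (toJ_off hN)) sum_row0 pdS_toJ.
by congr (_ + _); apply: eq_bigr => i _; rewrite pdS_toJ.
Qed.

Variable Kf : S.
Definition DeltaS : SJ := coordS R (Cu (1%N, 0%N)) - toJ Kf.

Lemma DxS_coord k : DxS (coordS R (Cu k)) = coordS R (Cu (k.1, k.2.+1)).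
Proof. by rewrite [LHS]vfieldS_coord pdS_coordS asboolF // add0r. Qed.

Lemma iter_DxS_Delta i :
  iter i DxS DeltaS = coordS R (Cu (1%N, i)) - toJ (iter i (XS R) Kf).
Proof. by elim: i => //= i ->; rewrite raddfB /= DxS_coord DxS_toJ. Qed.

Lemma iter_additiveD (F : {additive SJ -> SJ}) i : {morph iter i F : a b / a + b}.
Proof. by elim: i => [|i IH] a b //=; rewrite IH raddfD. Qed.
Lemma iter_additive0 (F : {additive SJ -> SJ}) i : iter i F 0 = 0.
Proof. by elim: i => //= i ->; rewrite raddf0. Qed.
Lemma iter_additiveB (F : {additive SJ -> SJ}) i a b : iter i F (a - b) = iter i F a - iter i F b.
Proof.
rewrite iter_additiveD; congr (_ + _); apply/eqP; rewrite -addr_eq0 -iter_additiveD addNr.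
by rewrite iter_additive0.
Qed.

Lemma fval_signM (I : choiceType) m (f : smoothfun R I) p :
  fval ((-1) ^+ m * f) p = (-1) ^+ m * fval f p.
Proof.
rewrite fvalM fctE; congr (_ * _); elim: m => [|m IH].
  by rewrite !expr0 fval1.
by rewrite !exprS fvalM fctE IH fvalN fval1.
Qed.

Section Formulas.
Variables (Q : S) (N : nat).
Hypotheses (hQ : forall k, (N <= k)%N -> pu k Q = 0)
           (hK : forall k, (N <= k)%N -> pu k Kf = 0).

Definition FreS : SJ := \sum_(i < N) toJ (pu i Q) * iter i DxS DeltaS.
Definition Fre_adjS : SJ :=
  \sum_(i < N) (-1) ^+ i * iter i DxS (toJ (pu i Q) * DeltaS).
Definition EulerS : SJ := Fre_adjS - DtS (toJ Q)
  - \sum_(i < N) (-1) ^+ i * iter i DxS (toJ (pu i Kf * Q)).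

Lemma fsbig_nat (V : nmodType) (F : nat -> V) : (forall k, (N <= k)%N -> F k = 0) ->
  \sum_(k \in [set: nat]) F k = \sum_(k < N) F k.
Proof.
move=> h; rewrite (fsbig_uniq_seq (iota_uniq 0 N)).
  by rewrite -[in iota 0 N](subn0 N) big_mkord.
by move=> k; rewrite mem_iota /= add0n -leqNgt; exact: h.
Qed.

Lemma FreE : Fre (fval Q) (Delta (fval Kf)) = fval FreS.
Proof.
apply/funext => p; rewrite /Fre fsbig_nat.
  rewrite /FreS fval_sum; apply: eq_bigr => i _.
  by rewrite fvalM fctE fval_iter_DxS.
move=> k hk; have -> : pd (Cu k) (fval Q) = 0 by rewrite -[LHS]/(fval (pu k Q)) hQ.
by rewrite [X in X * _](_ : _ = 0) // mul0r.
Qed.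

Lemma Fre_adjE : Fre_adj (fval Q) (Delta (fval Kf)) = fval Fre_adjS.
Proof.
have E i : (fun q => to_J (pd (Cu i) (fval Q)) q * Delta (fval Kf) q) =
    fval (toJ (pu i Q) * DeltaS) by [].
apply/funext => p; rewrite /Fre_adj fsbig_nat.
  rewrite /Fre_adjS fval_sum; apply: eq_bigr => i _.
  by rewrite E -fval_iter_DxS fval_signM.
by move=> k hk; rewrite E hQ // raddf0 mul0r -fval_iter_DxS iter_additive0 fval0 mulr0.
Qed.

(** Q (u_t - K) depends on the u_(0,i) and on u_(1,0) only; the latter
    contributes - D_t Q. *)
Lemma EulerE : Euler (fun p => to_J (fval Q) p * Delta (fval Kf) p) = fval EulerS.
Proof.
pose G : SJ := toJ Q * DeltaS.
have -> : (fun p => to_J (fval Q) p * Delta (fval Kf) p) = fval G by [].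
have dG0 i : pdS (Cu (0%N, i)) G = toJ (pu i Q) * DeltaS - toJ (pu i Kf * Q).
  rewrite pdS_mul pdS_toJ /DeltaS raddfB /= pdS_toJ pdS_coordS asboolF //.
  rewrite sub0r toJM; ring.
have dG1 a i : pdS (Cu (a.+1, i)) G = if (a == 0%N) && (i == 0%N) then toJ Q else 0.
  rewrite pdS_mul pdS_toJ mul0r add0r /DeltaS raddfB /= pdS_toJ subr0 pdS_coordS.
  case: ifP => [/andP[/eqP -> /eqP ->]|h]; first by rewrite asboolT // mulr1.
  by rewrite asboolF ?mulr0 // => -[a0 i0]; rewrite a0 i0 in h.
have E (k : nat * nat) p : (-1) ^+ (k.1 + k.2) * iter k.2 (@Dx R) (iter k.1 (@Dt R) (pd (Cu k) (fval G))) p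
   = fval ((-1) ^+ (k.1 + k.2) * iter k.2 DxS (iter k.1 DtS (pdS (Cu k) G))) p.
  by rewrite fval_signM fval_iter_DxS fval_iter_DtS.
apply/funext => p; rewrite /Euler.
rewrite (@fsbig_uniq_seq _ _ _ ((1%N, 0%N) :: row0 N)).
- under eq_bigr do rewrite E.
  rewrite -fval_sum; congr (fval _ p).
  rewrite big_cons sum_row0 /= dG1 /= addn0 expr1 mulN1r /EulerS /Fre_adjS.
  under eq_bigr => i _ do rewrite dG0 iter_additiveB mulrBr add0n.
  by rewrite sumrB addrCA addrA.
- by rewrite /= mem_row0 row0_uniq.
- move=> [[|a] i]; rewrite inE mem_row0 E /=.
    rewrite add0n -leqNgt => iN; rewrite dG0 hQ // hK // raddf0 !mul0r raddf0 subr0.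
    by rewrite iter_additive0 mulr0.
  rewrite dG1 orbF xpair_eqE eqSS => /negbTE ->.
  by rewrite iter_additive0 raddf0 iter_additive0 mulr0.
Qed.
End Formulas.

(** D_t Q - F_Q(u_t - K) = T Q, because the total derivative of u_t - K of order
    i is u_(1,i) - X^i K. *)
Lemma char_equationP (Q : S) n : (forall i, (n < i)%N -> pu i Kf = 0) ->
  (fun p => Fre_adj (fval Q) (Delta (fval Kf)) p - Fre (fval Q) (Delta (fval Kf)) p) =
    Euler (fun p => to_J (fval Q) p * Delta (fval Kf) p) <->
  TS Kf Q + \sum_(i < n.+1) (-1) ^+ i * iter i (XS R) (pu i Kf * Q) = 0.
Proof.
move=> hn; have [N0 hN0] := nat_bound Q.
pose N := maxn N0 n.+1.
have hQ k : (N <= k)%N -> pu k Q = 0 by rewrite geq_max => /andP[/hN0].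
have hK k : (N <= k)%N -> pu k Kf = 0 by rewrite geq_max => /andP[_ /hn].
rewrite (EulerE hQ hK) (FreE hQ) (Fre_adjE hQ).
have -> : (fun p => fval (Fre_adjS Q N) p - fval (FreS Q N) p) =
  fval (Fre_adjS Q N - FreS Q N) by [].
have iterX0 i : iter i (XS R) 0 = 0 by elim: i => //= i ->; rewrite raddf0.
have -> : \sum_(i < n.+1) (-1) ^+ i * iter i (XS R) (pu i Kf * Q) =
    \sum_(i < N) (-1) ^+ i * iter i (XS R) (pu i Kf * Q).
  have nN : (n.+1 <= N)%N by rewrite leq_maxr.
  rewrite -(subnKC nN) big_split_ord /= [X in _ = _ + X]big1 ?addr0 // => i _.
  by rewrite hn ?leq_addr // mul0r -iterS iterX0 mulr0.
set Z := TS Kf Q + _.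
have toJ_sign m f : toJ ((-1) ^+ m * f) = (-1) ^+ m * toJ f.
  rewrite toJM; congr (_ * _); elim: m => [|m IH]; first by rewrite !expr0 toJ1.
  by rewrite !exprS toJM IH raddfN /= toJ1.
have key : Fre_adjS Q N - FreS Q N = EulerS Q N + toJ Z.
  have toJ_sum (F : nat -> S) : toJ (\sum_(i < N) F i) = \sum_(i < N) toJ (F i).
    by rewrite raddf_sum.
  have toJD f g : toJ (f + g) = toJ f + toJ g by rewrite raddfD.
  pose U := \sum_(i < N) coordS R (Cu (1%N, nat_of_ord i)) * toJ (pu i Q).
  pose V := \sum_(i < N) toJ (iter i (XS R) Kf * pu i Q).
  pose W := \sum_(i < N) (-1) ^+ i * iter i DxS (toJ (pu i Kf * Q)).
  have e1 : FreS Q N = U - V.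
    rewrite /U /V -sumrB; apply: eq_bigr => i _.
    by rewrite iter_DxS_Delta mulrBr toJM mulrC [toJ _ * toJ _]mulrC.
  have e2 : toJ Z = toJ (pdS Ct Q) + V + W.
    rewrite /Z toJD [TS Kf Q](vfieldS_nat _ _ hQ) toJD.
    rewrite (toJ_sum (fun i => iter i (XS R) Kf * pu i Q)).
    rewrite (toJ_sum (fun i => (-1) ^+ i * iter i (XS R) (pu i Kf * Q))).
    by congr (_ + _); apply: eq_bigr => i _; rewrite toJ_sign -iter_DxS_toJ.
  rewrite e1 e2 /EulerS (DtS_toJ hQ) -/U -/W; ring.
rewrite key; split=> [/fval_inj/(canRL (addKr _))|->].
  by rewrite addNr => h; apply: toJ_inj; rewrite raddf0.
by rewrite raddf0 addr0.
Qed.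

End EulerOnJ.

(** * The module of forms *)
Section FormModule.
Variable R : realType.

(** A copy of the type of forms whose module operations act on all arguments at
    once; [form_subE], [form_linE] and [form_zeroE] identify them with the
    operations iterated from the function types. *)
Definition form : Type := bform R.
Implicit Types (x y z w : form).

Definition form_zero : form := fun _ _ _ _ => 0 : R.
Definition form_add x y : form := fun a b l p => (x a b l p + y a b l p : R).
Definition form_opp x : form := fun a b l p => (- x a b l p : R).
Definition form_scale (r : R) x : form := fun a b l p => (r * x a b l p : R).

Lemma form_ext x y : (forall a b l p, x a b l p = y a b l p) -> x = y.
Proof.
by move=> h; do 3!apply/funext => ?; apply/funext => p; exact: h.
Qed.

HB.instance Definition _ := gen_eqMixin form.
HB.instance Definition _ := gen_choiceMixin form.

Fact form_addA : associative form_add.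
Proof. by move=> x y z; apply: form_ext => a b l p; exact: addrA. Qed.
Fact form_addC : commutative form_add.
Proof. by move=> x y; apply: form_ext => a b l p; exact: addrC. Qed.
Fact form_add0 : left_id form_zero form_add.
Proof. by move=> x; apply: form_ext => a b l p; exact: add0r. Qed.
Fact form_addN : left_inverse form_zero form_opp form_add.
Proof. by move=> x; apply: form_ext => a b l p; exact: addNr. Qed.
HB.instance Definition _ :=
  GRing.isZmodule.Build form form_addA form_addC form_add0 form_addN.

Fact form_scaleA (r s : R) x : form_scale r (form_scale s x) = form_scale (r * s) x.
Proof. by apply: form_ext => a b l p; exact: mulrA. Qed.
Fact form_scale1 : left_id 1 form_scale.
Proof. by move=> x; apply: form_ext => a b l p; exact: mul1r. Qed.
Fact form_scaleDr : right_distributive form_scale +%R.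
Proof. by move=> r x y; apply: form_ext => a b l p; exact: mulrDr. Qed.
Fact form_scaleDl x : {morph form_scale^~ x : r s / r + s}.
Proof. by move=> r s; apply: form_ext => a b l p; exact: mulrDl. Qed.
HB.instance Definition _ :=
  GRing.Zmodule_isLmodule.Build R form form_scaleA form_scale1 form_scaleDr form_scaleDl.

Lemma formD x y a b l : (x + y) a b l = x a b l + y a b l. Proof. by []. Qed.
Lemma formN x a b l : (- x) a b l = - x a b l. Proof. by []. Qed.
Lemma formZ (r : R) x a b l : (r *: x) a b l = r *: x a b l. Proof. by []. Qed.
Lemma form0 a b l : (0 : form) a b l = 0. Proof. by []. Qed.

Lemma form_subE x y : (x : bform R) - y = (x : form) - y.
Proof. exact: form_ext. Qed.
Lemma form_linE (r : R) x y : r *: (x : bform R) + y = r *: (x : form) + y.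
Proof. exact: form_ext. Qed.
Lemma form_zeroE : (0 : bform R) = (0 : form).
Proof. exact: form_ext. Qed.

Lemma coset_modE (B : set form) w : coset_mod B w = coset B w.
Proof. by apply/funext => v; rewrite /coset_mod /coset /= form_subE. Qed.

Lemma lin_classE (r : R) (c d : set form) :
  lin_class r c d = [set r *: v + w | v in c & w in d].
Proof.
rewrite /lin_class; apply/seteqP.
by split=> _ [v cv [w dw <-]]; exists v => //; exists w => //; rewrite form_linE.
Qed.

End FormModule.

(** * Forms as pairs of contact tensors *)
Lemma subrACA (V : zmodType) (a b c d : V) : (a - b) - (c - d) = (a - c) - (b - d).
Proof. by rewrite !opprB addrACA [RHS]addrACA [- b - c]addrC. Qed.

Section Forms.
Variables (R : realType) (n : nat) (Kf : smoothfun R nat).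
Hypotheses (n_ge2 : (2 <= n)%N)
  (K_order : depends_on (fun i => (i <= n)%N) (fval Kf))
  (K_sep : forall p, pd (Cu n) (fval Kf) p <> 0).
Notation S := (smoothfun R nat).
Notation K := (fval Kf).
Let J := evolution n_ge2 K_order K_sep.
Notation tens := (seq nat -> J).
Implicit Types (A B C P : tens) (w v : form R) (l : seq nat) (a b : bool) (s : nat).

Lemma fJN (f : J) : fval (- f) = - fval f. Proof. by []. Qed.
Lemma fJM (f g : J) : fval (f * g) = fval f * fval g. Proof. by []. Qed.
Lemma fJ_sum (T : Type) (r : seq T) (F : T -> J) p :
  fval (\sum_(k <- r) F k) p = \sum_(k <- r) fval (F k) p.
Proof. exact: fval_sum. Qed.

Definition smooth_of (h : jet R nat -> R^o) : S :=
  if pselect (smooth h) is left sh then mksmooth sh else 0.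
Lemma smooth_ofK h : smooth h -> fval (smooth_of h) = h.
Proof. by rewrite /smooth_of; case: pselect. Qed.
Definition of0 A : form R := fun a b l => if a || b then 0 else fval (A l).
Definition of1 A B : form R := fun a b l =>
  if a then if b then 0 else fval (B l) else if b then fval (A l) else 0.
Definition of2 C : form R := fun a b l => if a && b then fval (C l) else 0.

Lemma smooth0 : smooth (0 : jet R nat -> R^o).
Proof. exact: (@smooth_cst R nat 0). Qed.

Lemma vform_smooth_of r s w a b : Omega r s w -> @vform J s (fun l => smooth_of (w a b l)).
Proof.
move=> [h1 h2 h3 [N h4]]; split.
- by move=> l hl; apply: fval_inj; rewrite smooth_ofK // h2 // hl orbT.
- move=> l1 i j l2; apply: fval_inj; rewrite fJN !smooth_ofK //.
- by exists N => l hl; apply: fval_inj; rewrite smooth_ofK // h4.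
Qed.

Lemma Omega0P s w : Omega 0 s w <-> exists2 A, vform s A & w = of0 A.
Proof.
split=> [hw|[A [dA aA [N bA]] ->]].
  exists (fun l => smooth_of (w false false l)); first exact: vform_smooth_of hw.
  have [h1 h2 _ _] := hw.
  apply/funext => -[]; apply/funext => -[]; apply/funext => l; rewrite /of0 /=.
  - exact: (h2 true true l isT).
  - exact: (h2 true false l isT).
  - exact: (h2 false true l isT).
  - by rewrite smooth_ofK.
split.
- by move=> a b l; rewrite /of0; case: ifP => _; [exact: smooth0|exact: fval_smooth].
- by case=> -[] l //=; rewrite /of0 /= => hl; rewrite dA.
- move=> [] [] l1 i j l2; rewrite /of0 /=; [exact/esym/oppr0..|].
  by rewrite aA fJN.
- by exists N => -[] [] l hl; rewrite /of0 //= bA.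
Qed.

Lemma Omega1P s w : Omega 1 s w <-> exists A B, [/\ vform s A, vform s B & w = of1 A B].
Proof.
split=> [hw|[A [B [[dA aA [N bA]] [dB aB [M bB]] ->]]]].
  exists (fun l => smooth_of (w false true l)), (fun l => smooth_of (w true false l)).
  have [h1 h2 _ _] := hw; split; try exact: vform_smooth_of hw.
  apply/funext => -[]; apply/funext => -[]; apply/funext => l; rewrite /of1 /=.
  - exact: (h2 true true l isT).
  - by rewrite smooth_ofK.
  - by rewrite smooth_ofK.
  - exact: (h2 false false l isT).
split.
- by move=> [] [] l; rewrite /of1; try exact: smooth0; exact: fval_smooth.
- by case=> -[] l //=; rewrite /of1 /= => hl; rewrite ?dA ?dB.
- move=> [] [] l1 i j l2; rewrite /of1 /=.
  + exact/esym/oppr0.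
  + by rewrite aB fJN.
  + by rewrite aA fJN.
  + exact/esym/oppr0.
- exists (maxn N M) => -[] [] l hl; rewrite /of1 //=.
    by rewrite (boundedW (leq_maxr N M) bB).
  by rewrite (boundedW (leq_maxl N M) bA).
Qed.

Lemma Omega2P s w : Omega 2 s w <-> exists2 C, vform s C & w = of2 C.
Proof.
split=> [hw|[A [dA aA [N bA]] ->]].
  exists (fun l => smooth_of (w true true l)); first exact: vform_smooth_of hw.
  have [h1 h2 _ _] := hw.
  apply/funext => -[]; apply/funext => -[]; apply/funext => l; rewrite /of2 /=.
  - by rewrite smooth_ofK.
  - exact: (h2 true false l isT).
  - exact: (h2 false true l isT).
  - exact: (h2 false false l isT).
split.
- by move=> a b l; rewrite /of2; case: ifP => _; [exact: fval_smooth|exact: smooth0].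
- by case=> -[] l //=; rewrite /of2 /= => hl; rewrite dA.
- move=> [] [] l1 i j l2; rewrite /of2 /=; [|exact/esym/oppr0..].
  by rewrite aA fJN.
- by exists N => -[] [] l hl; rewrite /of2 //= bA.
Qed.

Lemma of1_inj A B A' B' : of1 A B = of1 A' B' -> A = A' /\ B = B'.
Proof.
move=> e; split; apply/funext => l; apply: fval_inj.
  by move/(congr1 (fun w : bform R => w false true l)): e.
by move/(congr1 (fun w : bform R => w true false l)): e.
Qed.

Lemma of2_inj A B : of2 A = of2 B -> A = B.
Proof.
move=> e; apply/funext => l; apply: fval_inj.
by move/(congr1 (fun w : bform R => w true true l)): e.
Qed.

Lemma bformD (w v : bform R) a b l : (w + v) a b l = w a b l + v a b l.
Proof. by []. Qed.

Lemma of1D A B A' B' : of1 A B + of1 A' B' = of1 (A + A') (B + B').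
Proof.
apply/funext => -[]; apply/funext => -[]; apply/funext => l;
  rewrite formD /of1 /=; by [rewrite addr0 | ].
Qed.
Lemma of1N A B : - of1 A B = of1 (- A) (- B).
Proof.
apply/funext => -[]; apply/funext => -[]; apply/funext => l;
  rewrite formN /of1 /=; by [rewrite oppr0 | ].
Qed.
Lemma of1B A B A' B' : of1 A B - of1 A' B' = of1 (A - A') (B - B').
Proof. by rewrite of1N of1D. Qed.
Lemma of2B A B : of2 A - of2 B = of2 (A - B).
Proof.
apply/funext => -[]; apply/funext => -[]; apply/funext => l;
  rewrite formD formN /of2 /=; by [rewrite subrr | ].
Qed.
Lemma of1_0 : of1 0 0 = 0 :> form R.
Proof. by apply/funext => -[]; apply/funext => -[]. Qed.
Lemma of2_0 : of2 0 = 0 :> form R.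
Proof. by apply/funext => -[]; apply/funext => -[]. Qed.

Lemma Xform_fval w a b A l : (forall l, w a b l = fval (A l)) ->
  Xform w a b l = fval (XV A l).
Proof.
move=> e; apply/funext => p; rewrite /Xform e.
under eq_bigr do rewrite e.
rewrite /XV; elim: l A {w e} => [|i l IH] A.
  by rewrite big_ord0 addr0 -fval_XS.
rewrite big_mkcond big_ord_recl /= -big_mkcond /=.
rewrite fctE -IH [RHS]addrAC -[RHS]addrA; congr (_ + _).
by congr (_ + _); case: (i).
Qed.

Lemma Tform_fval w a b A l N : (forall l, w a b l = fval (A l)) -> bounded N A ->
  Tform K w a b l = fval (TV N A l).
Proof.
move=> e bA; apply/funext => p; rewrite /Tform e.
under eq_bigr => j _ do under eq_fsbigr => k _ do rewrite e.
rewrite /TV; elim: l A bA {w e} => [|i l IH] A bA.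
  by rewrite big_ord0 addr0 -fval_TS.
rewrite big_ord_recl /= fctE -IH; last exact: bounded_slot.
rewrite [RHS]addrAC -[RHS]addrA; congr (_ + _).
congr (_ + _).
rewrite (@fsbig_nat N); last first.
  move=> k hk; rewrite (_ : A (k :: l) = 0) ?mulr0 //.
  by rewrite slotE (bounded_slot0 bA).
rewrite fJ_sum; apply: eq_bigr => k _.
by rewrite fJM fctE -fval_iter_XS.
Qed.

Lemma dV_fval w a b A l : (forall l, w a b l = fval (A l)) ->
  dV w a b l = (-1) ^+ (a + b) *: fval (dvert A l).
Proof.
move=> e; rewrite /dV; congr (_ *: _).
under eq_bigr do rewrite e.
rewrite /dvert; elim: l A {w e} => [|i l IH] A.
  by rewrite big_ord0.
rewrite big_ord_recl /= expr0 scale1r /del /= drop0.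
congr (_ + _); rewrite -IH -sumrN.
by apply: eq_bigr => j _; rewrite /= exprS mulN1r scaleNr.
Qed.


Lemma fJ0 l : fval ((0 : tens) l) = 0. Proof. by []. Qed.
Lemma XV0 : XV (0 : tens) = 0. Proof. by rewrite raddf0. Qed.
Lemma TV0 N : TV N (0 : tens) = 0. Proof. by rewrite raddf0. Qed.
Lemma dvert0 : dvert (0 : tens) = 0. Proof. by rewrite raddf0. Qed.

Lemma Xform_of1 A B : Xform (of1 A B) = of1 (XV A) (XV B).
Proof.
apply/funext => -[]; apply/funext => -[]; apply/funext => l.
- by rewrite (@Xform_fval _ _ _ (0 : tens)) // XV0.
- by rewrite (@Xform_fval _ _ _ B).
- by rewrite (@Xform_fval _ _ _ A).
- by rewrite (@Xform_fval _ _ _ (0 : tens)) // XV0.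
Qed.

Lemma dH_of0 s A : vform s A -> dH K (of0 A) = of1 (XV A) (tdtV A).
Proof.
move=> [_ _ [N bA]].
apply/funext => -[]; apply/funext => -[]; apply/funext => l;
  rewrite /dH bformD /dx_wedge /dt_wedge /of1 /=.
- rewrite (@Xform_fval _ _ _ (0 : tens)) // (@Tform_fval _ _ _ (0 : tens) _ 0) //.
  by rewrite XV0 TV0 fJ0 scaler0 addr0.
- by rewrite (Tform_fval (A := A) l _ bA) // add0r (tdtVE bA).
- by rewrite (@Xform_fval _ _ _ A) // expr0 scale1r addr0.
- by rewrite addr0.
Qed.

Lemma dH_of1 s A B : vform s A -> vform s B ->
  dH K (of1 A B) = of2 (tdtV A - XV B).
Proof.
move=> [_ _ [N bA]] vB.
apply/funext => -[]; apply/funext => -[]; apply/funext => l;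
  rewrite /dH bformD /dx_wedge /dt_wedge /of2 /=.
- rewrite (@Xform_fval _ _ _ B) // (Tform_fval (A := A) l _ bA) //.
  by rewrite expr1 scaleN1r (tdtVE bA) addrC.
- rewrite (@Tform_fval _ _ _ (0 : tens) _ 0) //.
  by rewrite TV0 fJ0 addr0.
- rewrite (@Xform_fval _ _ _ (0 : tens)) //.
  by rewrite XV0 fJ0 scaler0 addr0.
- by rewrite addr0.
Qed.

Lemma dV_of1 A B : dV (of1 A B) = of1 (- dvert A) (- dvert B).
Proof.
apply/funext => -[]; apply/funext => -[]; apply/funext => l; rewrite /of1 /=.
- by rewrite (@dV_fval _ _ _ (0 : tens)) // dvert0 fJ0 scaler0.
- by rewrite (@dV_fval _ _ _ B) // expr1 scaleN1r.
- by rewrite (@dV_fval _ _ _ A) // expr1 scaleN1r.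
- by rewrite (@dV_fval _ _ _ (0 : tens)) // dvert0 fJ0 scaler0.
Qed.

Lemma dV_of2 A : dV (of2 A) = of2 (dvert A).
Proof.
apply/funext => -[]; apply/funext => -[]; apply/funext => l; rewrite /of2 /=.
- by rewrite (@dV_fval _ _ _ A) // sqrrN expr1n scale1r.
- by rewrite (@dV_fval _ _ _ (0 : tens)) // dvert0 fJ0 scaler0.
- by rewrite (@dV_fval _ _ _ (0 : tens)) // dvert0 fJ0 scaler0.
- by rewrite (@dV_fval _ _ _ (0 : tens)) // dvert0 fJ0 scaler0.
Qed.

Notation Q0 Q := (@theta0 J (@fun0 J Q)).

Lemma dx_theta0 (Q : S) : dx_wedge (theta_wedge 0 (fun_form (fval Q))) = of1 (Q0 Q) 0.
Proof.
have e (c : bool) l : theta_wedge 0 (fun_form (fval Q)) c false l =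
    if c then 0 else fval (Q0 Q l).
  rewrite /theta_wedge; case: c.
    by rewrite big1 ?scaler0 // => j _; rewrite /fun_form /= scaler0.
  rewrite expr0 scale1r; case: l => [|i l]; first by rewrite big_ord0.
  rewrite big_mkcond big_ord_recl /= expr0 scale1r /del /= drop0.
  rewrite big1 ?addr0 => [|j _]; last first.
    by case: ifP => // _; rewrite /fun_form /= scaler0.
  by case: i => [|i] //=; rewrite /fun_form /=; case: l.
apply/funext => -[]; apply/funext => -[]; apply/funext => l; rewrite /dx_wedge /of1 /=.
- by rewrite e scaler0.
- by [].
- by rewrite e expr0 scale1r.
- by [].
Qed.

Lemma normal_formE (Q : S) A :
  normal_form (fval Q) (of0 A) = of1 (Q0 Q) (- A).
Proof.
rewrite /normal_form dx_theta0.
have -> : dt_wedge (of0 A) = of1 0 A.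
  by apply/funext => -[]; apply/funext => -[].
by rewrite form_subE of1B subr0 sub0r.
Qed.

Definition cst_fun (r : R) : J := mksmooth (@smooth_cst R nat r).

Lemma vfieldS_cst (b : Defs.coord nat) (a : nat -> S) r : vfieldS b a (mksmooth (@smooth_cst R nat r)) = 0.
Proof.
have d0 c : pdS c (mksmooth (@smooth_cst R nat r)) = 0.
  by apply: fval_inj; apply: is_pdE => p; exact: is_derive_cst.
by rewrite (@vfieldS_nat R b a _ 0) // big_ord0 addr0.
Qed.

Lemma XV_cst r A : XV (scal (cst_fun r) A) = scal (cst_fun r) (XV A).
Proof. by rewrite XV_scal [tdx J _]vfieldS_cst scal0l add0r. Qed.
Lemma tdtV_cst r s A : vform s A -> tdtV (scal (cst_fun r) A) = scal (cst_fun r) (tdtV A).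
Proof.
move=> [_ _ [N bA]]; rewrite (tdtVE bA) (tdtVE (bounded_scal _ bA)).
by rewrite TV_scal [tdt J _]vfieldS_cst scal0l add0r.
Qed.
Lemma vform_cst r s A : vform s A -> vform s (scal (cst_fun r) A).
Proof.
move=> [dA aA [N bA]]; split; [exact: degree_scal|exact: alternating_scal|].
by exists N; exact: bounded_scal.
Qed.
Lemma of1Z r A B : r *: of1 A B = of1 (scal (cst_fun r) A) (scal (cst_fun r) B).
Proof.
apply/funext => -[]; apply/funext => -[]; apply/funext => l; rewrite /of1 /=.
- by rewrite formZ scaler0.
- by apply/funext.
- by apply/funext.
- by rewrite formZ scaler0.
Qed.


Lemma of2Z r A : r *: of2 A = of2 (scal (cst_fun r) A).
Proof.
apply/funext => -[]; apply/funext => -[]; apply/funext => l; rewrite /of2 /=.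
- by apply/funext.
- by rewrite formZ scaler0.
- by rewrite formZ scaler0.
- by rewrite formZ scaler0.
Qed.

(** * Cohomology classes *)
Lemma exact1P s w : dH_exact K 1 s w <->
  exists2 rho, vform s rho & w = of1 (XV rho) (tdtV rho).
Proof.
split=> [[v /Omega0P[A vA ->] <-]|[A vA ->]].
  by exists A => //; rewrite (dH_of0 vA).
by exists (of0 A); [apply/Omega0P; exists A|rewrite (dH_of0 vA)].
Qed.

Lemma exact2P s w : dH_exact K 2 s w <->
  exists A B, [/\ vform s A, vform s B & w = of2 (tdtV A - XV B)].
Proof.
split=> [[v /Omega1P[A [B [vA vB ->]]] <-]|[A [B [vA vB ->]]]].
  by exists A, B; rewrite (dH_of1 vA vB).
by exists (of1 A B); [apply/Omega1P; exists A, B|rewrite (dH_of1 vA vB)].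
Qed.

Lemma closed1P s w : dH_closed K 1 s w <->
  exists A B, [/\ vform s A, vform s B, tdtV A = XV B & w = of1 A B].
Proof.
split=> [[/Omega1P[A [B [vA vB ->]]]]|[A [B [vA vB e ->]]]].
  rewrite (dH_of1 vA vB) form_zeroE -of2_0 => /of2_inj/eqP; rewrite subr_eq0 => /eqP e.
  by exists A, B.
split; first by apply/Omega1P; exists A, B.
by rewrite (dH_of1 vA vB) e subrr form_zeroE of2_0.
Qed.

Lemma exact1_submodule s : submodule (dH_exact K 1 s : set (form R)).
Proof.
split.
- apply/exact1P; exists 0; first exact: vform0.
  by rewrite raddf0 tdtV0 of1_0.
- move=> _ _ /exact1P[r vr ->] /exact1P[r' vr' ->]; apply/exact1P; exists (r - r').
    exact: vformB.
  by rewrite of1B raddfB (tdtVB vr vr').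
- move=> a _ /exact1P[A vA ->]; apply/exact1P; exists (scal (cst_fun a) A).
    exact: vform_cst.
  by rewrite of1Z XV_cst (tdtV_cst _ vA).
Qed.

Lemma Omega1_submodule s : submodule (@Omega R 1 s : set (form R)).
Proof.
split.
- apply/Omega1P; exists 0, 0; split; [exact: vform0|exact: vform0|].
  by rewrite of1_0.
- move=> _ _ /Omega1P[A [B [vA vB ->]]] /Omega1P[A' [B' [vA' vB' ->]]].
  apply/Omega1P; exists (A - A'), (B - B').
  by split; [exact: vformB|exact: vformB|rewrite of1B].
- move=> a _ /Omega1P[A [B [vA vB ->]]].
  apply/Omega1P; exists (scal (cst_fun a) A), (scal (cst_fun a) B).
  by split; [exact: vform_cst|exact: vform_cst|rewrite of1Z].
Qed.

Lemma closed1_submodule s : submodule (dH_closed K 1 s : set (form R)).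
Proof.
split.
- apply/closed1P; exists 0, 0; split; [exact: vform0|exact: vform0| |].
    by rewrite tdtV0 raddf0.
  by rewrite of1_0.
- move=> _ _ /closed1P[A [B [vA vB e ->]]] /closed1P[A' [B' [vA' vB' e' ->]]].
  apply/closed1P; exists (A - A'), (B - B'); split; [exact: vformB|exact: vformB| |].
    by rewrite (tdtVB vA vA') e e' raddfB.
  by rewrite of1B.
- move=> a _ /closed1P[A [B [vA vB e ->]]].
  apply/closed1P; exists (scal (cst_fun a) A), (scal (cst_fun a) B).
  split; [exact: vform_cst|exact: vform_cst| |].
    by rewrite (tdtV_cst _ vA) e XV_cst.
  by rewrite of1Z.
Qed.

Lemma exact2_submodule s : submodule (dH_exact K 2 s : set (form R)).
Proof.
split.
- apply/exact2P; exists 0, 0; split; [exact: vform0|exact: vform0|].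
  by rewrite tdtV0 raddf0 subrr of2_0.
- move=> _ _ /exact2P[A [B [vA vB ->]]] /exact2P[A' [B' [vA' vB' ->]]].
  apply/exact2P; exists (A - A'), (B - B'); split; [exact: vformB|exact: vformB|].
  rewrite of2B (tdtVB vA vA') [XV (_ - _)]raddfB /=.
  by rewrite subrACA.
- move=> a _ /exact2P[A [B [vA vB ->]]].
  apply/exact2P; exists (scal (cst_fun a) A), (scal (cst_fun a) B).
  split; [exact: vform_cst|exact: vform_cst|].
  rewrite of2Z (tdtV_cst _ vA) XV_cst; congr (of2 _).
  by apply/funext => l; rewrite /scal mulrDr mulrN.
Qed.

Lemma exact1_closed s : dH_exact K 1 s `<=` dH_closed K 1 s.
Proof.
move=> _ /exact1P[r vr ->]; apply/closed1P; exists (XV r), (tdtV r).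
by split=> //; [exact: vform_XV|exact: vform_tdtV|rewrite (XV_tdtV vr)].
Qed.

Lemma closed_Omega s : dH_closed K 1 s `<=` @Omega R 1 s.
Proof. by move=> w []. Qed.

Lemma dV_exact s w : dH_exact K 1 s w -> dH_exact K 1 s.+1 (dV w).
Proof.
move=> /exact1P[r vr ->]; apply/exact1P; exists (- dvert r).
  exact/vformN/vform_dvert.
by rewrite dV_of1 dvert_XV (dvert_tdtV vr) raddfN (tdtVN (vform_dvert vr)).
Qed.

Lemma dV_closed s w : dH_closed K 1 s w -> dH_closed K 1 s.+1 (dV w).
Proof.
move=> /closed1P[A [B [vA vB e ->]]]; apply/closed1P.
exists (- dvert A), (- dvert B); split.
- exact/vformN/vform_dvert.
- exact/vformN/vform_dvert.
- by rewrite (tdtVN (vform_dvert vA)) -(dvert_tdtV vA) e raddfN dvert_XV.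
- exact: dV_of1.
Qed.

Lemma dVB s v w : Omega 1 s v -> Omega 1 s w ->
  dV (v - w) = (dV v : form R) - dV w.
Proof.
move=> /Omega1P[A [B [vA vB ->]]] /Omega1P[A' [B' [vA' vB' ->]]].
have dNB (C C' : tens) : - dvert (C - C') = - dvert C - - dvert C'.
  by rewrite [dvert (_ - _)]raddfB /= opprD.
by rewrite of1B !dV_of1 of1B !dNB.
Qed.

Lemma dV_lin s (r : R) v w : Omega 1 s v -> Omega 1 s w ->
  dV (r *: v + w) = r *: (dV v : form R) + dV w.
Proof.
move=> /Omega1P[A [B [vA vB ->]]] /Omega1P[A' [B' [vA' vB' ->]]].
have dNL (C C' : tens) : - dvert (scal (cst_fun r) C + C') =
    scal (cst_fun r) (- dvert C) + - dvert C'.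
  rewrite [dvert (_ + _)]raddfD /= opprD; congr (_ + _); apply/funext => l.
  rewrite -[LHS]/(- (dvert (scal (cst_fun r) C) l)) dvert_scal.
  rewrite -[RHS]/(cst_fun r * - dvert C l).
  have -> : dwedge (cst_fun r) l C = 0.
    elim: l C => [|i l IH] C //=; rewrite IH subr0.
    have -> : pu J i (cst_fun r) = 0.
      by apply: fval_inj; apply: is_pdE => p; exact: is_derive_cst.
    exact: mul0r.
  by rewrite add0r -mulrN.
by rewrite of1Z of1D !dV_of1 of1Z of1D !dNL.
Qed.

Lemma dV_dV s w : Omega 1 s w -> dV (dV w) = 0 :> form R.
Proof.
move=> /Omega1P[A [B [vA vB ->]]].
have ddN (C : tens) : - dvert (- dvert C) = 0.
  by rewrite [dvert (- _)]raddfN /= dvert_dvert !oppr0.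
by rewrite !dV_of1 !ddN of1_0.
Qed.

Lemma cls_eqP s v w : cls K 1 s v = cls K 1 s w <-> dH_exact K 1 s (v - w).
Proof. by rewrite /cls !coset_modE; exact: coset_eqP (exact1_submodule s). Qed.

Lemma cls2_eqP v w : cls K 2 0 v = cls K 2 0 w <-> dH_exact K 2 0 (v - w).
Proof. by rewrite /cls !coset_modE; exact: coset_eqP (exact2_submodule 0). Qed.

Lemma lin_cls s r v w :
  lin_class r (cls K 1 s v) (cls K 1 s w) = cls K 1 s (r *: v + w).
Proof.
by rewrite /cls !coset_modE lin_classE; exact: coset_lin (exact1_submodule s).
Qed.

Lemma dV_cls_cls s v : Omega 1 s v ->
  dV_cls K 1 s (cls K 1 s v) = cls K 1 s.+1 (dV v).
Proof.
move=> ov; rewrite /cls !coset_modE.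
have EO : dH_exact K 1 s `<=` @Omega R 1 s by move=> w /exact1_closed /closed_Omega.
rewrite -(coset_map (exact1_submodule s) (exact1_submodule s.+1)
  (Omega1_submodule s) EO ov (@dVB s) (@dV_exact s)) /dV_cls.
by apply/seteqP; split=> w [v' hv' hw]; exists v' => //; rewrite form_subE in hw *.
Qed.

Lemma mod_dV_cls v : mod_dV K (cls K 1 1 v) =
  translates (dH_exact K 1 1) (dH_closed K 1 0) (@dV R : form R -> form R) v.
Proof.
rewrite /translates.
apply/seteqP; split=> [c [d [mu hmu <-] <-]|c [mu hmu <-]].
  exists mu; first exact: hmu.
  by rewrite (dV_cls_cls (closed_Omega hmu)) lin_cls scale1r /cls coset_modE.
exists (cls K 1 0 mu); first by exists mu.
by rewrite (dV_cls_cls (closed_Omega hmu)) lin_cls scale1r /cls coset_modE.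
Qed.

Lemma mod_dV_eqP v w :
  mod_dV K (cls K 1 1 v) = mod_dV K (cls K 1 1 w) <->
  exists2 mu, dH_closed K 1 0 mu & dH_exact K 1 1 (v - w - (dV mu : form R)).
Proof.
rewrite !mod_dV_cls; apply: (translates_eqP _ _ (exact1_submodule 1) (closed1_submodule 0)).
by move=> x y /closed_Omega ox /closed_Omega oy; exact: (dVB ox oy).
Qed.


Lemma du_contract_of1 i A B :
  du_contract i (of1 A B) = of1 (- slot i A) (- slot i B).
Proof.
apply/funext => -[]; apply/funext => -[]; apply/funext => l; rewrite /du_contract /of1 /=.
- by rewrite scaler0.
- by rewrite expr1 scaleN1r.
- by rewrite expr1 scaleN1r.
- by rewrite scaler0.
Qed.

Lemma iter_Xform_of1 i A B :
  iter i (@Xform R) (of1 A B) = of1 (iter i (@XV J) A) (iter i (@XV J) B).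
Proof. by elim: i => //= i ->; rewrite Xform_of1. Qed.

Lemma iter_XV0 i : iter i (@XV J) 0 = 0.
Proof. by elim: i => //= i ->; rewrite raddf0. Qed.

(** * The operator delta_V^E *)
Lemma euler_form A N : bounded N A ->
  (fun a b l p => \sum_(i \in [set: nat])
      (-1) ^+ i * iter i (@Xform R) (du_contract i (of1 (- A) 0)) a b l p) =
  of1 (euler N A) 0.
Proof.
move=> bA.
have e i : iter i (@Xform R) (du_contract i (of1 (- A) 0)) =
    of1 (iter i (@XV J) (slot i A)) 0.
  by rewrite du_contract_of1 slotN opprK slot0 oppr0 iter_Xform_of1 iter_XV0.
apply/funext => a; apply/funext => b; apply/funext => l; apply/funext => p.
under eq_fsbigr => i _ do rewrite e.
rewrite (@fsbig_nat N) => [|i iN]; last first.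
  rewrite (bounded_slot0 bA iN) iter_XV0 of1_0 form0.
  exact: mulr0.
have z : \sum_(i < N) (-1) ^+ i * (0 : jet R nat -> R^o) p = 0.
  by rewrite big1 // => i _; exact: mulr0.
case: a; case: b; rewrite /of1; [exact: z|exact: z| |exact: z].
rewrite /euler fct_sumE fJ_sum; apply: eq_bigr => i _.
rewrite iter_nXE -signr_odd; case: (odd i).
  by rewrite expr1 mulN1r.
by rewrite expr0 mul1r.
Qed.

Lemma deltaVE_form (Q : S) N : bounded N (dvert (Q0 Q)) ->
  deltaVE 1 (dx_wedge (theta_wedge 0 (fun_form (fval Q)))) =
  2%:R^-1 *: theta_wedge 0 (of1 (euler N (dvert (Q0 Q))) 0).
Proof.
move=> bD; rewrite dx_theta0 /deltaVE /IE dV_of1 dvert0 oppr0.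
by rewrite (euler_form bD).
Qed.

(** The coefficient on theta^0 /\ theta^k is the Euler operator on theta^k. *)
Lemma deltaVE_eq0_pos (Q : S) N : bounded N (dvert (Q0 Q)) ->
  deltaVE 1 (dx_wedge (theta_wedge 0 (fun_form (fval Q)))) = 0 ->
  forall k, (0 < k)%N -> euler N (dvert (Q0 Q)) [:: k] = 0.
Proof.
move=> bD h k k0; apply: fval_inj; apply/funext => p.
have : deltaVE 1 (dx_wedge (theta_wedge 0 (fun_form (fval Q))))
    false true [:: 0%N; k] p = 0 by rewrite h.
rewrite (deltaVE_form bD).
have -> : (2%:R^-1 *: theta_wedge 0 (of1 (euler N (dvert (Q0 Q))) 0))
   false true [:: 0%N; k] p = 2%:R^-1 * - fval (euler N (dvert (Q0 Q)) [:: k]) p.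
  rewrite /theta_wedge; congr (_ * _).
  rewrite big_mkcond big_ord_recl big_ord1 /= /del /= -[k == 0%N]negbK -lt0n k0 /=.
  by rewrite addr0 expr0 scale1r expr1 scaleN1r.
by move/eqP; rewrite mulf_eq0 invr_eq0 pnatr_eq0 oppr_eq0 => /eqP.
Qed.

Lemma deltaVE_eq0 (Q : S) N : bounded N (dvert (Q0 Q)) ->
  euler N (dvert (Q0 Q)) = 0 ->
  deltaVE 1 (dx_wedge (theta_wedge 0 (fun_form (fval Q)))) = 0.
Proof.
move=> bD e; rewrite (deltaVE_form bD) e of1_0.
apply/funext => a; apply/funext => b; apply/funext => l; apply/funext => p.
rewrite /theta_wedge -[LHS]/(2%:R^-1 * _) big1; last by move=> j _; exact: scaler0.
by rewrite scaler0; exact: mulr0.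
Qed.

(** * The map Lambda *)
Lemma Lambda_graphP c k : Lambda_graph K c k <->
  exists (Q : S) B h, [/\ vform 1 B, vform 0 h, c (dV (of1 (Q0 Q) B)),
    tdtV (Q0 Q) - XV B = dvert h & k = cls K 2 0 (of2 h)].
Proof.
split.
  move=> [Q [gamma [lambda [[sQ /Omega0P[G vG ->] /Omega2P[h vh ->]] [cQ e ->]]]]].
  move: cQ e; rewrite -[Q]/(fval (mksmooth sQ)) normal_formE => cQ e.
  exists (mksmooth sQ), (- G), h; split=> //; first exact: vformN.
  by move: e; rewrite (dH_of1 (@vform_theta0 J (mksmooth sQ)) (vformN vG)) dV_of2 => /of2_inj.
move=> [Q [B [h [vB vh cQ e ->]]]].
exists (fval Q), (of0 (- B)), (of2 h); split; first split.
- exact: fval_smooth.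
- by apply/Omega0P; exists (- B) => //; exact: vformN.
- by apply/Omega2P; exists h.
- rewrite normal_formE opprK; split=> //.
  by rewrite (dH_of1 (@vform_theta0 J Q) vB) e dV_of2.
Qed.

Lemma theta0_funB (Q Q' : S) : Q0 Q - Q0 Q' = Q0 (Q - Q').
Proof.
have z : (0 : J) - 0 = 0 by rewrite subrr.
by apply/funext => -[|[|i] [|j l]]; rewrite ?addrfctE ?opprfctE /=; try exact: z.
Qed.

Lemma cls_mem_sub s w v v' : cls K 1 s w v -> cls K 1 s w v' -> dH_exact K 1 s (v - v').
Proof.
rewrite /cls coset_modE /coset /= => hv hv'.
have := submoduleB (exact1_submodule s) hv hv'.
by rewrite opprB addrA subrK.
Qed.

Lemma Lambda_graph_unique w k k' : Lambda_graph K (cls K 1 2 w) k ->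
  Lambda_graph K (cls K 1 2 w) k' -> k = k'.
Proof.
move=> /Lambda_graphP[Q [B [h [vB vh cQ e ->]]]].
move=> /Lambda_graphP[Q' [B' [h' [vB' vh' cQ' e' ->]]]].
apply/cls2_eqP; have vQ := @vform_theta0 J Q; have vQ' := @vform_theta0 J Q'.
have /exact1P[rho vr] := cls_mem_sub cQ cQ'.
have dNB (C C' : tens) : - dvert C - - dvert C' = - dvert (C - C').
  by rewrite [dvert (_ - _)]raddfB /= opprD.
rewrite !dV_of1 of1B !dNB => /of1_inj[eA eB].
have [mu [nu [vm vn hh]]] : exists mu nu,
    [/\ vform 0 mu, vform 0 nu & h - h' = tdtV mu - XV nu].
  apply: (@Lambda_well_defined J (Q0 Q - Q0 Q') (B - B') (- rho)).
  - exact: vformB.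
  - exact: vformB.
  - exact: vformN.
  - exact: vformB.
  - by rewrite raddfN /= -eA opprK.
  - by rewrite (tdtVN vr) -eB opprK.
  - rewrite (tdtVB vQ vQ') [XV (_ - _)]raddfB [dvert (h - h')]raddfB /= -e -e'.
    by rewrite subrACA.
by apply/exact2P; exists mu, nu; rewrite of2B hh.
Qed.

Lemma LambdaE w k : Lambda_graph K (cls K 1 2 w) k -> Lambda K (cls K 1 2 w) = k.
Proof.
move=> hk; rewrite /Lambda; case: xgetP => [k' _ /= hk'|/(_ k) //].
exact: Lambda_graph_unique hk' hk.
Qed.

(** * Representatives and the kernel of dV *)
Lemma H11_normal v : dH_closed K 1 1 v ->
  exists (Q : S) B, [/\ vform 1 B, tdtV (Q0 Q) = XV B & dH_exact K 1 1 (v - of1 (Q0 Q) B)].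
Proof.
move=> /closed1P[A [B [vA vB e ->]]].
have [Q [C [vC eA]]] := byparts1 vA.
exists Q, (B - tdtV C); split.
- by apply: vformB => //; exact: vform_tdtV.
- rewrite [XV (_ - _)]raddfB /= -e eA (tdtVD (@vform_theta0 J Q) (vform_XV vC)).
  by rewrite (XV_tdtV vC) addrK.
- apply/exact1P; exists C => //; rewrite of1B eA addrC addKr.
  by rewrite opprB addrCA subrr addr0.
Qed.

Lemma H12_normal w : dH_closed K 1 2 w ->
  exists (Q : S) B h, [/\ vform 1 B, vform 0 h,
    dH_exact K 1 2 (w - dV (of1 (Q0 Q) B)) & tdtV (Q0 Q) - XV B = dvert h].
Proof.
move=> /closed1P[A [B [vA vB e ->]]].
have [Q [gamma [rho [h [vg vr vh eA [eB eh]]]]]] := H12_representative vA vB e.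
(* dV (dx /\ A) = - dx /\ d_V A, hence the signs. *)
have Q0N : Q0 (- Q) = - Q0 Q.
  by rewrite -sub0r -theta0_funB -[RHS]sub0r; congr (_ - _);
     apply/funext => -[|[|i] [|j l]].
exists (- Q), (- gamma), (- h); split; [exact: vformN|exact: vformN| |].
  apply/exact1P; exists rho => //.
  rewrite Q0N dV_of1 of1B ![dvert (- _)]raddfN /= !opprK eA eB.
  by rewrite ![_ + _ - _]addrC !addKr.
rewrite Q0N (tdtVN (@vform_theta0 J Q)) [XV (- _)]raddfN [dvert (- _)]raddfN /= -eh.
by rewrite opprD.
Qed.

Lemma dV_exact_inj v : dH_closed K 1 1 v -> dH_exact K 1 2 (dV v) ->
  exists2 mu, dH_closed K 1 0 mu & dH_exact K 1 1 (v - (dV mu : form R)).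
Proof.
move=> /closed1P[A [B [vA vB e ->]]] /exact1P[rho vr].
rewrite dV_of1 => /of1_inj[eA _].
have [|mu [nu [sigma [vm vn vs eA' [eB' emn]]]]] := dV_kernel vA vB (vformN vr) e.
  by rewrite raddfN /= -eA opprK.
exists (of1 (- mu) (- nu)).
  apply/closed1P; exists (- mu), (- nu); split=> //; try exact: vformN.
  by rewrite (tdtVN vm) emn raddfN.
apply/exact1P; exists sigma => //.
rewrite dV_of1 of1B ![dvert (- _)]raddfN /= !opprK eA' eB'.
by rewrite ![_ + _ - _]addrC !addKr.
Qed.

(** * The two bijections *)
Definition induced_dV (C : set (set (bform R))) : set (bform R) :=
  dV_cls K 1 1 (xget set0 [set c | Hcoh K 1 1 c /\ mod_dV K c = C]).

Lemma induced_dVE v : dH_closed K 1 1 v ->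
  induced_dV (mod_dV K (cls K 1 1 v)) = cls K 1 2 (dV v).
Proof.
move=> hv; rewrite /induced_dV; case: xgetP => [c0 _ [[v0 hv0 <-]]|h]; last first.
  by case: (h (cls K 1 1 v)); split => //; exists v.
move=> /mod_dV_eqP[mu hmu hex].
have ov := closed_Omega hv; have ov0 := closed_Omega hv0.
rewrite (dV_cls_cls ov0); apply/cls_eqP.
have odmu := closed_Omega (dV_closed hmu).
have ovv := submoduleB (Omega1_submodule 1) ov0 ov.
have := dV_exact hex; rewrite (dVB ovv odmu) (dVB ov0 ov).
by rewrite (dV_dV (closed_Omega hmu)) subr0.
Qed.

(** If eta is closed, lambda = 0 satisfies dH eta = dV lambda. *)
Lemma Lambda_dV v : dH_closed K 1 1 v -> ker_Lambda K (cls K 1 2 (dV v)).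
Proof.
move=> hv; split; first by exists (dV v) => //; exact: dV_closed.
have [Q [B [vB e hex]]] := H11_normal hv.
have h0 : Lambda_graph K (cls K 1 2 (dV v)) (cls K 2 0 (of2 0)).
  apply/Lambda_graphP; exists Q, B, 0; split=> //; first exact: vform0.
    have ov := closed_Omega hv.
    have oQ : Omega 1 1 (of1 (Q0 Q) B).
      by apply/Omega1P; exists (Q0 Q), B; split=> //; exact: vform_theta0.
    rewrite /cls coset_modE /coset /= -opprB.
    apply: (submoduleN (exact1_submodule _)).
    by rewrite -(dVB ov oQ); exact: dV_exact.
  by rewrite e subrr raddf0.
by rewrite (LambdaE h0) of2_0 form_zeroE.
Qed.

(** The value of Lambda is h with dH eta = dV h; if h = dH mu then
    eta + dV mu is closed, with the same vertical differential as eta. *)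
Lemma ker_Lambda_dV c : ker_Lambda K c ->
  exists2 v, dH_closed K 1 1 v & c = cls K 1 2 (dV v).
Proof.
move=> [[w hw <-]].
have [Q [B [h [vB vh hex e]]]] := H12_normal hw.
have hg : Lambda_graph K (cls K 1 2 w) (cls K 2 0 (of2 h)).
  apply/Lambda_graphP; exists Q, B, h; split=> //.
  rewrite /cls coset_modE /coset /= -opprB.
  exact: (submoduleN (exact1_submodule _) hex).
rewrite (LambdaE hg) form_zeroE => /cls2_eqP; rewrite subr0.
move=> /exact2P[f [g [vf vg /of2_inj eh]]].
exists (of1 (Q0 Q - dvert f) (B - dvert g)).
  apply/closed1P; exists (Q0 Q - dvert f), (B - dvert g).
  have vQ := @vform_theta0 J Q.
  split=> //; try exact: vformB (vform_dvert _).
  rewrite (tdtVB vQ (vform_dvert vf)) [XV (_ - _)]raddfB /=.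
  apply/eqP; rewrite -subr_eq0 subrACA e eh -(dvert_tdtV vf) -dvert_XV.
  by rewrite [dvert (_ - _)]raddfB /= subrr.
apply/cls_eqP; rewrite (_ : dV (of1 (Q0 Q - dvert f) (B - dvert g)) = dV (of1 (Q0 Q) B)) //.
by rewrite !dV_of1 ![dvert (_ - _)]raddfB /= !dvert_dvert !subr0.
Qed.

Lemma induced_dV_bij : set_bij (H11_mod_dV K) (ker_Lambda K) induced_dV.
Proof.
split.
- by move=> _ [_ [v hv <-] <-]; rewrite /= (induced_dVE hv); exact: Lambda_dV.
- move=> _ _ /set_mem[_ [v hv <-] <-] /set_mem[_ [v' hv' <-] <-].
  rewrite (induced_dVE hv) (induced_dVE hv') => /cls_eqP hex.
  apply/mod_dV_eqP; apply: dV_exact_inj.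
    exact: (submoduleB (closed1_submodule 1) hv hv').
  by rewrite (dVB (closed_Omega hv) (closed_Omega hv')).
- move=> c /ker_Lambda_dV[v hv ->].
  exists (mod_dV K (cls K 1 1 v)); last by rewrite (induced_dVE hv).
  by exists (cls K 1 1 v) => //; exists v.
Qed.

(** Two normal forms in a class differ by (Q - Q') theta^0 = X C, which forces
    Q = Q'. *)
Lemma char_fun_of1 (Q : S) B v : vform 1 B -> dH_exact K 1 1 (v - of1 (Q0 Q) B) ->
  char_fun (cls K 1 1 v) = fval Q.
Proof.
move=> vB hex; rewrite /char_fun; case: xgetP => [Q' _ /= [sQ' [_ /Omega0P[G vG ->]]]|h].
  rewrite -[Q']/(fval (mksmooth sQ')) normal_formE => hc; congr fval.
  have hc' : cls K 1 1 v (of1 (Q0 Q) B).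
    rewrite /cls coset_modE /coset /= -opprB.
    exact: (submoduleN (exact1_submodule _) hex).
  have /exact1P[C vC] := cls_mem_sub hc hc'.
  rewrite of1B theta0_funB => /of1_inj[eC _].
  by have := theta0_inj_mod_XV vC eC => /eqP; rewrite subr_eq0 => /eqP.
exfalso; apply: (h (fval Q)); split; first exact: fval_smooth.
exists (of0 (- B)); first by apply/Omega0P; exists (- B) => //; exact: vformN.
rewrite normal_formE opprK /cls coset_modE /coset /= -opprB.
exact: (submoduleN (exact1_submodule _) hex).
Qed.

Lemma closed_of1 A B : vform 1 A -> vform 1 B -> tdtV A = XV B ->
  dH_closed K 1 1 (of1 A B).
Proof. by move=> vA vB e; apply/closed1P; exists A, B. Qed.

(** Both sides say that d_V (Q theta^0) is X-exact. *)
Lemma deltaVE_exactP (Q : S) B : vform 1 B -> tdtV (Q0 Q) = XV B ->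
  deltaVE 1 (dx_wedge (theta_wedge 0 (fun_form (fval Q)))) = 0 <->
  exists2 mu, dH_closed K 1 0 mu & dH_exact K 1 1 (of1 (Q0 Q) B - (dV mu : form R)).
Proof.
move=> vB e; have vQ := @vform_theta0 J Q.
have vD := vform_dvert vQ; have [_ _ [N bD]] := vD.
have hcl := closed_of1 vQ vB e.
split=> [h|[mu hmu hex]].
  have [C vC eC] := exact_of_euler_pos vD bD (deltaVE_eq0_pos bD h).
  apply: dV_exact_inj => //.
  apply/exact1P; exists (- C); first exact: vformN.
  by rewrite dV_of1 (dvert_exact_dt vQ vB vC e eC) eC raddfN (tdtVN vC).
apply: (deltaVE_eq0 bD).
have := dV_exact hex; rewrite (dVB (closed_Omega hcl) (closed_Omega (dV_closed hmu))).
rewrite (dV_dV (closed_Omega hmu)) subr0 dV_of1 => /exact1P[C vC /of1_inj[eC _]].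
apply: (exact_euler0 bD (vformN vC)).
by rewrite raddfN /= -eC opprK.
Qed.

Lemma char_equation_conserved (Q : S) :
  ((fun p => Fre_adj (fval Q) (Delta K) p - Fre (fval Q) (Delta K) p) =
    Euler (fun p => to_J (fval Q) p * Delta K p)) <->
  exists2 B, vform 1 B & tdtV (Q0 Q) = XV B.
Proof.
rewrite (@char_equationP R Kf Q n) => [|i ni]; last exact: pu_rhsS K_order i ni.
exact: iff_sym (@conserved_charP J Q).
Qed.

Lemma char_fun_bij : set_bij
    [set c | Hcoh K 1 1 c /\ mod_dV K c <> mod_dV K (cls K 1 1 0)]
    [set Q | [/\ smooth Q,
                 (fun p => Fre_adj Q (Delta K) p - Fre Q (Delta K) p) =
                 Euler (fun p => to_J Q p * Delta K p) &
                 deltaVE 1 (dx_wedge (theta_wedge 0 (fun_form Q))) <> 0]]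
    (@char_fun R).
Proof.
split.
- move=> _ [[v hv <-] hne] /=.
  have [Q [B [vB e hex]]] := H11_normal hv.
  rewrite (char_fun_of1 vB hex); split; first exact: fval_smooth.
    by apply/char_equation_conserved; exists B.
  move=> /(deltaVE_exactP vB e)[mu hmu hex']; apply: hne.
  rewrite form_zeroE; apply/mod_dV_eqP; exists mu => //.
  have := submoduleD (exact1_submodule 1) hex hex'.
  by rewrite subr0 addrA subrK.
- move=> _ _ /set_mem[[v hv <-] _] /set_mem[[v' hv' <-] _].
  have [Q [B [vB e hex]]] := H11_normal hv.
  have [Q' [B' [vB' e' hex']]] := H11_normal hv'.
  rewrite (char_fun_of1 vB hex) (char_fun_of1 vB' hex') => /fval_inj eQ.
  apply/cls_eqP; rewrite -{Q'}eQ in e' hex'.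
  have eB : B = B'.
    apply/eqP; rewrite -subr_eq0; apply/eqP.
    apply: (@XV_inj_vform J 0); first exact: vformB.
    by rewrite raddfB /= -e -e' subrr.
  have := submoduleB (exact1_submodule 1) hex hex'.
  by rewrite -eB subrACA subrr subr0.
- move=> Q0' [sQ]; rewrite -[Q0']/(fval (mksmooth sQ)); set Q := mksmooth sQ.
  move=> /char_equation_conserved[B vB e] hne.
  have vQ := @vform_theta0 J Q.
  exists (cls K 1 1 (of1 (Q0 Q) B)); last first.
    apply: char_fun_of1 vB _; rewrite subrr.
    exact: submodule0 (exact1_submodule 1).
  split; first by exists (of1 (Q0 Q) B) => //; exact: closed_of1.
  rewrite form_zeroE => /mod_dV_eqP[mu hmu]; rewrite subr0 => hex.
  by apply: hne; apply/(deltaVE_exactP vB e); exists mu.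
Qed.

End Forms.

Theorem corollaryA5 (R : realType) (n : nat) (K : jet R nat -> R^o)
  (n_ge2 : (2 <= n)%N)
  (K_smooth : smooth K)
  (K_order : depends_on (fun i => (i <= n)%N) K)
  (K_sep : forall p, pd (Cu n) K p <> 0) :
  (exists phi : set (set (bform R)) -> set (bform R),
    [/\ forall c, Hcoh K 1 1 c -> phi (mod_dV K c) = dV_cls K 1 1 c,
        forall (a : R) c d, Hcoh K 1 1 c -> Hcoh K 1 1 d ->
          phi (mod_dV K (lin_class a c d)) =
          lin_class a (phi (mod_dV K c)) (phi (mod_dV K d)) &
        set_bij (H11_mod_dV K) (ker_Lambda K) phi]) /\
  set_bij
    [set c | Hcoh K 1 1 c /\ mod_dV K c <> mod_dV K (cls K 1 1 0)]
    [set Q | [/\ smooth Q,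
                 (fun p => Fre_adj Q (Delta K) p - Fre Q (Delta K) p) =
                 Euler (fun p => to_J Q p * Delta K p) &
                 deltaVE 1 (dx_wedge (theta_wedge 0 (fun_form Q))) <> 0]]
    (@char_fun R).
Proof.
have [Kf eK] : exists Kf : smoothfun R nat, K = fval Kf by exists (mksmooth K_smooth).
rewrite {K K_smooth}eK in K_order K_sep *.
split; last exact: (char_fun_bij n_ge2 K_order K_sep).
exists (induced_dV Kf); split.
- move=> _ [v hv <-].
  rewrite (induced_dVE n_ge2 K_order K_sep hv).
  by rewrite (dV_cls_cls n_ge2 K_order K_sep (closed_Omega hv)).
- move=> a _ _ [v hv <-] [w hw <-].
  have hvw := submoduleD (closed1_submodule n_ge2 K_order K_sep 1)
    (submoduleZ (closed1_submodule n_ge2 K_order K_sep 1) a hv) hw.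
  rewrite (lin_cls n_ge2 K_order K_sep) (induced_dVE n_ge2 K_order K_sep hvw).
  rewrite (induced_dVE n_ge2 K_order K_sep hv) (induced_dVE n_ge2 K_order K_sep hw).
  rewrite (lin_cls n_ge2 K_order K_sep); congr (cls _ _ _ _).
  exact: (dV_lin n_ge2 K_order K_sep a (closed_Omega hv) (closed_Omega hw)).
- exact: (induced_dV_bij n_ge2 K_order K_sep).
Qed.
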